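(* Let $c_1\neq c_2\in\mathbb{R}^2$, $m_1\ge m_2>0$, and let $\Omega\subset\mathbb{R}^2$ be a bounded domain (open connected set) containing the closed segment $[c_1,c_2]$, whose boundary $\partial\Omega$ is a real-analytic simple closed curve. Assume that $\partial\Omega$ is not an ellipse with foci $c_1$ and $c_2$. Then, for every energy $h\ge 0$, every real-analytic first integral $\mathcal{F}:M_h\to\mathbb{R}$ of the two-centre billiard map $\mathcal{B}$ in $\Omega$ at energy $h$ is constant.
   Context: Potential and trajectories. $U(x)=\frac{m_1}{|x-c_1|}+\frac{m_2}{|x-c_2|}$. An energy-$h$ trajectory of the two-centre problem is a solution of $\ddot x=\nabla U(x)$ with $\frac12|\dot x|^2-U(x)=h$, continued through collisions with the centres by the following regularisation. Put $d=|c_1-c_2|/2$, $e=(c_2-c_1)/(2d)$, $e^\perp$ the rotation of $e$ by $+\pi/2$, $\mathcal{C}=\mathbb{R}\times\mathbb{R}/2\pi\mathbb{Z}$ and $\Phi:\mathcal{C}\to\mathbb{R}^2$, $\Phi(\xi,\eta)=\frac{c_1+c_2}{2}+d(\cosh\xi\cos\eta\, e+\sinh\xi\sin\eta\, e^\perp)$ (a two-to-one branched covering, with deck transformation $(\xi,\eta)\mapsto(-\xi,-\eta)$, branched over $c_1,c_2$). On $T^*\mathcal{C}$ let $K=\frac12(p_\xi^2+p_\eta^2)-d(m_1+m_2)\cosh\xi+d(m_1-m_2)\cos\eta-hd^2(\cosh^2\xi-\cos^2\eta)$. Away from the centres, the projections by $\Phi$ of the orbits of the Hamiltonian flow of $K$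 on $\{K=0\}$ are exactly the energy-$h$ trajectories up to the time change $dt_{\mathrm{phys}}=|x-c_1||x-c_2|\,dt$; projections of orbits through the branch points define the continuation through collisions. Billiard map. Let $\gamma:\mathbb{S}^1\to\partial\Omega$ be a regular real-analytic parametrisation, $N(\theta)$ the inward unit normal and $T(\theta)=\dot\gamma(\theta)/|\dot\gamma(\theta)|$. $M_h$ is the set of pairs $(\gamma(\theta),v)$ with $\frac12|v|^2-U(\gamma(\theta))=h$ and $v$ pointing strictly into $\Omega$; it is identified with $\mathbb{S}^1\times(-\frac\pi2,\frac\pi2)$ via $v/|v|=\cos\alpha\,N(\theta)+\sin\alpha\,T(\theta)$. For $z\in M_h$ the return time is the first $t>0$ at which the (regularised) trajectory issued from $z$ meets $\partial\Omega$ again ($+\infty$ if it never does). The domain $\mathcal{D}\subset M_h$ of the billiard map consists of the $z$ with finite return time whose trajectory is transversal to $\partial\Omega$ at the return point; for such $z$, $\mathcal{B}(z)\in M_h$ is the return point together with the velocity obtained from the arrival velocity by elastic reflection. A real-analytic first integral of $\mathcal{B}$ is a function $\mathcal{F}:M_h\to\mathbb{R}$, real-analytic in the coordinates $(\theta,\alpha)$, such that $\mathcal{F}(\mathcal{B}(u))=\mathcal{F}(u)$ for every $u\in\mathcal{D}$. *)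

(* Defs.v *)
From Stdlib Require Import Reals ClassicalEpsilon.
From Coquelicot Require Import Coquelicot.
Open Scope R_scope.

(* [norm] on this product normed module is the Euclidean norm. *)
Notation plane := (R * R)%type.

Definition dot (u v : plane) : R := fst u * fst v + snd u * snd v.
Definition rot90 (u : plane) : plane := (- snd u, fst u).
Definition distance (x y : plane) : R := norm (minus x y).

Definition velocity (X : R -> plane) (t : R) : plane :=
  (Derive (fun s => fst (X s)) t, Derive (fun s => snd (X s)) t).

Definition connected (A : plane -> Prop) : Prop :=
  forall U V : plane -> Prop,
    open U -> open V ->
    (forall x, A x -> U x \/ V x) ->
    (exists x, A x /\ U x) -> (exists x, A x /\ V x) ->
    exists x, A x /\ U x /\ V x.

Definition bounded_set (A : plane -> Prop) : Prop :=
  exists M : R, forall x, A x -> norm x <= M.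

Definition boundary (A : plane -> Prop) (x : plane) : Prop :=
  ~ locally x A /\ ~ locally x (fun y => ~ A y).

Definition contains_segment (A : plane -> Prop) (a b : plane) : Prop :=
  forall s : R, 0 <= s <= 1 -> A (plus (scal (1 - s) a) (scal s b)).

(* The semi-major axis [a] must exceed half the focal distance: equality would
   describe the segment joining the foci. *)
Definition is_ellipse_with_foci (f1 f2 : plane) (A : plane -> Prop) : Prop :=
  exists a : R, distance f1 f2 < 2 * a /\
    forall x, A x <-> distance x f1 + distance x f2 = 2 * a.

Definition analytic_at (f : R -> R) (x0 : R) : Prop :=
  exists (a : nat -> R) (r : R), 0 < r /\
    forall x, Rabs (x - x0) < r -> is_pseries a (x - x0) (f x).

(* Absolute convergence of the double power series, summed by total degree. *)
Definition analytic2_at (f : R -> R -> R) (x0 y0 : R) : Prop :=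
  exists (a : nat -> nat -> R) (r : R), 0 < r /\
    forall x y, Rabs (x - x0) < r -> Rabs (y - y0) < r ->
      ex_series (fun n => sum_f_R0
        (fun k => Rabs (a k (n - k)%nat * (x - x0) ^ k * (y - y0) ^ (n - k))) n)
      /\
      is_series (fun n => sum_f_R0
        (fun k => a k (n - k)%nat * (x - x0) ^ k * (y - y0) ^ (n - k)) n)
        (f x y).

(* The circle is R / 2 pi Z, and a map on it is a 2 pi-periodic map on R. *)
Definition analytic_simple_closed_curve (gamma : R -> plane) : Prop :=
  (forall theta, gamma (theta + 2 * PI) = gamma theta) /\
  (forall theta, analytic_at (fun s => fst (gamma s)) theta /\
                 analytic_at (fun s => snd (gamma s)) theta) /\
  (forall theta, velocity gamma theta <> (0, 0)) /\
  (forall s t, gamma s = gamma t -> exists k : Z, s = t + 2 * IZR k * PI).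

Definition parametrises_boundary (gamma : R -> plane) (Omega : plane -> Prop)
  : Prop :=
  analytic_simple_closed_curve gamma /\
  forall x, boundary Omega x <-> exists theta, x = gamma theta.

Definition tangent (gamma : R -> plane) (theta : R) : plane :=
  scal (/ norm (velocity gamma theta)) (velocity gamma theta).

Definition is_inward_normal (Omega : plane -> Prop) (gamma : R -> plane)
    (theta : R) (n : plane) : Prop :=
  norm n = 1 /\ dot n (velocity gamma theta) = 0 /\
  exists eps : R, 0 < eps /\
    forall s, 0 < s < eps -> Omega (plus (gamma theta) (scal s n)).

Definition inward_normal (Omega : plane -> Prop) (gamma : R -> plane)
    (theta : R) : plane :=
  epsilon (inhabits zero) (is_inward_normal Omega gamma theta).

Definition potential (c1 c2 : plane) (m1 m2 : R) (x : plane) : R :=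
  m1 / distance x c1 + m2 / distance x c2.

Definition Phi (c1 c2 : plane) (xi eta : R) : plane :=
  let d := distance c1 c2 / 2 in
  let e := scal (/ (2 * d)) (minus c2 c1) in
  plus (scal (/ 2) (plus c1 c2))
       (scal d (plus (scal (cosh xi * cos eta) e)
                     (scal (sinh xi * sin eta) (rot90 e)))).

Definition Ham (c1 c2 : plane) (m1 m2 h : R) (xi eta pxi peta : R) : R :=
  let d := distance c1 c2 / 2 in
  / 2 * (pxi ^ 2 + peta ^ 2) - d * (m1 + m2) * cosh xi
  + d * (m1 - m2) * cos eta - h * d ^ 2 * (cosh xi ^ 2 - cos eta ^ 2).

(* Orbits are lifted to the universal cover, so that [eta] ranges over R. *)
Definition zero_level_orbit (c1 c2 : plane) (m1 m2 h : R) (a b : R)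
    (xi eta pxi peta : R -> R) : Prop :=
  let H := Ham c1 c2 m1 m2 h in
  forall t, a < t < b ->
    H (xi t) (eta t) (pxi t) (peta t) = 0 /\
    is_derive xi t (Derive (fun p => H (xi t) (eta t) p (peta t)) (pxi t)) /\
    is_derive eta t (Derive (fun p => H (xi t) (eta t) (pxi t) p) (peta t)) /\
    is_derive pxi t (- Derive (fun q => H q (eta t) (pxi t) (peta t)) (xi t)) /\
    is_derive peta t (- Derive (fun q => H (xi t) q (pxi t) (peta t)) (eta t)).

(* [X] is a regularised trajectory on an open interval containing [0, T],
   parametrised by the regularised time. *)
Definition trajectory (c1 c2 : plane) (m1 m2 h : R) (T : R) (X : R -> plane)
  : Prop :=
  exists (a b : R) (xi eta pxi peta : R -> R),
    a < 0 /\ T < b /\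
    zero_level_orbit c1 c2 m1 m2 h a b xi eta pxi peta /\
    forall t, a < t < b -> X t = Phi c1 c2 (xi t) (eta t).

(* dt_phys = |x - c1| |x - c2| dt *)
Definition physical_velocity (c1 c2 : plane) (X : R -> plane) (t : R) : plane :=
  scal (/ (distance (X t) c1 * distance (X t) c2)) (velocity X t).

Definition phase_space (c1 c2 : plane) (m1 m2 h : R) (Omega : plane -> Prop)
    (gamma : R -> plane) (x v : plane) : Prop :=
  exists theta : R, x = gamma theta /\
    / 2 * norm v ^ 2 - potential c1 c2 m1 m2 x = h /\
    0 < dot v (inward_normal Omega gamma theta).

Definition phase_velocity (c1 c2 : plane) (m1 m2 h : R) (Omega : plane -> Prop)
    (gamma : R -> plane) (theta alpha : R) : plane :=
  scal (sqrt (2 * (h + potential c1 c2 m1 m2 (gamma theta))))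
       (plus (scal (cos alpha) (inward_normal Omega gamma theta))
             (scal (sin alpha) (tangent gamma theta))).

Definition reflect (n w : plane) : plane := minus w (scal (2 * dot w n) n).

(* The regularised time is an increasing function of the physical one, so the
   first return does not depend on which of the two is used. *)
Definition is_return_time (Omega : plane -> Prop) (X : R -> plane) (T : R)
  : Prop :=
  0 < T /\ boundary Omega (X T) /\ forall t, 0 < t < T -> ~ boundary Omega (X t).

(* Graph of the billiard map: its domain is the set of [(x, v)] related to
   some [(x', v')]. *)
Definition billiard_map (c1 c2 : plane) (m1 m2 h : R) (Omega : plane -> Prop)
    (gamma : R -> plane) (x v x' v' : plane) : Prop :=
  phase_space c1 c2 m1 m2 h Omega gamma x v /\
  exists (T : R) (X : R -> plane) (theta : R),
    trajectory c1 c2 m1 m2 h T X /\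
    X 0 = x /\ physical_velocity c1 c2 X 0 = v /\
    is_return_time Omega X T /\
    X T = x' /\ x' = gamma theta /\
    let n := inward_normal Omega gamma theta in
    let w := physical_velocity c1 c2 X T in
    dot w n <> 0 /\ v' = reflect n w.

(* Only the values of [F] on the phase space matter. *)
Definition analytic_first_integral (c1 c2 : plane) (m1 m2 h : R)
    (Omega : plane -> Prop) (gamma : R -> plane) (F : plane -> plane -> R)
  : Prop :=
  (forall theta alpha, - (PI / 2) < alpha < PI / 2 ->
     analytic2_at (fun s a =>
       F (gamma s) (phase_velocity c1 c2 m1 m2 h Omega gamma s a)) theta alpha) /\
  (forall x v x' v',
     billiard_map c1 c2 m1 m2 h Omega gamma x v x' v' -> F x' v' = F x v).

(* Main.v *)
(* Elliptic coordinates separate the motion: on [K = 0] there is a constant eps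
   with xi'^2 / 2 = W(xi) + eps and eta'^2 / 2 = V(eta) - eps, where W has its
   minimum W(0) = 0 and V > 0.  If eps > 0, then xi is monotone and the orbit
   passes between the centres; as eps -> 0 this takes longer and longer while
   eta winds around.  Near the boundary point gamma(s0) that minimises the sum
   of the distances to the centres, comparing the two travel times (intermediate
   value theorem) yields, for all s and s1, such flights from gamma(s) to
   gamma(s1) with eps -> 0.  They depart at angles tending to
   tau (+-phi(s) - psi(s)) and arrive at -tau (+-phi(s1) - psi(s1)), where
   psi(s) = 0 iff the boundary is tangent at gamma(s) to a confocal ellipse; in
   particular psi(s0) = 0.  So F(gamma(s), .) takes the value
   F(gamma(s0), -tau phi(s0)) at both tau (phi(s) - psi(s)) and
   tau (phi(s) + psi(s)), and at the former to an order k independent of s.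
   If k is finite, then psi <> 0 arbitrarily close to s0, since otherwise the
   boundary would be an ellipse by analyticity; the two points are distinct and
   merge as s -> s0, so by Rolle the k-th derivative vanishes at s0, which is
   absurd.  Hence F is constant near s0, and everywhere by analyticity. *)
Require Import Defs.
From Stdlib Require Import Reals Lra Lia ZArith Classical ClassicalEpsilon.
From Coquelicot Require Import Coquelicot.
Open Scope R_scope.

(* [lra] treats [Rmin] as opaque: supply its bounds. *)
Ltac pose_Rmin a b :=
  lazymatch goal with
  | _ : Rmin a b <= a |- _ => fail
  | _ => pose proof (Rmin_l a b); pose proof (Rmin_r a b)
  end.
Ltac Rmin_lra :=
  repeat match goal with
  | |- context [Rmin ?a ?b] => pose_Rmin a b
  | _ : context [Rmin ?a ?b] |- _ => pose_Rmin a b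
  end; lra.

(** The minimum of the focal sum is what makes the flights legal. The interior of the confocal
    ellipse through [gamma s0] lies in the domain, so the orbit meets no boundary point while [|xi|]
    is below its value there. Near the two ends the boundary is almost a level curve of [xi],
    whereas the orbit crosses such curves with a slope bounded below uniformly in [eps]; hence the
    prescribed end point is the first return. The signs come from [h >= 0] and [m2 > 0]: they give
    [W] its minimum at 0 and keep [V] away from 0, so that for small [eps] neither coordinate turns
    back. The obstacle is that the energies with equal travel times are only known to exist
    arbitrarily close to 0 and need not form a curve. Two analytic functions are thus compared along
    a mere sequence of angles, which preserves the limit value and the order of vanishing but no
    single derivative. Hence the bookkeeping by orders: at one of the two merging points the
    derivatives of order 1 to [k - 1] vanish, at the other only the value is used, and together this
    is what Rolle's theorem needs. *)

(** * Elementary facts on neighbourhoods, signs and continuity *)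

Lemma locally_plane (x : plane) (P : plane -> Prop) :
  locally x P <-> exists e, 0 < e /\
    forall y : plane, Rabs (fst y - fst x) < e -> Rabs (snd y - snd x) < e -> P y.
Proof.
  split.
  - intros [e He]. exists e. split; [apply e|]. intros y H1 H2. apply He. now split.
  - intros [e [He H]]. exists (mkposreal e He). intros y [H1 H2]. now apply H.
Qed.

Lemma locally_R (x : R) (P : R -> Prop) :
  locally x P <-> exists e, 0 < e /\ forall y, Rabs (y - x) < e -> P y.
Proof.
  split.
  - intros [e He]. exists e. split; [apply e|]. intros y H1. now apply He.
  - intros [e [He H]]. exists (mkposreal e He). intros y H1. now apply H.
Qed.

Lemma Rabs_self_lt (x e : R) : 0 < e -> Rabs (x - x) < e.
Proof. now rewrite Rminus_diag, Rabs_R0. Qed.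

Definition is_sign (sg : R) : Prop := sg = 1 \/ sg = -1.

Lemma is_sign_1 : is_sign 1.
Proof. now left. Qed.

Lemma is_sign_m1 : is_sign (-1).
Proof. now right. Qed.

Lemma sign_sqr (sg : R) : is_sign sg -> sg * sg = 1.
Proof. intros [-> | ->]; ring. Qed.

Lemma sqr_sum_nonneg (a b : R) : 0 <= a ^ 2 + b ^ 2.
Proof. apply Rplus_le_le_0_compat; apply pow2_ge_0. Qed.

Lemma sqr_sum_pos (a b : R) : ~ (a = 0 /\ b = 0) -> 0 < a ^ 2 + b ^ 2.
Proof. intros H. apply Rnot_le_lt. intros Hle. apply H. split; nra. Qed.

Lemma Rabs_sum_pos (a b : R) : 0 < a ^ 2 + b ^ 2 -> 0 < Rabs a + Rabs b.
Proof.
  rewrite <- (pow2_abs a), <- (pow2_abs b). assert (Ha := Rabs_pos a). assert (Hb := Rabs_pos b). nra.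
Qed.

Lemma even_Rabs (f : R -> R) (x : R) : (forall x, f (- x) = f x) -> f (Rabs x) = f x.
Proof. intros Hf. unfold Rabs. destruct (Rcase_abs x); [apply Hf|reflexivity]. Qed.

Lemma continuous_eps (f : R -> R) (x e : R) :
  continuous f x -> 0 < e ->
  exists d, 0 < d /\ forall y, Rabs (y - x) < d -> Rabs (f y - f x) < e.
Proof.
  intros Hf He. apply locally_R. apply (Hf (fun z => Rabs (z - f x) < e)).
  exists (mkposreal e He). intros z Hz. exact Hz.
Qed.

Lemma continuous_between (f : R -> R) (x a b : R) : continuous f x -> a < f x < b ->
  exists d, 0 < d /\ forall y, Rabs (y - x) < d -> a < f y < b.
Proof.
  intros Hf Hx. destruct (continuous_eps f x (Rmin (f x - a) (b - f x)) Hf) as [d [Hd H]].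
  { apply Rmin_pos; lra. }
  exists d. split; [exact Hd|]. intros y Hy. specialize (H y Hy). apply Rabs_def2 in H. split; Rmin_lra.
Qed.

Lemma between_ball (z r a b c : R) :
  Rabs (a - z) < r -> Rabs (b - z) < r -> Rmin a b <= c <= Rmax a b -> Rabs (c - z) < r.
Proof.
  intros Ha Hb. apply Rabs_def2 in Ha, Hb. unfold Rmin, Rmax.
  destruct (Rle_dec a b); intros; apply Rabs_def1; lra.
Qed.

Lemma mean_value (f df : R -> R) (z r a b : R) :
  (forall c, Rabs (c - z) < r -> is_derive f c (df c)) -> Rabs (a - z) < r -> Rabs (b - z) < r ->
  exists c, Rabs (c - z) < r /\ f a - f b = df c * (a - b).
Proof.
  intros Hf Ha Hb.
  assert (Hin := fun c => between_ball z r b a c Hb Ha).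
  destruct (MVT_gen f b a df) as [c [Hc E]].
  - intros c Hc. apply Hf, Hin. lra.
  - intros c Hc. apply derivable_continuous_pt. exists (df c). now apply is_derive_Reals, Hf, Hin.
  - exists c. split; [now apply Hin|exact E].
Qed.

Lemma norm_plane (u : plane) : norm u = sqrt (fst u ^ 2 + snd u ^ 2).
Proof.
  unfold norm; simpl; unfold prod_norm; simpl. unfold norm; simpl; unfold abs; simpl.
  now rewrite !Rmult_1_r, <- !Rabs_mult, !(Rabs_pos_eq (_ * _)) by apply Rle_0_sqr.
Qed.

Lemma continuous_of_derive (f : R -> R) (x : R) : ex_derive f x -> continuous f x.
Proof. apply (ex_derive_continuous (K := R_AbsRing) (V := R_NormedModule)). Qed.

(** * Real-analytic functions *)

(** The series converges at the midpoint [y] between [Rabs x] and [r], so its terms there tend to 0,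
    which fails outside the disk of convergence. The radius is therefore at least [y], beyond
    [Rabs x]. *)
Lemma CV_radius_gt (a : nat -> R) (r x : R) :
  (forall y, Rabs y < r -> ex_pseries a y) -> Rabs x < r ->
  Rbar_lt (Rabs x) (CV_radius a).
Proof.
  intros Ha Hx. set (y := (Rabs x + r) / 2).
  assert (Hy0 : 0 <= Rabs x) by apply Rabs_pos.
  assert (Hy : Rabs y = y) by (apply Rabs_pos_eq; unfold y; lra).
  destruct (Rbar_lt_le_dec (CV_radius a) (Rabs y)) as [H|H].
  - exfalso. apply (CV_disk_outside a y H).
    assert (E : ex_pseries a y) by (apply Ha; rewrite Hy; unfold y; lra).
    apply ex_series_lim_0 in E. eapply is_lim_seq_ext; [|exact E].
    intros n; simpl. rewrite pow_n_pow. unfold scal; simpl; unfold mult; simpl. ring.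
  - eapply Rbar_lt_le_trans; [|exact H]. rewrite Hy. simpl. unfold y; lra.
Qed.

Lemma CV_radius_local (f : R -> R) (a : nat -> R) (x0 r : R) :
  (forall x, Rabs (x - x0) < r -> is_pseries a (x - x0) (f x)) ->
  forall y, Rabs y < r -> ex_pseries a y /\ Rbar_lt (Rabs y) (CV_radius a).
Proof.
  intros Ha. assert (Hex : forall y, Rabs y < r -> ex_pseries a y).
  { intros y Hy. exists (f (x0 + y)). generalize (Ha (x0 + y)).
    replace (x0 + y - x0) with y by ring. intros H; exact (H Hy). }
  intros y Hy. split; [now apply Hex|now apply CV_radius_gt with r].
Qed.

(** Termwise differentiation in a whole neighbourhood of [x0]: the derivative is again the sum of a
    power series, hence continuous. *)
Lemma analytic_at_C1 (f : R -> R) (x0 : R) :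
  analytic_at f x0 -> ex_derive f x0 /\ continuous (Derive f) x0.
Proof.
  intros [a [r [Hr Ha]]]. assert (HCV := CV_radius_local f a x0 r Ha).
  assert (HD : forall x, Rabs (x - x0) < r -> is_derive f x (PSeries (PS_derive a) (x - x0))).
  { intros x Hx. apply (is_derive_ext_loc (fun z => PSeries a (z - x0))).
    - apply locally_R. exists (r - Rabs (x - x0)). split; [lra|]. intros y Hy.
      apply is_pseries_unique, Ha. replace (y - x0) with ((y - x) + (x - x0)) by ring.
      eapply Rle_lt_trans; [apply Rabs_triang|lra].
    - evar_last.
      + apply (is_derive_comp (PSeries a) (fun z => z - x0)).
        * apply is_derive_PSeries. now apply HCV.
        * auto_derive; [exact I|reflexivity].
      + unfold scal; simpl; unfold mult; simpl. ring. }
  assert (H0 := Rabs_self_lt x0 r Hr).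
  split; [eexists; now apply HD|].
  apply (continuous_ext_loc _ (fun x => PSeries (PS_derive a) (x - x0))).
  - apply locally_R. exists r. split; [exact Hr|]. intros y Hy. symmetry.
    now apply is_derive_unique, HD.
  - apply (continuous_comp (fun x => x - x0) (PSeries (PS_derive a))).
    + apply continuous_of_derive. auto_derive. exact I.
    + apply continuity_pt_filterlim, PSeries_continuity. rewrite CV_radius_derive.
      now apply HCV.
Qed.

Lemma analytic_at_continuous (f : R -> R) (x : R) : analytic_at f x -> continuous f x.
Proof. intros H. apply continuous_of_derive. now apply analytic_at_C1. Qed.

Lemma PSeries_tail_0 (a : nat -> R) (y : R) :
  (forall n, (1 <= n)%nat -> a n = 0) -> ex_pseries a y -> PSeries a y = a O.
Proof.
  intros Ha Hy. rewrite PSeries_decr_1 by exact Hy.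
  rewrite (PSeries_ext _ (fun _ => 0)).
  - rewrite PSeries_const_0. ring.
  - intros n. apply Ha. lia.
Qed.

(** The order is recorded twice. The two-sided growth bound can be tested along a sequence of
    points; the vanishing derivatives are the form required by Rolle's theorem. *)
Definition has_order (f : R -> R) (x0 : R) (k : nat) : Prop :=
  (1 <= k)%nat /\
  (exists m M r, 0 < m /\ 0 < r /\ forall x, Rabs (x - x0) < r ->
     m * Rabs (x - x0) ^ k <= Rabs (f x - f x0) <= M * Rabs (x - x0) ^ k) /\
  (forall j, (1 <= j < k)%nat -> Derive_n f j x0 = 0) /\
  Derive_n f k x0 <> 0.

(** The order is the index [k] of the first nonzero coefficient after the constant one: [f x - f x0]
    is [(x - x0) ^ k] times a power series [b] with [b 0 = a k], which stays near [a k] by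
    continuity. *)
Lemma analytic_dichotomy (f : R -> R) (x0 : R) :
  analytic_at f x0 -> locally x0 (fun x => f x = f x0) \/ exists k, has_order f x0 k.
Proof.
  intros [a [r [Hr Ha]]].
  assert (HCV := CV_radius_local f a x0 r Ha).
  assert (Hf : forall x, Rabs (x - x0) < r -> f x = PSeries a (x - x0)).
  { intros x Hx. symmetry. now apply is_pseries_unique, Ha. }
  assert (Hf0 : f x0 = a O).
  { rewrite Hf; rewrite Rminus_diag, ?Rabs_R0; [apply PSeries_0|lra]. }
  assert (H0r : Rabs 0 < r) by (rewrite Rabs_R0; lra).
  destruct (classic (forall n, (1 <= n)%nat -> a n = 0)) as [Hz|Hnz].
  - left. exists (mkposreal r Hr). intros x Hx.
    rewrite Hf, Hf0 by exact Hx. now apply PSeries_tail_0, HCV.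
  - right. apply not_all_ex_not in Hnz.
    destruct (dec_inh_nat_subset_has_unique_least_element (fun n => (1 <= n)%nat /\ a n <> 0))
      as [k [[[Hk Hak] Hmin] _]].
    { intros n. apply classic. }
    { destruct Hnz as [n Hn]. exists n. now apply imply_to_and in Hn. }
    assert (Hz : forall j, (1 <= j < k)%nat -> a j = 0).
    { intros j Hj. apply NNPP. intros E. assert (k <= j)%nat by (apply Hmin; split; [lia|exact E]). lia. }
    assert (HD : forall j, Derive_n f j x0 = a j * INR (fact j)).
    { intros j. transitivity (Derive_n (fun x => PSeries a (x + - x0)) j x0).
      - apply Derive_n_ext_loc. exists (mkposreal r Hr). intros x Hx. apply Hf. exact Hx.
      - rewrite (Derive_n_comp_trans (PSeries a) j x0 (- x0)).
        rewrite Rplus_opp_r. apply Derive_n_coef.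
        destruct (HCV 0 H0r) as [_ H]. now rewrite Rabs_R0 in H. }
    set (b := PS_decr_n a k).
    assert (Hb : forall y, Rabs y < r -> PSeries a y = a O + y ^ k * PSeries b y).
    { intros y Hy. destruct k as [|k]; [lia|]. rewrite (PSeries_decr_n a k) by now apply HCV.
      f_equal. destruct k as [|k]; [simpl; ring|]. rewrite decomp_sum by lia.
      simpl pred. rewrite (sum_eq _ (fun _ => 0)).
      - rewrite sum_cte. simpl; ring.
      - intros i Hi. rewrite Hz by lia. ring. }
    assert (Hcb : continuous (PSeries b) 0).
    { apply continuity_pt_filterlim, PSeries_continuity.
      apply CV_radius_gt with r; [|exact H0r]. intros y Hy. apply ex_pseries_decr_n; [|now apply HCV].
      destruct (Req_dec y 0) as [E|E]; [now left|right]. exists (/ y). now apply Rinv_l. }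
    assert (Hb0 : PSeries b 0 = a k).
    { rewrite PSeries_0. unfold b, PS_decr_n. f_equal; lia. }
    assert (Hap : 0 < Rabs (a k) / 2).
    { apply Rabs_pos_lt in Hak. lra. }
    destruct (continuous_eps _ _ _ Hcb Hap) as [r1 [Hr1 H1]]. rewrite Hb0 in H1.
    exists k. split; [exact Hk|]. split; [|split].
    + exists (Rabs (a k) / 2), (2 * Rabs (a k)), (Rmin r r1).
      split; [exact Hap|]. split; [now apply Rmin_pos|]. intros x H.
      rewrite Hf, Hf0, Hb by Rmin_lra.
      replace (a O + (x - x0) ^ k * PSeries b (x - x0) - a O)
        with ((x - x0) ^ k * PSeries b (x - x0)) by ring.
      rewrite Rabs_mult, <- RPow_abs, (Rmult_comm (_ ^ k)).
      assert (H0 : 0 <= Rabs (x - x0) ^ k) by apply pow_le, Rabs_pos.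
      specialize (H1 (x - x0)). rewrite Rminus_0_r in H1. specialize (H1 ltac:(Rmin_lra)).
      assert (H2 := Rabs_triang_inv (a k) (PSeries b (x - x0))). rewrite Rabs_minus_sym in H2.
      assert (H3 := Rabs_triang_inv (PSeries b (x - x0)) (a k)).
      split; apply Rmult_le_compat_r; lra.
    + intros j Hj. rewrite HD, Hz by exact Hj. ring.
    + rewrite HD. apply Rmult_integral_contrapositive_currified; [exact Hak|apply INR_fact_neq_0].
Qed.

(** Connectedness of the interval: otherwise the function equal to -1 on [P] and to 1 off [P] would
    be continuous, change sign and have no zero. *)
Lemma interval_clopen_lt (P : R -> Prop) (a b : R) :
  a < b ->
  (forall x, a <= x <= b -> P x -> locally x P) ->
  (forall x, a <= x <= b -> ~ P x -> locally x (fun y => ~ P y)) ->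
  P a -> P b.
Proof.
  intros Hab Hop Hcl Ha. apply NNPP. intros Hb.
  set (f := fun x => if excluded_middle_informative (P x) then -1 else 1).
  assert (H1 : forall x, P x -> f x = -1) by (intros x Hx; unfold f; now destruct (excluded_middle_informative (P x))).
  assert (H2 : forall x, ~ P x -> f x = 1) by (intros x Hx; unfold f; now destruct (excluded_middle_informative (P x))).
  destruct (Ranalysis5.IVT_interv f a b) as [z [Hz Hfz]]; [|exact Hab|rewrite H1; auto; lra|rewrite H2; auto; lra|].
  - intros x Hx. apply continuity_pt_filterlim.
    destruct (classic (P x)) as [HP|HP]; [specialize (Hop x Hx HP)|specialize (Hcl x Hx HP)].
    + apply (continuous_ext_loc _ (fun _ => -1)); [|apply continuous_const].
      refine (filter_imp _ _ _ Hop). intros y Hy. now rewrite H1.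
    + apply (continuous_ext_loc _ (fun _ => 1)); [|apply continuous_const].
      refine (filter_imp _ _ _ Hcl). intros y Hy. now rewrite H2.
  - destruct (classic (P z)) as [HP|HP]; [rewrite H1 in Hfz by exact HP|rewrite H2 in Hfz by exact HP]; lra.
Qed.

Lemma interval_clopen (P : R -> Prop) (a b : R) :
  (forall x, Rmin a b <= x <= Rmax a b -> P x -> locally x P) ->
  (forall x, Rmin a b <= x <= Rmax a b -> ~ P x -> locally x (fun y => ~ P y)) ->
  P a -> P b.
Proof.
  intros Hop Hcl Ha. destruct (Rtotal_order a b) as [H|[H|H]].
  - rewrite Rmin_left, Rmax_right in Hop, Hcl by lra.
    now apply interval_clopen_lt with a.
  - now subst.
  - rewrite Rmin_right, Rmax_left in Hop, Hcl by lra.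
    destruct (classic (P b)) as [|Hb]; [assumption|exfalso].
    (* The complement satisfies the same two hypotheses, which reverses the interval. *)
    apply (interval_clopen_lt (fun x => ~ P x) b a); auto.
    intros x Hx HP. apply NNPP in HP. specialize (Hop x Hx HP).
    refine (filter_imp _ _ _ Hop). intros y Hy Hn. now apply Hn.
Qed.

(** The set of points near which [f] is identically [c] is open by definition. It is also closed:
    where [f] takes the value [c] without being locally constant it has a finite order, so it
    differs from [c] on a punctured neighbourhood. *)
Lemma analytic_identity (f : R -> R) (lo hi x0 c : R) :
  (forall x, lo < x < hi -> analytic_at f x) -> lo < x0 < hi ->
  locally x0 (fun x => f x = c) ->
  forall x, lo < x < hi -> f x = c.
Proof.
  intros Hf Hx0 Hloc x Hx.
  assert (H : locally x (fun y => f y = c)); [|exact (locally_singleton _ _ H)].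
  assert (Hin : forall y, Rmin x0 x <= y <= Rmax x0 x -> lo < y < hi).
  { intros y. unfold Rmin, Rmax. destruct (Rle_dec x0 x); lra. }
  apply (interval_clopen (fun y => locally y (fun z => f z = c)) x0 x); auto.
  { intros y _ Hy. now apply locally_locally. }
  intros y Hy Hn.
  destruct (Req_dec (f y) c) as [E|E].
  - destruct (analytic_dichotomy f y (Hf y (Hin y Hy))) as [Hc|[k [_ [[m [M [r [Hm [Hr Hb]]]]] _]]]].
    + exfalso. apply Hn. now rewrite E in Hc.
    + exists (mkposreal r Hr). intros z Hz Hzc.
      destruct (Req_dec z y) as [->|Hzy]; [now apply Hn|].
      assert (Hzd : 0 < Rabs (z - y)) by (apply Rabs_pos_lt; lra).
      specialize (Hb z Hz). apply locally_singleton in Hzc.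
      rewrite Hzc, E, Rminus_diag, Rabs_R0 in Hb.
      assert (0 < m * Rabs (z - y) ^ k); [|lra].
      now apply Rmult_lt_0_compat, pow_lt.
  - assert (Hd : 0 < Rabs (f y - c)) by (apply Rabs_pos_lt; lra).
    destruct (continuous_eps f y _ (analytic_at_continuous f y (Hf y (Hin y Hy))) Hd) as [r [Hr Hb]].
    apply locally_R. exists r. split; [exact Hr|]. intros z Hz Hzc. apply locally_singleton in Hzc.
    specialize (Hb z Hz). rewrite Hzc, Rabs_minus_sym in Hb. lra.
Qed.

(** * Double power series and confluence of zeros *)

Lemma sum_f_R0_rev (h : nat -> R) (n : nat) :
  sum_f_R0 (fun k => h (n - k)%nat) n = sum_f_R0 h n.
Proof.
  induction n as [|n IH]; [reflexivity|].
  rewrite decomp_sum by lia. simpl pred.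
  rewrite (sum_eq (fun i => h (S n - S i)%nat) (fun i => h (n - i)%nat))
    by (intros; f_equal; lia).
  rewrite IH. simpl. lra.
Qed.

Lemma sum_f_R0_ge_term (h : nat -> R) (n i : nat) :
  (forall k, 0 <= h k) -> (i <= n)%nat -> h i <= sum_f_R0 h n.
Proof.
  intros Hh Hi. induction n as [|n IH].
  - replace i with O by lia. simpl; lra.
  - rewrite tech5. assert (0 <= sum_f_R0 h n) by now apply cond_pos_sum.
    destruct (Nat.eq_dec i (S n)) as [->|E]; [lra|].
    specialize (Hh (S n)). assert (h i <= sum_f_R0 h n) by (apply IH; lia). lra.
Qed.

(** The triangle of indices with sum at most [N], summed by diagonals and by columns; from [N] to
    [N + 1] both sides gain the same new diagonal. *)
Lemma sum_triangle (g : nat -> nat -> R) (N : nat) :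
  sum_f_R0 (fun n => sum_f_R0 (fun k => g k (n - k)%nat) n) N =
  sum_f_R0 (fun j => sum_f_R0 (fun i => g i j) (N - j)) N.
Proof.
  induction N as [|N IH]; [reflexivity|].
  rewrite tech5, IH, (tech5 (fun j => sum_f_R0 (fun i => g i j) (S N - j)) N), Nat.sub_diag.
  rewrite (sum_eq (fun j => sum_f_R0 (fun i => g i j) (S N - j))
    (fun j => sum_f_R0 (fun i => g i j) (N - j) + g (S N - j)%nat j) N).
  2:{ intros i Hi. replace (S N - i)%nat with (S (N - i)) by lia. reflexivity. }
  rewrite sum_plus, Rplus_assoc. f_equal.
  rewrite <- (sum_f_R0_rev (fun k => g k (S N - k)%nat) (S N)).
  rewrite tech5. f_equal.
  - apply sum_eq. intros i Hi. now replace (S N - (S N - i))%nat with i by lia.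
  - now rewrite !Nat.sub_diag, Nat.sub_0_r.
Qed.

(** Comparison with the geometric series: the tail from [n + 1] on is at most
    [2 * M * (1 / 2) ^ (n + 1)]. *)
Lemma tail_half (b : nat -> R) (M x : R) (n : nat) :
  (forall i, Rabs (b i) <= M) -> Rabs x <= 1 / 2 ->
  ex_series (fun i => b i * x ^ i) /\
  Rabs (Series (fun i => b i * x ^ i) - sum_f_R0 (fun i => b i * x ^ i) n)
    <= M * (1 / 2) ^ n.
Proof.
  intros Hb Hx.
  assert (HM : 0 <= M) by (eapply Rle_trans; [apply Rabs_pos|apply (Hb O)]).
  assert (Hterm : forall i, Rabs (b i * x ^ i) <= M * (1 / 2) ^ i).
  { intros i. rewrite Rabs_mult, <- RPow_abs.
    apply Rmult_le_compat; try apply Rabs_pos; [|apply Hb|].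
    - apply pow_le, Rabs_pos.
    - apply pow_incr. split; [apply Rabs_pos|exact Hx]. }
  assert (Hgeom : forall m, is_series (fun i => M * (1 / 2) ^ (m + i)) (2 * M * (1 / 2) ^ m)).
  { intros m. apply is_series_ext with (fun i => scal (M * (1/2) ^ m) ((1/2) ^ i)).
    - intros i. unfold scal; simpl; unfold mult; simpl. rewrite pow_add. ring.
    - replace (2 * M * (1 / 2) ^ m) with (scal (M * (1/2) ^ m) (/ (1 - 1/2))).
      + apply (is_series_scal (K:=R_AbsRing) (V:=R_NormedModule)). apply is_series_geom. rewrite Rabs_pos_eq; lra.
      + unfold scal; simpl; unfold mult; simpl. field. }
  assert (Hex : ex_series (fun i => b i * x ^ i)).
  { apply (ex_series_le (K:=R_AbsRing) (V:=R_CompleteNormedModule) _ (fun i => M * (1 / 2) ^ i)).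
    - intros i. apply Hterm.
    - exists (2 * M * (1 / 2) ^ 0). apply (Hgeom O). }
  split; [exact Hex|].
  rewrite (Series_incr_n _ (S n)) by (try lia; exact Hex). simpl pred.
  replace (_ + _ - _) with (Series (fun k => b (S n + k)%nat * x ^ (S n + k))) by ring.
  assert (Hex' : ex_series (fun k => M * (1 / 2) ^ (S n + k))) by (eexists; apply Hgeom).
  assert (Hexa : ex_series (fun k => Rabs (b (S n + k)%nat * x ^ (S n + k)))).
  { apply (ex_series_le (K:=R_AbsRing) (V:=R_CompleteNormedModule) _ (fun k => M * (1 / 2) ^ (S n + k))); [|exact Hex'].
    intros k. unfold norm; simpl; unfold abs; simpl. rewrite Rabs_Rabsolu. apply Hterm. }
  eapply Rle_trans; [now apply Series_Rabs|].
  eapply Rle_trans; [apply Series_le; [|exact Hex']|].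
  - intros k. split; [apply Rabs_pos|apply Hterm].
  - rewrite (is_series_unique _ _ (Hgeom (S n))). simpl. lra.
Qed.

(* Regrouping a double power series by powers of [y].  The unequal radii 1/2
   and 1/4 make the discrepancy between the two partial sums geometric. *)
Lemma regroup (b : nat -> nat -> R) (M x y l : R) :
  (forall i j, Rabs (b i j) <= M) -> Rabs x <= 1 / 2 -> Rabs y <= 1 / 4 ->
  is_series (fun n => sum_f_R0 (fun k => b k (n - k)%nat * x ^ k * y ^ (n - k)) n) l ->
  is_series (fun j => Series (fun i => b i j * x ^ i) * y ^ j) l.
Proof.
  intros Hb Hx Hy Hs.
  assert (HM : 0 <= M) by (eapply Rle_trans; [apply Rabs_pos|apply (Hb O O)]).
  set (c := fun j => Series (fun i => b i j * x ^ i)).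
  set (T := fun n => sum_f_R0 (fun k => b k (n - k)%nat * x ^ k * y ^ (n - k)) n) in Hs.
  assert (Hs' : is_lim_seq (sum_f_R0 T) l).
  { apply is_lim_seq_ext with (2 := Hs). intros n. now rewrite sum_n_Reals. }
  assert (Hd : is_lim_seq (fun N => sum_f_R0 (fun j => c j * y ^ j) N - sum_f_R0 T N) 0).
  { apply is_lim_seq_abs_0.
    apply is_lim_seq_le_le with (u := fun _ => 0) (w := fun N => 2 * M * (1 / 2) ^ N).
    - intros N. split; [apply Rabs_pos|].
      unfold T. rewrite (sum_triangle (fun i j => b i j * x ^ i * y ^ j)).
      rewrite <- minus_sum.
      eapply Rle_trans; [apply Rsum_abs|].
      eapply Rle_trans; [apply sum_Rle with (Bn := fun j => (1/2) ^ j * (M * (1 / 2) ^ N))|].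
      + intros j Hj.
        replace (sum_f_R0 (fun i => b i j * x ^ i * y ^ j) (N - j))
          with (sum_f_R0 (fun i => b i j * x ^ i) (N - j) * y ^ j)
          by (rewrite Rmult_comm, scal_sum; apply sum_eq; intros; ring).
        rewrite <- Rmult_minus_distr_r, Rabs_mult, <- RPow_abs.
        (* Column [j] is truncated at [N - j], at a cost of [M * (1 / 2) ^ (N - j)]. The factor
           [(1 / 4) ^ j] from [y] absorbs the loss and leaves [(1 / 2) ^ j * (1 / 2) ^ N], summable
           in [j]. *)
        destruct (tail_half (fun i => b i j) M x (N - j) (fun i => Hb i j) Hx) as [_ Ht].
        apply Rle_trans with (M * (1 / 2) ^ (N - j) * (1 / 4) ^ j).
        * apply Rmult_le_compat; try apply Rabs_pos; [apply pow_le, Rabs_pos|exact Ht|].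
          apply pow_incr; split; [apply Rabs_pos|exact Hy].
        * replace (1 / 4) with (1 / 2 * (1 / 2)) by field. rewrite Rpow_mult_distr.
          replace N with (N - j + j)%nat at 2 by lia. rewrite pow_add.
          right; ring.
      + rewrite <- scal_sum, Rmult_comm.
        rewrite (sum_eq _ (fun i => (1 / 2) ^ i)) by reflexivity.
        rewrite tech3 by lra.
        assert (0 < (1 / 2) ^ S N) by (apply pow_lt; lra).
        assert (0 <= M * (1 / 2) ^ N) by (apply Rmult_le_pos; [exact HM|apply pow_le; lra]).
        replace (1 - 1 / 2) with (/ 2) by field. unfold Rdiv. rewrite Rinv_inv. nra.
    - apply is_lim_seq_const.
    - replace (Finite 0) with (Rbar_mult (2 * M) 0) by (simpl; f_equal; ring).
      apply is_lim_seq_scal_l. apply is_lim_seq_geom. rewrite Rabs_pos_eq; lra. }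
  change (is_lim_seq (sum_n (fun j => c j * y ^ j)) l).
  apply (is_lim_seq_ext (fun N => (sum_f_R0 (fun j => c j * y ^ j) N - sum_f_R0 T N) + sum_f_R0 T N)).
  - intros N. rewrite sum_n_Reals. unfold c. ring.
  - replace (Finite l) with (Finite (0 + l)) by (f_equal; ring).
    now apply is_lim_seq_plus'.
Qed.

(** Joint analyticity seen as a family of power series in [y]: the coefficients depend continuously
    on [x] and obey one Cauchy estimate for all [x] near [x0]. This uniformity is what allows
    derivatives on different slices to be compared. *)
Lemma analytic2_slices (f : R -> R -> R) (x0 y0 : R) :
  analytic2_at f x0 y0 ->
  exists (A : R -> nat -> R) (M rho r : R), 0 < r /\ r < rho /\
    (forall x l, Rabs (x - x0) < r -> Rabs (A x l) <= M / rho ^ l) /\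
    (forall l, continuous (fun x => A x l) x0) /\
    (forall x y, Rabs (x - x0) < r -> Rabs (y - y0) < r ->
       is_pseries (A x) (y - y0) (f x y)).
Proof.
  intros [a [r0 [Hr0 Ha]]].
  set (rho := r0 / 2). assert (Hrho : 0 < rho) by (unfold rho; lra).
  (* The series converges absolutely at the corner [(x0 + rho, y0 + rho)], so its diagonal sums are
     bounded, and each of them dominates its individual terms. *)
  assert (HM : exists M, forall i j, Rabs (a i j * rho ^ i * rho ^ j) <= M).
  { destruct (Ha (x0 + rho) (y0 + rho)) as [Hex _];
      [replace (x0 + rho - x0) with rho by ring; rewrite Rabs_pos_eq; unfold rho; lra
      |replace (y0 + rho - y0) with rho by ring; rewrite Rabs_pos_eq; unfold rho; lra|].
    replace (x0 + rho - x0) with rho in Hex by ring.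
    replace (y0 + rho - y0) with rho in Hex by ring.
    apply ex_series_lim_0 in Hex.
    apply is_lim_seq_Reals in Hex. destruct (maj_by_pos _ (exist _ 0 Hex)) as [M [_ HM]].
    exists M. intros i j. eapply Rle_trans; [|apply (HM (i + j)%nat)].
    eapply Rle_trans; [|apply Rle_abs].
    assert (Hpos : forall k, 0 <= Rabs (a k (i + j - k)%nat * rho ^ k * rho ^ (i + j - k)))
      by (intros; apply Rabs_pos).
    eapply Rle_trans; [|apply (sum_f_R0_ge_term _ (i + j)%nat i Hpos); lia].
    replace (i + j - i)%nat with j by lia. lra. }
  destruct HM as [M HM].
  set (b := fun i j => a i j * rho ^ i * rho ^ j).
  assert (Hpow : forall n, 0 < rho ^ n) by (intros; now apply pow_lt).
  assert (Hsc : forall z, Rabs (z / rho) = Rabs z / rho).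
  { intros z. unfold Rdiv. rewrite Rabs_mult, Rabs_inv, (Rabs_pos_eq rho); lra. }
  assert (Hhalf : forall z, Rabs z < rho / 4 -> Rabs (z / rho) <= 1 / 4).
  { intros z Hz. rewrite Hsc. apply Rmult_le_reg_r with rho; [exact Hrho|].
    unfold Rdiv. rewrite (Rmult_assoc (Rabs z)), Rinv_l by lra. lra. }
  (* Within [rho / 4] both rescaled variables are at most 1/4, as [regroup] demands. In [2 * M], one
     [M] bounds the term of index 0 and the other the tail after it. *)
  exists (fun x l => Series (fun i => b i l * ((x - x0) / rho) ^ i) / rho ^ l),
    (2 * M), rho, (rho / 4).
  repeat split; try lra.
  - intros x l Hx. specialize (Hhalf _ Hx).
    destruct (tail_half (fun i => b i l) M ((x - x0) / rho) 0 (fun i => HM i l)) as [_ Ht]; [lra|].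
    unfold Rdiv at 1. rewrite Rabs_mult, Rabs_inv, (Rabs_pos_eq (rho ^ l)) by (left; apply Hpow).
    apply Rmult_le_compat_r; [left; apply Rinv_0_lt_compat, Hpow|].
    simpl in Ht. assert (H0 := HM O l). fold (b O l) in H0.
    rewrite !Rmult_1_r in Ht.
    eapply Rle_trans with (Rabs (b O l) + Rabs (Series (fun i => b i l * ((x - x0) / rho) ^ i) - b O l)); [|lra].
    eapply Rle_trans; [|apply Rabs_triang]. right. f_equal. ring.
  - intros l.
    assert (Hc : continuous (PSeries (fun i => b i l)) 0).
    { apply continuity_pt_filterlim, PSeries_continuity.
      apply CV_radius_gt with (1 / 2); [|rewrite Rabs_R0; lra].
      intros y Hy. apply ex_pseries_R.
      apply (tail_half (fun i => b i l) M y 0 (fun i => HM i l)). lra. }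
    apply (continuous_scal_l (V := R_NormedModule) (fun x => PSeries (fun i => b i l) ((x - x0) / rho)) (/ rho ^ l)).
    apply continuous_comp.
    + apply (continuous_scal_l (V := R_NormedModule) (fun x => x - x0) (/ rho)).
      apply (continuous_minus (fun x => x) (fun _ => x0)); [apply continuous_id|apply continuous_const].
    + now replace ((x0 - x0) / rho) with 0 by (field; lra).
  - intros x y Hx Hy.
    destruct (Ha x y) as [_ Hs]; [unfold rho in *; lra|unfold rho in *; lra|].
    apply is_pseries_R.
    assert (Hx4 := Hhalf _ Hx). assert (Hy4 := Hhalf _ Hy).
    assert (Hs' : is_series (fun n => sum_f_R0 (fun k => b k (n - k)%nat * ((x - x0) / rho) ^ k * ((y - y0) / rho) ^ (n - k)) n) (f x y)).
    { apply is_series_ext with (2 := Hs). intros n. apply sum_eq. intros k Hk.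
      unfold b, Rdiv. rewrite !Rpow_mult_distr, !pow_inv. field.
      split; apply Rgt_not_eq, Hpow. }
    apply (regroup b M) in Hs'; [|exact HM|lra|exact Hy4].
    apply is_series_ext with (2 := Hs'). intros j. simpl.
    unfold Rdiv. rewrite !Rpow_mult_distr, !pow_inv. ring.
Qed.

(* Each zero of [G^(j)] between [s] and [u], together with the zero at [s],
   yields by Rolle a zero of [G^(j+1)]. *)
Lemma rolle_chain (G : R -> R) (s u : R) (k : nat) :
  s <> u -> (1 <= k)%nat ->
  (forall t j, Rmin s u <= t <= Rmax s u -> ex_derive_n G j t) ->
  G s = G u -> (forall j, (1 <= j < k)%nat -> Derive_n G j s = 0) ->
  exists z, Rmin s u <= z <= Rmax s u /\ z <> s /\ Derive_n G k z = 0.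
Proof.
  intros Hsu Hk Hex HG HD.
  assert (Hrolle : forall j w, Rmin s u <= w <= Rmax s u -> w <> s ->
    Derive_n G j s = Derive_n G j w ->
    exists z, Rmin s u <= z <= Rmax s u /\ z <> s /\ Derive_n G (S j) z = 0).
  { intros j w Hw Hws Hj.
    assert (Hs : Rmin s u <= s <= Rmax s u) by (split; [apply Rmin_l|apply Rmax_l]).
    assert (Hgen : forall a b, a < b -> Rmin s u <= a -> b <= Rmax s u -> Derive_n G j a = Derive_n G j b ->
      exists z, a < z < b /\ Derive_n G (S j) z = 0).
    { intros a b Hab Ha Hb E. destruct (MVT_cor2 (Derive_n G j) (Derive_n G (S j)) a b Hab) as [c [Hc1 Hc2]].
      - intros c Hc. apply is_derive_Reals, Derive_correct, (Hex c (S j)). lra.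
      - exists c. split; [exact Hc2|]. rewrite E, Rminus_diag in Hc1. nra. }
    destruct (Rtotal_order s w) as [H|[H|H]]; [|congruence|].
    - destruct (Hgen s w) as [z [Hz Ez]]; try lra. exists z. repeat split; lra.
    - destruct (Hgen w s) as [z [Hz Ez]]; try lra. exists z. repeat split; lra. }
  assert (Hu : Rmin s u <= u <= Rmax s u) by (split; [apply Rmin_r|apply Rmax_r]).
  induction k as [|k IH]; [lia|].
  destruct k as [|k].
  - apply Hrolle with u; auto.
  - destruct IH as [w [Hw [Hws Hz]]]; [lia|intros; apply HD; lia|].
    apply Hrolle with w; auto. rewrite Hz. apply HD. lia.
Qed.

(** By [rolle_chain] such a coincidence would give a zero of the [k]-th derivative in [y] close to
    [(x0, y0)]. That derivative is within a multiple of [|y - y0|], uniform in [x], of [k!] times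
    the coefficient [A x k], which is continuous in [x] and nonzero at [x0]. *)
Lemma no_confluence (f : R -> R -> R) (x0 y0 : R) (k : nat) :
  analytic2_at f x0 y0 -> (1 <= k)%nat -> Derive_n (f x0) k y0 <> 0 ->
  exists eta, 0 < eta /\ forall x s u,
    Rabs (x - x0) < eta -> Rabs (s - y0) < eta -> Rabs (u - y0) < eta ->
    s <> u -> f x s = f x u ->
    (forall j, (1 <= j < k)%nat -> Derive_n (f x) j s = 0) -> False.
Proof.
  intros Hf Hk HDk.
  destruct (analytic2_slices f x0 y0 Hf) as [A [M [rho [r [Hr [Hrr [HA [Hc Hs]]]]]]]].
  assert (HCV : forall x y, Rabs (x - x0) < r -> Rabs y < r -> Rbar_lt (Rabs y) (CV_radius (A x))).
  { intros x y Hx Hy. now apply (CV_radius_local (f x) (A x) y0 r (fun z => Hs x z Hx)). }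
  assert (HD : forall x y n, Rabs (x - x0) < r -> Rabs (y - y0) < r ->
    is_derive_n (f x) n y (PSeries (PS_derive_n n (A x)) (y - y0))).
  { intros x y n Hx Hy.
    apply (is_derive_n_ext_loc (fun z => PSeries (A x) (z + - y0))).
    - apply locally_R. exists (r - Rabs (y - y0)). split; [lra|]. intros z Hz.
      apply is_pseries_unique, Hs; [exact Hx|].
      replace (z - y0) with ((z - y) + (y - y0)) by ring.
      eapply Rle_lt_trans; [apply Rabs_triang|lra].
    - apply (is_derive_n_comp_trans (PSeries (A x)) n y (- y0)).
      apply is_derive_n_PSeries. now apply HCV. }
  set (B := fun n => M / rho ^ n).
  assert (HM : 0 <= M).
  { specialize (HA x0 O). rewrite Rminus_diag, Rabs_R0 in HA. specialize (HA Hr).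
    simpl in HA. assert (H := Rabs_pos (A x0 O)). lra. }
  assert (HB : forall n, 0 <= B n).
  { intros n. apply Rmult_le_pos; [exact HM|left; apply Rinv_0_lt_compat, pow_lt; lra]. }
  assert (HBcv : forall y, Rabs y < rho -> ex_pseries B y).
  { intros y Hy. apply ex_pseries_R.
    apply ex_series_ext with (fun n => scal M ((y / rho) ^ n)).
    - intros n. unfold scal; simpl; unfold mult; simpl. unfold B, Rdiv.
      rewrite Rpow_mult_distr, pow_inv. ring.
    - apply (ex_series_scal (K := R_AbsRing) (V := R_NormedModule)), ex_series_geom.
      unfold Rdiv. rewrite Rabs_mult, Rabs_inv, (Rabs_pos_eq rho) by lra.
      apply Rmult_lt_reg_r with rho; [lra|]. rewrite Rmult_assoc, Rinv_l; lra. }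
  (* [D] dominates, for all [x] at once, the coefficients of the [k]-th derivative of a slice beyond
     its constant term; its sum [C] at [r'] bounds the variation of that derivative away from
     [y0]. *)
  set (D := PS_decr_1 (PS_derive_n k B)).
  set (r' := r / 2). assert (Hr' : 0 < r' < r) by (unfold r'; lra).
  assert (HDex : ex_series (fun n => D n * r' ^ n)).
  { apply ex_pseries_R. apply ex_pseries_decr_1.
    - right. exists (/ r'). apply Rinv_l. lra.
    - apply CV_radius_inside. rewrite CV_radius_derive_n.
      apply CV_radius_gt with rho; [exact HBcv|]. rewrite Rabs_pos_eq; lra. }
  set (C := Series (fun n => D n * r' ^ n)).
  assert (Hbound : forall x y, Rabs (x - x0) < r -> Rabs (y - y0) < r' ->
    Rabs (Derive_n (f x) k y - INR (fact k) * A x k) <= Rabs (y - y0) * C).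
  { intros x y Hx Hy.
    rewrite (is_derive_n_unique _ _ _ _ (HD x y k Hx ltac:(lra))).
    assert (He : ex_pseries (PS_derive_n k (A x)) (y - y0)).
    { apply CV_radius_inside. rewrite CV_radius_derive_n. apply HCV; lra. }
    rewrite PSeries_decr_1 by exact He.
    replace (PS_derive_n k (A x) 0) with (INR (fact k) * A x k).
    2:{ unfold PS_derive_n. rewrite Nat.add_0_l. simpl (fact 0). simpl (INR 1). field. }
    replace (_ + _ - _) with ((y - y0) * PSeries (PS_decr_1 (PS_derive_n k (A x))) (y - y0)) by ring.
    rewrite Rabs_mult. apply Rmult_le_compat_l; [apply Rabs_pos|].
    assert (Hle : forall n, Rabs (PS_decr_1 (PS_derive_n k (A x)) n * (y - y0) ^ n) <= D n * r' ^ n).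
    { intros n. rewrite Rabs_mult, <- RPow_abs.
      apply Rmult_le_compat; try apply Rabs_pos; [apply pow_le, Rabs_pos| |].
      - unfold D, PS_decr_1, PS_derive_n. rewrite Rabs_mult.
        assert (Hq : 0 <= INR (fact (S n + k)) / INR (fact (S n))).
        { apply Rmult_le_pos; [apply pos_INR|]. left. apply Rinv_0_lt_compat, INR_fact_lt_0. }
        rewrite (Rabs_pos_eq (_ / _)) by exact Hq.
        apply Rmult_le_compat_l; [exact Hq|]. apply HA. exact Hx.
      - apply pow_incr. split; [apply Rabs_pos|lra]. }
    unfold PSeries, C.
    eapply Rle_trans; [apply Series_Rabs|apply Series_le; [|exact HDex]].
    - apply (ex_series_le (K:=R_AbsRing) (V:=R_CompleteNormedModule) _ (fun n => D n * r' ^ n)); [|exact HDex].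
      intros n. unfold norm; simpl; unfold abs; simpl. rewrite Rabs_Rabsolu. apply Hle.
    - intros n. split; [apply Rabs_pos|apply Hle]. }
  assert (Hd0 : Derive_n (f x0) k y0 = INR (fact k) * A x0 k).
  { assert (H := Hbound x0 y0). rewrite !Rminus_diag, Rabs_R0, Rmult_0_l in H.
    specialize (H Hr ltac:(lra)).
    apply Rminus_diag_uniq. apply Rabs_eq_0. apply Rle_antisym; [exact H|apply Rabs_pos]. }
  set (v := Rabs (INR (fact k) * A x0 k)).
  assert (Hv : 0 < v) by (apply Rabs_pos_lt; now rewrite <- Hd0).
  assert (Hcf : continuous (fun x => INR (fact k) * A x k) x0).
  { apply (continuous_scal_r (V := R_NormedModule) (INR (fact k)) (fun x => A x k)), Hc. }
  destruct (continuous_eps _ _ (v / 2) Hcf ltac:(lra)) as [r1 [Hr1 Hr1']].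
  assert (HC : 0 < Rabs C + 1) by (assert (H := Rabs_pos C); lra).
  (* Half of the margin [v] pays for moving [x] away from [x0], the other half for moving [y] away
     from [y0]. *)
  assert (Heta : exists eta, 0 < eta /\ eta <= r' /\ eta <= r1 /\ eta * (Rabs C + 1) <= v / 2).
  { exists (Rmin (Rmin r' r1) (v / 2 / (Rabs C + 1))).
    split; [repeat apply Rmin_pos; try lra; apply Rdiv_lt_0_compat; lra|].
    repeat split; try Rmin_lra. apply Rle_div_r; [exact HC|Rmin_lra]. }
  destruct Heta as [eta [Heta [He1 [He2 He3]]]].
  exists eta. split; [exact Heta|]. intros x s u Hx Hsy Huy Hsu Hfe HDs.
  assert (Hbet := fun z => between_ball y0 eta s u z Hsy Huy).
  destruct (rolle_chain (f x) s u k Hsu Hk) as [z [Hz [_ Hzk]]]; auto.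
  { intros t j Ht. specialize (Hbet t Ht). destruct j as [|j]; [exact I|].
    exists (PSeries (PS_derive_n (S j) (A x)) (t - y0)). apply (HD x t (S j)); lra. }
  specialize (Hbet z Hz).
  assert (H1 : Rabs (Derive_n (f x) k z - INR (fact k) * A x k) <= Rabs (z - y0) * C) by (apply Hbound; lra).
  assert (H2 : Rabs (INR (fact k) * A x k - INR (fact k) * A x0 k) < v / 2) by (apply Hr1'; lra).
  rewrite Hzk, Rminus_0_l, Rabs_Ropp in H1.
  assert (H3 : v <= Rabs (INR (fact k) * A x k - INR (fact k) * A x0 k) + Rabs (INR (fact k) * A x k)).
  { unfold v. rewrite (Rabs_minus_sym (INR (fact k) * A x k)).
    eapply Rle_trans; [|apply Rabs_triang]. right; f_equal; ring. }
  assert (H4 := Rle_abs C). assert (H5 := Rabs_pos (z - y0)). nra.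
Qed.

(** * Paths avoiding the boundary of a planar set *)

(** Off the boundary a point is interior to [Omega] or to its complement, so membership in [Omega]
    is an open and closed condition along the path. *)
Lemma path_stays (Omega : plane -> Prop) (px py : R -> R) :
  (forall r, 0 <= r <= 1 -> continuous px r /\ continuous py r) ->
  (forall r, 0 <= r <= 1 -> ~ boundary Omega (px r, py r)) ->
  Omega (px 0, py 0) -> Omega (px 1, py 1).
Proof.
  intros Hc Hb H0.
  assert (Hloc : forall (r : R) (Q : plane -> Prop), 0 <= r <= 1 -> locally ((px r, py r) : plane) Q ->
    locally r (fun r' => Q (px r', py r'))).
  { intros r Q Hr HQ. apply locally_plane in HQ. destruct HQ as [e [He HQ]].
    destruct (Hc r Hr) as [Hx Hy].
    destruct (continuous_eps _ _ _ Hx He) as [d1 [Hd1 H1]].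
    destruct (continuous_eps _ _ _ Hy He) as [d2 [Hd2 H2]].
    apply locally_R. exists (Rmin d1 d2). split; [now apply Rmin_pos|].
    intros y Hyr. apply HQ; [apply H1|apply H2]; Rmin_lra. }
  assert (Hdec : forall r, 0 <= r <= 1 -> locally ((px r, py r) : plane) Omega \/
    locally ((px r, py r) : plane) (fun y => ~ Omega y)).
  { intros r Hr. destruct (classic (locally ((px r, py r) : plane) Omega)) as [Hl|Hl]; [now left|right].
    apply NNPP. intros Hl'. apply (Hb r Hr). now split. }
  apply (interval_clopen (fun r => Omega (px r, py r)) 0 1); auto;
    rewrite Rmin_left, Rmax_right by lra; intros r Hr HP; destruct (Hdec r Hr) as [Hl|Hl].
  - now apply Hloc.
  - exfalso. exact (locally_singleton _ _ Hl HP).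
  - exfalso. apply HP. exact (locally_singleton _ _ Hl).
  - apply (Hloc r (fun y => ~ Omega y)); assumption.
Qed.

(** A ray that never meets the boundary stays in [Omega] by [path_stays], against boundedness. *)
Lemma ray_meets_boundary (Omega : plane -> Prop) (px py wx wy : R) :
  bounded_set Omega -> Omega (px, py) -> 0 < Rabs wx + Rabs wy ->
  exists r, 0 <= r /\ boundary Omega (px + r * wx, py + r * wy).
Proof.
  intros [M HM] H0 Hw. apply NNPP. intros Hno.
  assert (HM0 := Rabs_pos M). assert (Hx0 := Rabs_pos px). assert (Hy0 := Rabs_pos py).
  (* At time [K] the absolute values of the two coordinates add up to more than [2 * Rabs M], so one
     of them exceeds [M]. *)
  set (K := (2 * Rabs M + Rabs px + Rabs py + 1) / (Rabs wx + Rabs wy)).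
  assert (HK : 0 < K) by (apply Rdiv_lt_0_compat; lra).
  assert (H : Omega (px + 1 * K * wx, py + 1 * K * wy)).
  { apply (path_stays Omega (fun r => px + r * K * wx) (fun r => py + r * K * wy)).
    - intros r _. split; apply continuous_of_derive; auto_derive; exact I.
    - intros r Hr Hb. apply Hno. exists (r * K). split; [nra|exact Hb].
    - now rewrite !Rmult_0_l, !Rplus_0_r. }
  apply HM in H. rewrite norm_plane, Rmult_1_l in H. simpl fst in H; simpl snd in H.
  destruct (sqrt_plus_sqr (px + K * wx) (py + K * wy)) as [Hmax _].
  assert (H1 := Rmax_l (Rabs (px + K * wx)) (Rabs (py + K * wy))).
  assert (H2 := Rmax_r (Rabs (px + K * wx)) (Rabs (py + K * wy))).
  assert (Hc : forall p w, K * Rabs w <= Rabs (p + K * w) + Rabs p).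
  { intros p w. rewrite <- (Rabs_pos_eq K), <- Rabs_mult by lra. rewrite <- (Rabs_Ropp p).
    eapply Rle_trans; [|apply Rabs_triang]. rewrite (Rabs_pos_eq K) by lra. right; f_equal; ring. }
  assert (Hx := Hc px wx). assert (Hy := Hc py wy). assert (HMa := Rle_abs M).
  assert (K * (Rabs wx + Rabs wy) = 2 * Rabs M + Rabs px + Rabs py + 1) by (unfold K; field; lra).
  lra.
Qed.

Lemma convex_bounds (lo hi a b r : R) :
  lo < a < hi -> lo < b < hi -> 0 <= r <= 1 -> lo < a + r * (b - a) < hi.
Proof.
  intros Ha Hb Hr. destruct (Rle_lt_dec a b) as [H|H].
  - assert (0 <= r * (b - a) <= b - a) by nra. lra.
  - assert (b - a <= r * (b - a) <= 0) by nra. lra.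
Qed.

Lemma mult_small (t z S e : R) : Rabs t < e / S -> Rabs z < S -> Rabs (t * z) < e.
Proof.
  intros Ht Hz. rewrite Rabs_mult. assert (Ht0 := Rabs_pos t). assert (Hz0 := Rabs_pos z).
  apply (Rmult_lt_compat_r S) in Ht; [|lra].
  replace (e / S * S) with e in Ht by (field; lra). nra.
Qed.

Lemma orthogonal_multiple (X Y a b : R) : 0 < a ^ 2 + b ^ 2 -> X * a + Y * b = 0 ->
  X = - ((Y * a - X * b) / (a ^ 2 + b ^ 2) * b) /\ Y = (Y * a - X * b) / (a ^ 2 + b ^ 2) * a.
Proof.
  intros HL H. set (L := a ^ 2 + b ^ 2) in *.
  split; apply Rmult_eq_reg_r with L; try lra.
  - transitivity ((X * a + Y * b) * a - (Y * a - X * b) * b); [unfold L; ring|rewrite H; field; lra].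
  - transitivity ((X * a + Y * b) * b + (Y * a - X * b) * a); [unfold L; ring|rewrite H; field; lra].
Qed.

Lemma orthonormal_expansion (n1 n2 t1 t2 v1 v2 : R) :
  n1 ^ 2 + n2 ^ 2 = 1 -> t1 ^ 2 + t2 ^ 2 = 1 -> n1 * t1 + n2 * t2 = 0 ->
  v1 = (v1 * n1 + v2 * n2) * n1 + (v1 * t1 + v2 * t2) * t1.
Proof.
  intros Hn Ht Hnt. destruct (orthogonal_multiple n1 n2 t1 t2) as [E1 E2]; [lra|exact Hnt|].
  rewrite Ht, Rdiv_1_r in E1, E2. set (D := n2 * t1 - n1 * t2) in *. clearbody D. subst n1 n2.
  assert (HD : D ^ 2 = 1).
  { rewrite <- Hn. transitivity (D ^ 2 * (t1 ^ 2 + t2 ^ 2)); [rewrite Ht|]; ring. }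
  transitivity (D ^ 2 * (v1 * t2 ^ 2 - v2 * t1 * t2) + (v1 * t1 + v2 * t2) * t1); [|ring].
  rewrite HD. transitivity (v1 * (t1 ^ 2 + t2 ^ 2)); [rewrite Ht|]; ring.
Qed.

(** * Elliptic coordinates *)

Lemma cosh2_sinh2 (x : R) : cosh x ^ 2 = 1 + sinh x ^ 2.
Proof.
  unfold cosh, sinh. assert (H : exp x * exp (- x) = 1).
  { rewrite <- exp_plus, Rplus_opp_r. apply exp_0. }
  nra.
Qed.

Lemma cosh_pos (x : R) : 0 < cosh x.
Proof. unfold cosh. assert (H := exp_pos x). assert (H' := exp_pos (- x)). lra. Qed.

Lemma cosh_ge_1 (x : R) : 1 <= cosh x.
Proof. assert (H := cosh2_sinh2 x). assert (H' := cosh_pos x). assert (H0 := pow2_ge_0 (sinh x)). nra. Qed.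

Lemma cosh_even (x : R) : cosh (- x) = cosh x.
Proof. unfold cosh. rewrite Ropp_involutive. lra. Qed.

Lemma sinh_odd (x : R) : sinh (- x) = - sinh x.
Proof. unfold sinh. rewrite Ropp_involutive. lra. Qed.

Lemma sinh_pos (x : R) : 0 < x -> 0 < sinh x.
Proof.
  intros Hx. unfold sinh. assert (exp (- x) < exp x) by (apply exp_increasing; lra). lra.
Qed.

Lemma cosh_increasing (x y : R) : 0 <= x < y -> cosh x < cosh y.
Proof.
  intros Hxy. destruct (MVT_cor2 cosh sinh x y) as [c [Hc1 Hc2]]; [lra| |].
  - intros c _. apply derivable_pt_lim_cosh.
  - assert (H := sinh_pos c ltac:(lra)). nra.
Qed.

Lemma cos2_sin2 (x : R) : cos x ^ 2 = 1 - sin x ^ 2.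
Proof. assert (H := sin2_cos2 x). unfold Rsqr in H. lra. Qed.

Lemma angle_exists (a b : R) : a ^ 2 + b ^ 2 = 1 -> exists y, cos y = a /\ sin y = b.
Proof.
  intros H. assert (Ha : -1 <= a <= 1) by nra.
  assert (Hs : sin (acos a) = sqrt (1 - a ^ 2)).
  { rewrite sin_acos by exact Ha. f_equal. unfold Rsqr. ring. }
  assert (Hb : 1 - a ^ 2 = Rsqr b) by (unfold Rsqr; lra).
  rewrite Hb, sqrt_Rsqr_abs in Hs.
  destruct (Rle_lt_dec 0 b) as [Hp|Hn].
  - exists (acos a). rewrite cos_acos by exact Ha. rewrite Hs, Rabs_pos_eq by exact Hp. now split.
  - exists (- acos a). rewrite cos_neg, sin_neg, cos_acos by exact Ha.
    rewrite Hs, Rabs_left by exact Hn. split; [reflexivity|ring].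
Qed.

(* [sinh_sqr u w] is [sinh xi ^ 2] at the point [(cosh xi cos eta, sinh xi sin eta) = (u, w)]:
   the nonnegative root [z] of [u^2 / (1 + z) + w^2 / z = 1]. *)
Definition sinh_sqr (u w : R) : R :=
  ((u ^ 2 + w ^ 2 - 1) + sqrt ((u ^ 2 + w ^ 2 - 1) ^ 2 + 4 * w ^ 2)) / 2.

Lemma sinh_sqr_root (u w : R) :
  0 <= sinh_sqr u w /\
  sinh_sqr u w ^ 2 - (u ^ 2 + w ^ 2 - 1) * sinh_sqr u w - w ^ 2 = 0.
Proof.
  unfold sinh_sqr. set (q := u ^ 2 + w ^ 2 - 1).
  assert (H1 := pow2_ge_0 q). assert (H2 := pow2_ge_0 w).
  assert (Hs : sqrt (q ^ 2 + 4 * w ^ 2) ^ 2 = q ^ 2 + 4 * w ^ 2) by (apply pow2_sqrt; lra).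
  assert (H0 := sqrt_pos (q ^ 2 + 4 * w ^ 2)).
  split; [|nra].
  assert (- q <= sqrt (q ^ 2 + 4 * w ^ 2)); [|lra].
  destruct (Rle_lt_dec (- q) 0); [lra|]. apply Rsqr_incr_0_var; [unfold Rsqr; nra|exact H0].
Qed.

Lemma sinh_sqr_elliptic (x y : R) :
  0 < x -> sinh_sqr (cosh x * cos y) (sinh x * sin y) = sinh x ^ 2.
Proof.
  intros Hx. assert (HS := sinh_pos x Hx).
  destruct (sinh_sqr_root (cosh x * cos y) (sinh x * sin y)) as [H1 H2].
  set (z := sinh_sqr _ _) in *.
  assert (E : (z - sinh x ^ 2) * (z + sin y ^ 2) = 0).
  { rewrite <- H2. rewrite !Rpow_mult_distr, cosh2_sinh2, cos2_sin2. ring. }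
  apply Rmult_integral in E. destruct E as [E|E]; [lra|].
  assert (H3 := pow2_ge_0 (sin y)).
  assert (Hz : z = 0 /\ sin y ^ 2 = 0) by lra. destruct Hz as [Hz Hy].
  (* The excluded root is [- sin y ^ 2]; when both vanish [z] is still the larger one. *)
  exfalso. unfold z, sinh_sqr in Hz.
  rewrite !Rpow_mult_distr, cosh2_sinh2, cos2_sin2, Hy in Hz.
  replace ((1 + sinh x ^ 2) * (1 - 0) + sinh x ^ 2 * 0 - 1) with (sinh x ^ 2) in Hz by ring.
  assert (H4 := sqrt_pos ((sinh x ^ 2) ^ 2 + 4 * (sinh x ^ 2 * 0))). nra.
Qed.

Lemma sinh_sqr_unit (u w : R) : 0 < sinh_sqr u w ->
  (u / sqrt (1 + sinh_sqr u w)) ^ 2 + (w / sqrt (sinh_sqr u w)) ^ 2 = 1.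
Proof.
  intros Hz. destruct (sinh_sqr_root u w) as [_ Hr]. set (z := sinh_sqr u w) in *.
  unfold Rdiv. rewrite !Rpow_mult_distr, !pow_inv, !pow2_sqrt by lra.
  apply Rmult_eq_reg_r with ((1 + z) * z); [|nra].
  transitivity (u ^ 2 * z + w ^ 2 * (1 + z)); [field; lra|lra].
Qed.

Lemma elliptic_surjective (u w : R) :
  exists x y, 0 <= x /\ u = cosh x * cos y /\ w = sinh x * sin y.
Proof.
  destruct (sinh_sqr_root u w) as [H1 H2]. assert (H3 := sinh_sqr_unit u w).
  set (z := sinh_sqr u w) in *. set (x := arcsinh (sqrt z)).
  assert (HS : sinh x = sqrt z) by apply sinh_arcsinh.
  assert (HC : cosh x = sqrt (1 + z)).
  { rewrite <- (pow2_sqrt z) at 1 by exact H1. rewrite <- HS, <- cosh2_sinh2.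
    symmetry. apply sqrt_pow2. left. apply cosh_pos. }
  assert (Hx : 0 <= x).
  { unfold x. rewrite <- arcsinh_0. apply arcsinh_le, sqrt_pos. }
  (* The value [z = 0] is the segment between the foci, where [x = 0] and the angle is [acos u]. *)
  destruct (Req_dec z 0) as [Hz|Hz].
  - assert (Hw : w = 0) by nra.
    assert (Hq : u ^ 2 <= 1).
    { unfold z, sinh_sqr in Hz. assert (H0 := sqrt_pos ((u ^ 2 + w ^ 2 - 1) ^ 2 + 4 * w ^ 2)). subst w. lra. }
    exists x, (acos u). split; [exact Hx|]. rewrite cos_acos by nra.
    rewrite HS, HC, Hz, sqrt_0, Rplus_0_r, sqrt_1. split; lra.
  - assert (HSp : 0 < sqrt z) by (apply sqrt_lt_R0; lra).
    assert (HCp : 0 < sqrt (1 + z)) by (apply sqrt_lt_R0; lra).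
    destruct (angle_exists _ _ (H3 ltac:(lra))) as [y [Hy1 Hy2]].
    exists x, y. rewrite HS, HC, Hy1, Hy2. split; [exact Hx|]. split; field; lra.
Qed.

Lemma cos_sin_atan_div (p q : R) : 0 < p ->
  cos (atan (q / p)) = p / sqrt (p ^ 2 + q ^ 2) /\ sin (atan (q / p)) = q / sqrt (p ^ 2 + q ^ 2).
Proof.
  intros Hp. assert (Hs : 0 < sqrt (p ^ 2 + q ^ 2)) by (apply sqrt_lt_R0; nra).
  assert (E : sqrt (1 + (q / p)²) = sqrt (p ^ 2 + q ^ 2) / p).
  { replace (1 + (q / p)²) with ((p ^ 2 + q ^ 2) / p ^ 2) by (unfold Rsqr; field; lra).
    rewrite sqrt_div_alt by nra. now rewrite sqrt_pow2 by lra. }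
  rewrite cos_atan, sin_atan, E. split; field; lra.
Qed.

Lemma cos_sin_sign (sg x : R) : is_sign sg -> cos (sg * x) = cos x /\ sin (sg * x) = sg * sin x.
Proof.
  intros [-> | ->]; [now rewrite !Rmult_1_l|].
  replace (-1 * x) with (- x) by ring. rewrite cos_neg, sin_neg. split; ring.
Qed.

(** The radial coordinate comes from [sinh_sqr], differentiable where it is positive. The pair
    [(C, S)] is the cosine and sine of the angle; turning it back by [y0] brings it near [(1, 0)],
    so that the arctangent of [Y / X] gives the angle without a choice of branch. *)
Lemma elliptic_lift (u w : R -> R) (s0 x0 y0 : R) :
  (forall s, ex_derive u s) -> (forall s, ex_derive w s) ->
  0 < x0 -> u s0 = cosh x0 * cos y0 -> w s0 = sinh x0 * sin y0 ->
  exists (xb yb : R -> R) (d : R), 0 < d /\ xb s0 = x0 /\ yb s0 = y0 /\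
    forall s, Rabs (s - s0) < d -> 0 < xb s /\ ex_derive xb s /\ ex_derive yb s /\
      u s = cosh (xb s) * cos (yb s) /\ w s = sinh (xb s) * sin (yb s).
Proof.
  intros Hu Hw Hx0 Hu0 Hw0.
  set (z := fun s => sinh_sqr (u s) (w s)).
  assert (HS0 := sinh_pos x0 Hx0). assert (HC0 := cosh_pos x0).
  assert (Hz0 : z s0 = sinh x0 ^ 2) by (unfold z; rewrite Hu0, Hw0; now apply sinh_sqr_elliptic).
  assert (Hdisc : forall s, 0 < z s -> 0 < (u s ^ 2 + w s ^ 2 - 1) ^ 2 + 4 * w s ^ 2).
  { intros s Hs. apply Rnot_le_lt. intros H. unfold z, sinh_sqr in Hs. rewrite (sqrt_neg_0 _ H) in Hs. nra. }
  assert (Hzd : forall s, 0 < z s -> ex_derive z s).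
  { intros s Hs. specialize (Hdisc s Hs). unfold z, sinh_sqr. auto_derive. simpl in Hdisc.
    repeat split; auto. }
  set (C := fun s => u s / sqrt (1 + z s)). set (S := fun s => w s / sqrt (z s)).
  set (X := fun s => C s * cos y0 + S s * sin y0).
  set (Y := fun s => S s * cos y0 - C s * sin y0).
  assert (HCd : forall s, 0 < z s -> ex_derive C s /\ ex_derive S s).
  { intros s Hs. assert (Hzs := Hzd s Hs). assert (Hq : 0 < sqrt (z s)) by now apply sqrt_lt_R0.
    assert (Hq' : 0 < sqrt (1 + z s)) by (apply sqrt_lt_R0; lra).
    unfold C, S. split; auto_derive; repeat split; auto; lra. }
  assert (HX0 : X s0 = 1 /\ Y s0 = 0).
  { assert (E1 : C s0 = cos y0).
    { unfold C. rewrite Hz0, <- cosh2_sinh2, sqrt_pow2, Hu0 by lra. field; lra. }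
    assert (E2 : S s0 = sin y0).
    { unfold S. rewrite Hz0, sqrt_pow2, Hw0 by lra. field; lra. }
    unfold X, Y. rewrite E1, E2. assert (H := cos2_sin2 y0). split; nra. }
  destruct HX0 as [HX0 HY0].
  assert (Hz0p : 0 < z s0) by (rewrite Hz0; now apply pow_lt).
  destruct (continuous_eps z s0 (z s0)) as [d1 [Hd1 H1]]; [now apply continuous_of_derive, Hzd|exact Hz0p|].
  destruct (continuous_eps X s0 1) as [d2 [Hd2 H2]]; [|lra|].
  { apply continuous_of_derive. destruct (HCd s0 Hz0p) as [Ha Hb].
    unfold X. auto_derive. repeat split; auto. }
  exists (fun s => arcsinh (sqrt (z s))), (fun s => y0 + atan (Y s / X s)), (Rmin d1 d2).
  split; [now apply Rmin_pos|]. split; [|split].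
  - rewrite Hz0, sqrt_pow2 by lra. apply arcsinh_sinh.
  - rewrite HY0. unfold Rdiv. rewrite Rmult_0_l, atan_0. lra.
  - intros s Hs.
    specialize (H1 s ltac:(Rmin_lra)). specialize (H2 s ltac:(Rmin_lra)). apply Rabs_def2 in H1, H2. rewrite HX0 in H2.
    assert (Hz : 0 < z s) by lra. assert (HX : 0 < X s) by lra.
    destruct (HCd s Hz) as [HCds HSds].
    assert (Hq : 0 < sqrt (z s)) by now apply sqrt_lt_R0.
    assert (Hq' : 0 < sqrt (1 + z s)) by (apply sqrt_lt_R0; lra).
    set (x := arcsinh (sqrt (z s))).
    assert (HSx : sinh x = sqrt (z s)) by apply sinh_arcsinh.
    assert (HCx : cosh x = sqrt (1 + z s)).
    { rewrite <- (pow2_sqrt (z s)) at 1 by lra. rewrite <- HSx, <- cosh2_sinh2.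
      symmetry. apply sqrt_pow2. left. apply cosh_pos. }
    assert (Hy02 := cos2_sin2 y0).
    assert (HXY : X s ^ 2 + Y s ^ 2 = 1).
    { transitivity ((C s ^ 2 + S s ^ 2) * (cos y0 ^ 2 + sin y0 ^ 2)); [unfold X, Y; ring|].
      unfold C, S, z. rewrite sinh_sqr_unit by exact Hz. rewrite Hy02. ring. }
    destruct (cos_sin_atan_div (X s) (Y s) HX) as [Hcos Hsin].
    rewrite HXY, sqrt_1, Rdiv_1_r in Hcos, Hsin.
    assert (Hcy : cos (y0 + atan (Y s / X s)) = C s).
    { rewrite cos_plus, Hcos, Hsin. unfold X, Y. transitivity (C s * (cos y0 ^ 2 + sin y0 ^ 2)); [ring|].
      rewrite Hy02. ring. }
    assert (Hsy : sin (y0 + atan (Y s / X s)) = S s).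
    { rewrite sin_plus, Hcos, Hsin. unfold X, Y. transitivity (S s * (cos y0 ^ 2 + sin y0 ^ 2)); [ring|].
      rewrite Hy02. ring. }
    split; [|split; [|split; [|split]]].
    + unfold x. rewrite <- arcsinh_0. now apply arcsinh_lt.
    + assert (Hzs := Hzd s Hz). unfold arcsinh. auto_derive. do 2 (split; [exact Hzs|split; [exact Hz|]]).
      split; [|split; [|exact I]].
      * apply Rplus_le_lt_0_compat; [nra|apply Rlt_0_1].
      * apply Rplus_lt_le_0_compat; [exact Hq|apply sqrt_pos].
    + unfold X, Y in HX |- *. auto_derive. repeat split; auto; lra.
    + rewrite Hcy, HCx. unfold C. field; lra.
    + rewrite Hsy, HSx. unfold S. field; lra.
Qed.

(** * Slices, sums and products of analytic functions *)

Lemma analytic2_at_snd (f : R -> R -> R) (x0 y0 : R) :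
  analytic2_at f x0 y0 -> analytic_at (f x0) y0.
Proof.
  intros Hf. destruct (analytic2_slices f x0 y0 Hf) as [A [M [rho [r [Hr [_ [_ [_ Hs]]]]]]]].
  exists (A x0), r. split; [exact Hr|]. intros y Hy. apply Hs; [|exact Hy].
  now apply Rabs_self_lt.
Qed.

Lemma analytic2_at_fst (f : R -> R -> R) (x0 y0 : R) :
  analytic2_at f x0 y0 -> analytic_at (fun x => f x y0) x0.
Proof.
  intros [a [r [Hr Ha]]]. exists (fun n => a n O), r. split; [exact Hr|]. intros x Hx.
  destruct (Ha x y0 Hx) as [_ Hs]; [now apply Rabs_self_lt|].
  apply is_pseries_R. apply is_series_ext with (2 := Hs). intros n.
  rewrite Rminus_diag. destruct n as [|n].
  - simpl. ring.
  - rewrite tech5. rewrite (sum_eq _ (fun _ => 0)), sum_cte.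
    + rewrite Nat.sub_diag. simpl. ring.
    + intros i Hi. rewrite (pow_ne_zero (S n - i)) by lia. ring.
Qed.

Lemma analytic_at_plus (f g : R -> R) (x0 : R) :
  analytic_at f x0 -> analytic_at g x0 -> analytic_at (fun x => f x + g x) x0.
Proof.
  intros [a [r [Hr Ha]]] [b [r' [Hr' Hb]]].
  exists (PS_plus a b), (Rmin r r'). split; [now apply Rmin_pos|]. intros x Hx.
  apply (is_pseries_plus (K := R_AbsRing) (V := R_NormedModule)); [apply Ha|apply Hb]; Rmin_lra.
Qed.

Lemma analytic_at_mult (f g : R -> R) (x0 : R) :
  analytic_at f x0 -> analytic_at g x0 -> analytic_at (fun x => f x * g x) x0.
Proof.
  intros [a [r [Hr Ha]]] [b [r' [Hr' Hb]]].
  exists (PS_mult a b), (Rmin r r'). split; [now apply Rmin_pos|]. intros x Hx.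
  assert (H1 : Rabs (x - x0) < r) by Rmin_lra. assert (H2 : Rabs (x - x0) < r') by Rmin_lra.
  apply is_pseries_mult; [now apply Ha|now apply Hb| |].
  - exact (proj2 (CV_radius_local f a x0 r Ha _ H1)).
  - exact (proj2 (CV_radius_local g b x0 r' Hb _ H2)).
Qed.

Lemma analytic_at_const (c x0 : R) : analytic_at (fun _ => c) x0.
Proof.
  exists (fun n => match n with O => c | _ => 0 end), 1. split; [lra|]. intros x _.
  apply is_pseries_R.
  set (a := fun n : nat => match n with O => c | _ => 0 end).
  change (is_lim_seq (sum_n (fun k => a k * (x - x0) ^ k)) c).
  apply (is_lim_seq_ext (fun _ => c)); [|apply is_lim_seq_const].
  intros n. rewrite sum_n_Reals. induction n as [|n IH]; [simpl; ring|].
  rewrite tech5, <- IH. simpl. ring.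
Qed.

(** * Analytic functions that agree along two curves *)

Lemma derive_two_sided (g : R -> R) (l : R) : is_derive g 0 l -> l <> 0 ->
  exists a b r, 0 < a /\ 0 < r /\ forall e, 0 < e < r -> a * e <= Rabs (g e - g 0) <= b * e.
Proof.
  intros Hg Hl. apply Rabs_pos_lt in Hl. apply is_derive_Reals in Hg.
  destruct (Hg (Rabs l / 2) ltac:(lra)) as [r Hr].
  exists (Rabs l / 2), (2 * Rabs l), r. split; [lra|]. split; [apply r|]. intros e He.
  specialize (Hr e ltac:(lra)). rewrite (Rabs_pos_eq e), Rplus_0_l in Hr by lra. specialize (Hr ltac:(lra)).
  set (q := (g e - g 0) / e) in *.
  replace (g e - g 0) with (q * e) by (unfold q; field; lra).
  rewrite Rabs_mult, (Rabs_pos_eq e) by lra.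
  assert (H1 := Rabs_triang_inv l q). rewrite Rabs_minus_sym in H1.
  assert (H2 := Rabs_triang_inv q l). split; apply Rmult_le_compat_r; lra.
Qed.

Lemma power_compare (k k' : nat) (c K : R) : 0 < c ->
  (forall e1, 0 < e1 -> exists e, 0 < e < e1 /\ c * e ^ k <= K * e ^ k') -> (k' <= k)%nat.
Proof.
  intros Hc H. apply Nat.nlt_ge. intros Hlt.
  assert (HK := Rabs_pos K).
  destruct (H (Rmin 1 (c / (Rabs K + 1)))) as [e [He Hle]].
  { apply Rmin_pos; [lra|apply Rdiv_lt_0_compat; lra]. }
  assert (He1 : e < 1) by Rmin_lra. assert (He2 : e < c / (Rabs K + 1)) by Rmin_lra.
  replace k' with (k + S (k' - S k))%nat in Hle by lia. rewrite pow_add in Hle.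
  assert (Hp : 0 < e ^ k) by (apply pow_lt; lra).
  assert (Hq : e ^ S (k' - S k) <= e).
  { simpl. assert (e ^ (k' - S k) <= 1) by (rewrite <- (pow1 (k' - S k)); apply pow_incr; lra). nra. }
  assert (Hq0 : 0 < e ^ S (k' - S k)) by (apply pow_lt; lra).
  assert (Hle' : c <= K * e ^ S (k' - S k)).
  { apply Rmult_le_reg_r with (e ^ k); [exact Hp|]. lra. }
  assert (Hfin : e * (Rabs K + 1) < c).
  { apply Rlt_div_r; lra. }
  assert (HKl := Rle_abs K). nra.
Qed.

(** Equality is asked only for arbitrarily small parameters, not for all small ones, because the
    intermediate value theorem supplies no more than that. *)
Definition meet (p q al be : R -> R) : Prop :=
  forall e1, 0 < e1 -> exists e, 0 < e < e1 /\ p (al e) = q (be e).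

Lemma meet_sym (p q al be : R -> R) : meet p q al be -> meet q p be al.
Proof. intros H e1 He1. destruct (H e1 He1) as [e [He E]]. now exists e. Qed.

Lemma small_image (al : R -> R) (r : R) : continuous al 0 -> 0 < r ->
  exists e0, 0 < e0 /\ forall e, 0 < e < e0 -> Rabs (al e - al 0) < r.
Proof.
  intros Ha Hr. destruct (continuous_eps al 0 r Ha Hr) as [e0 [He0 H]].
  exists e0. split; [exact He0|]. intros e He. apply H. rewrite Rminus_0_r, Rabs_pos_eq; lra.
Qed.

Lemma meet_value (p q al be : R -> R) :
  continuous p (al 0) -> continuous q (be 0) -> continuous al 0 -> continuous be 0 ->
  meet p q al be -> p (al 0) = q (be 0).
Proof.
  intros Hp Hq Ha Hb H. apply Rminus_diag_uniq. apply NNPP. intros Hne.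
  apply Rabs_pos_lt in Hne. set (v := Rabs (p (al 0) - q (be 0))) in *.
  destruct (continuous_eps p _ (v / 2) Hp ltac:(lra)) as [r1 [Hr1 H1]].
  destruct (continuous_eps q _ (v / 2) Hq ltac:(lra)) as [r2 [Hr2 H2]].
  destruct (small_image al r1 Ha Hr1) as [e1 [He1 H3]]. destruct (small_image be r2 Hb Hr2) as [e2 [He2 H4]].
  destruct (H (Rmin e1 e2)) as [e [He E]]; [now apply Rmin_pos|].
  specialize (H1 _ (H3 e ltac:(Rmin_lra))). specialize (H2 _ (H4 e ltac:(Rmin_lra))).
  rewrite E in H1. rewrite Rabs_minus_sym in H1.
  assert (Ht : v <= Rabs (p (al 0) - q (be e)) + Rabs (q (be e) - q (be 0))).
  { unfold v. eapply Rle_trans; [|apply Rabs_triang]. right. f_equal. ring. }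
  lra.
Qed.

(** Since [al] and [be] move at nonzero speed, [p (al e)] departs from the common value by at least
    a multiple of [e ^ k] and [q (be e)] by at most a multiple of [e ^ k']; the departures agree for
    arbitrarily small [e]. *)
Lemma meet_order_le (p q al be : R -> R) (la lb : R) (k k' : nat) :
  is_derive al 0 la -> la <> 0 -> is_derive be 0 lb -> lb <> 0 ->
  p (al 0) = q (be 0) -> has_order p (al 0) k -> has_order q (be 0) k' ->
  meet p q al be -> (k' <= k)%nat.
Proof.
  intros Hda Hla Hdb Hlb Hval [_ [[m [M [r [Hm [Hr Hp]]]]] _]] [_ [[m' [M' [r' [Hm' [Hr' Hq]]]]] _]] H.
  destruct (derive_two_sided al la Hda Hla) as [a1 [a2 [ra [Ha1 [Hra Ha]]]]].
  destruct (derive_two_sided be lb Hdb Hlb) as [b1 [b2 [rb [Hb1 [Hrb Hb]]]]].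
  assert (Hca : continuous al 0) by (apply continuous_of_derive; eexists; exact Hda).
  assert (Hcb : continuous be 0) by (apply continuous_of_derive; eexists; exact Hdb).
  destruct (small_image al r Hca Hr) as [e1 [He1 H3]]. destruct (small_image be r' Hcb Hr') as [e2 [He2 H4]].
  apply (power_compare k k' (m * a1 ^ k) (Rabs M' * b2 ^ k')).
  { apply Rmult_lt_0_compat; [exact Hm|now apply pow_lt]. }
  intros e0 He0. destruct (H (Rmin e0 (Rmin (Rmin e1 e2) (Rmin ra rb)))) as [e [He E]].
  { now repeat apply Rmin_pos. }
  assert (Hlt : e < e0 /\ (e < e1 /\ e < e2) /\ (e < ra /\ e < rb)) by (repeat split; Rmin_lra).
  exists e. split; [lra|].
  destruct (Hp (al e)) as [Hlow _]; [apply H3; lra|]. destruct (Hq (be e)) as [_ Hup]; [apply H4; lra|].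
  destruct (Ha e ltac:(lra)) as [Ha' _]. destruct (Hb e ltac:(lra)) as [_ Hb'].
  rewrite E, Hval in Hlow.
  rewrite !Rmult_assoc, <- !Rpow_mult_distr.
  apply Rle_trans with (m * Rabs (al e - al 0) ^ k).
  { apply Rmult_le_compat_l; [lra|]. apply pow_incr. split; [apply Rmult_le_pos; lra|exact Ha']. }
  eapply Rle_trans; [exact Hlow|]. eapply Rle_trans; [exact Hup|].
  assert (Hpw : 0 <= Rabs (be e - be 0) ^ k') by apply pow_le, Rabs_pos.
  apply Rle_trans with (Rabs M' * Rabs (be e - be 0) ^ k').
  { apply Rmult_le_compat_r; [exact Hpw|apply Rle_abs]. }
  apply Rmult_le_compat_l; [apply Rabs_pos|]. apply pow_incr. split; [apply Rabs_pos|exact Hb'].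
Qed.

(** If [p] had a finite order, [p (al e)] would differ from its limit for every small [e > 0],
    whereas [q (be e)] keeps the limit value. *)
Lemma meet_constant (p q al be : R -> R) (la lb : R) :
  analytic_at p (al 0) -> is_derive al 0 la -> la <> 0 -> is_derive be 0 lb ->
  p (al 0) = q (be 0) -> meet p q al be ->
  locally (be 0) (fun y => q y = q (be 0)) -> locally (al 0) (fun x => p x = p (al 0)).
Proof.
  intros Hp Hda Hla Hdb Hval H Hq.
  destruct (analytic_dichotomy p (al 0) Hp) as [Hc|[k [_ [[m [M [r [Hm [Hr Hb]]]]] _]]]]; [exact Hc|exfalso].
  destruct (derive_two_sided al la Hda Hla) as [a1 [a2 [ra [Ha1 [Hra Ha]]]]].
  assert (Hca : continuous al 0) by (apply continuous_of_derive; eexists; exact Hda).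
  assert (Hcb : continuous be 0) by (apply continuous_of_derive; eexists; exact Hdb).
  apply locally_R in Hq. destruct Hq as [r' [Hr' Hq]].
  destruct (small_image al r Hca Hr) as [e1 [He1 H3]]. destruct (small_image be r' Hcb Hr') as [e2 [He2 H4]].
  destruct (H (Rmin ra (Rmin e1 e2))) as [e [He E]]; [now repeat apply Rmin_pos|].
  assert (Hlt : e < ra /\ e < e1 /\ e < e2) by (repeat split; Rmin_lra).
  rewrite (Hq (be e)) in E by (apply H4; lra). rewrite <- Hval in E.
  destruct (Hb (al e)) as [Hlow _]; [apply H3; lra|]. rewrite E, Rminus_diag, Rabs_R0 in Hlow.
  destruct (Ha e ltac:(lra)) as [Ha' _].
  assert (0 < Rabs (al e - al 0)) by nra.
  assert (0 < m * Rabs (al e - al 0) ^ k) by (apply Rmult_lt_0_compat; [exact Hm|now apply pow_lt]). lra.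
Qed.

(** * Travel times *)

Lemma ex_RInt_of_continuous (f : R -> R) (a b : R) : (forall x, continuous f x) -> ex_RInt f a b.
Proof. intros Hf. apply (ex_RInt_continuous (V := R_CompleteNormedModule)). intros x _. apply Hf. Qed.

Lemma is_derive_primitive (g : R -> R) (a x : R) :
  (forall y, continuous g y) -> is_derive (fun y => RInt g a y) x (g x).
Proof.
  intros Hg. apply (is_derive_RInt (V := R_NormedModule) g (fun y => RInt g a y) a); [|apply Hg].
  apply locally_R. exists 1. split; [lra|]. intros y _.
  now apply (RInt_correct (V := R_CompleteNormedModule)), ex_RInt_of_continuous.
Qed.

(* Separation of variables: the solution is the inverse of the travel time. *)
Lemma autonomous_ode (f : R -> R) (x0 : R) :
  (forall x, continuous f x) -> (forall x, 0 < f x) ->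
  exists g T : R -> R, (forall x, T x = RInt (fun z => / f z) x0 x) /\ (forall x, g (T x) = x) /\
    (forall x y, x < y -> T x < T y) /\
    (forall lo hi t, lo < hi -> T lo < t < T hi -> is_derive g t (f (g t))).
Proof.
  intros Hc Hp. set (Th := fun x => RInt (fun z => / f z) x0 x).
  assert (Hci : forall y, continuous (fun z => / f z) y).
  { intros y. apply (continuous_comp f Rinv); [apply Hc|].
    apply continuous_of_derive. auto_derive. apply Rgt_not_eq, Hp. }
  assert (HD : forall x, is_derive Th x (/ f x)) by (intros x; exact (is_derive_primitive (fun z => / f z) x0 x Hci)).
  assert (Hinc : forall x y, x < y -> Th x < Th y).
  { intros x y Hxy. destruct (MVT_cor2 Th (fun x => / f x) x y Hxy) as [c [E _]].
    - intros c _. now apply is_derive_Reals.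
    - assert (0 < / f c) by apply Rinv_0_lt_compat, Hp. nra. }
  assert (Hinj : forall x y, Th x = Th y -> x = y).
  { intros x y E. destruct (Rtotal_order x y) as [H|[H|H]]; [|exact H|]; apply Hinc in H; lra. }
  (* The inverse of the increasing function [Th], arbitrary outside its range. *)
  set (g := fun t => epsilon (inhabits 0) (fun x => Th x = t)).
  assert (Hg : forall x, g (Th x) = x).
  { intros x. apply Hinj. apply (epsilon_spec (inhabits 0) (fun y => Th y = Th x)). now exists x. }
  exists g, Th. split; [reflexivity|]. split; [exact Hg|]. split; [exact Hinc|].
  assert (HIVT : forall lo hi t, lo < hi -> Th lo < t < Th hi -> exists x, lo < x < hi /\ Th x = t).
  { intros lo hi t Hlh Ht. destruct (IVT (fun y => Th y - t) lo hi) as [y [Hy Hyt]]; try lra.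
    - intros y. apply continuity_pt_filterlim.
      apply (continuous_minus (V := R_NormedModule) Th (fun _ => t)); [|apply continuous_const].
      apply continuous_of_derive. eexists; apply HD.
    - exists y. destruct (Req_dec y lo) as [->|Hne]; [lra|]. destruct (Req_dec y hi) as [->|Hne']; lra. }
  intros lo hi t Hlh Ht. destruct (HIVT lo hi t Hlh Ht) as [x [Hx <-]]. rewrite Hg.
  apply is_derive_Reals. intros eps Heps.
  destruct (continuous_eps f x eps (Hc x) Heps) as [r [Hr Hcont]].
  assert (H1 := Hinc (x - r / 2) x ltac:(lra)). assert (H2 := Hinc x (x + r / 2) ltac:(lra)).
  set (del := Rmin (Th x - Th (x - r / 2)) (Th (x + r / 2) - Th x)).
  assert (Hdel : 0 < del) by (apply Rmin_pos; lra).
  assert (Hd1 : del <= Th x - Th (x - r / 2)) by apply Rmin_l.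
  assert (Hd2 : del <= Th (x + r / 2) - Th x) by apply Rmin_r.
  exists (mkposreal del Hdel). intros k Hk0 Hk. simpl in Hk. apply Rabs_def2 in Hk.
  destruct (HIVT (x - r / 2) (x + r / 2) (Th x + k)) as [y [Hy Hyk]]; [lra|lra|].
  replace (Th x + k) with (Th y) by lra. rewrite !Hg.
  (* The difference quotient of the inverse is [f c] for a point [c] within [r] of [x]. *)
  destruct (mean_value Th (fun x => / f x) x r y x) as [c [Hcr E]];
    [intros c _; apply HD|apply Rabs_def1; lra|now apply Rabs_self_lt|].
  replace ((y - x) / k) with (f c); [now apply Hcont|].
  replace k with (Th y - Th x) in Hk0 |- * by lra. rewrite E in Hk0 |- *.
  assert (Hfc := Hp c). field. repeat split; try lra. intros E0. apply Hk0. rewrite E0. ring.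
Qed.

Lemma RInt_param_continuous (f : R -> R -> R) (a b e0 : R) : a <= b ->
  (forall x, a <= x <= b -> continuity_2d_pt f e0 x) ->
  locally e0 (fun e => ex_RInt (f e) a b) -> continuous (fun e => RInt (f e) a b) e0.
Proof.
  intros Hab Hf Hex P HP. apply locally_R in HP. destruct HP as [eps [Heps HP]].
  (* The added 1 covers the case [a = b]. *)
  assert (Heps' : 0 < eps / (b - a + 1)) by (apply Rdiv_lt_0_compat; lra).
  destruct (uniform_continuity_2d_1d' f a b e0 Hf (mkposreal _ Heps')) as [[d Hd] H]; simpl in H.
  assert (Hex0 := locally_singleton _ _ Hex).
  apply locally_R in Hex. destruct Hex as [r [Hr Hex]].
  apply locally_R. exists (Rmin d r). split; [now apply Rmin_pos|]. intros e He. apply HP.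
  assert (Hex' : ex_RInt (f e) a b) by (apply Hex; Rmin_lra).
  assert (Hed : Rabs (e - e0) < d) by Rmin_lra. apply Rabs_def2 in Hed.
  rewrite <- (RInt_minus (V := R_CompleteNormedModule)) by assumption.
  apply Rle_lt_trans with ((b - a) * (eps / (b - a + 1))).
  - apply abs_RInt_le_const; [exact Hab|now apply (ex_RInt_minus (V := R_CompleteNormedModule))|].
    intros x Hx. left. apply H; try lra. now apply Rabs_self_lt.
  - apply Rlt_le_trans with ((b - a + 1) * (eps / (b - a + 1))); [nra|right; field; lra].
Qed.

Lemma inv_sqrt_continuous (w : R -> R) (c x : R) :
  continuous w x -> 0 < w x + c -> continuous (fun x => / sqrt (2 * (w x + c))) x.
Proof.
  intros Hw Hp. apply (continuous_comp w (fun y => / sqrt (2 * (y + c)))); [exact Hw|].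
  apply continuous_of_derive. auto_derive. split; [lra|split; [|exact I]].
  apply Rgt_not_eq, sqrt_lt_R0. lra.
Qed.

(* The integral is the time between [a] and [b] of [x' = sqrt (2 (w x + c e))]. *)
Lemma travel_time_continuous (w : R -> R) (c a b e0 : R) :
  (forall x, continuous w x) -> a <= b ->
  (exists r, 0 < r /\ forall e x, Rabs (e - e0) < r -> 0 < w x + c * e) ->
  continuous (fun e => RInt (fun x => / sqrt (2 * (w x + c * e))) a b) e0.
Proof.
  intros Hw Hab [r [Hr Hlow]].
  apply (RInt_param_continuous (fun e x => / sqrt (2 * (w x + c * e)))); [exact Hab| |].
  - intros x _. assert (Hp := Hlow e0 x (Rabs_self_lt e0 r Hr)).
    apply (continuity_1d_2d_pt_comp (fun z => / sqrt (2 * z)) (fun e x => w x + c * e)).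
    + apply continuity_pt_filterlim, (continuous_of_derive (fun z => / sqrt (2 * z))). auto_derive.
      split; [lra|split; [apply Rgt_not_eq, sqrt_lt_R0; lra|exact I]].
    + apply continuity_2d_pt_plus.
      * apply (continuity_1d_2d_pt_comp w (fun _ x => x)); [apply continuity_pt_filterlim, Hw|apply continuity_2d_pt_id2].
      * apply continuity_2d_pt_mult; [apply continuity_2d_pt_const|apply continuity_2d_pt_id1].
  - apply locally_R. exists r. split; [exact Hr|]. intros e He. apply ex_RInt_of_continuous. intros x.
    now apply inv_sqrt_continuous, Hlow.
Qed.

(* As [e] tends to 0 the time spent near the zero of [w] at the origin diverges
   like [ln (1 / e)]. *)
Lemma travel_time_unbounded (w : R -> R) (C b : R) :
  (forall x, continuous w x) -> (forall x, 0 <= w x) -> 0 < b -> 0 <= C ->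
  (forall x, 0 <= x <= b -> w x <= C * x ^ 2) ->
  forall K e1, 0 < e1 -> exists e, 0 < e < e1 /\
    K < RInt (fun x => / sqrt (2 * (w x + e))) 0 b.
Proof.
  intros Hw Hpos Hb HC Hq K e1 He1.
  set (k := sqrt (2 * (C + 1))).
  assert (Hk : 0 < k) by (apply sqrt_lt_R0; lra).
  (* With [e = r ^ 2], the integrand on [[r, b]] is at least [1 / (k * x)]. The first bound on [r]
     makes [ln (b / r) / k] at least [Rabs K + 1], the second keeps [r] below [b], the third gives
     [r ^ 2 < e1]. *)
  set (r := Rmin (b * exp (- (k * (Rabs K + 1)))) (Rmin (b / 2) (sqrt e1 / 2))).
  assert (Hse : 0 < sqrt e1) by now apply sqrt_lt_R0.
  assert (Hr : 0 < r).
  { repeat apply Rmin_pos; try lra. apply Rmult_lt_0_compat; [exact Hb|apply exp_pos]. }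
  assert (Hrle : r <= b * exp (- (k * (Rabs K + 1))) /\ r <= b / 2 /\ r <= sqrt e1 / 2)
    by (unfold r; repeat split; Rmin_lra).
  destruct Hrle as [Hr1 [Hr2 Hr3]].
  assert (Hr4 : r ^ 2 < e1).
  { assert (E := sqrt_sqrt e1 ltac:(lra)). nra. }
  exists (r ^ 2). split; [split; [now apply pow_lt|exact Hr4]|].
  assert (He : 0 < r ^ 2) by now apply pow_lt.
  set (g := fun x => / sqrt (2 * (w x + r ^ 2))).
  assert (Hgc : forall x, continuous g x).
  { intros x. apply inv_sqrt_continuous; [apply Hw|]. specialize (Hpos x). lra. }
  assert (Hg0 : forall x, 0 < g x).
  { intros x. specialize (Hpos x). apply Rinv_0_lt_compat, sqrt_lt_R0. lra. }
  assert (Hex : forall u v, ex_RInt g u v).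
  { intros u v. now apply ex_RInt_of_continuous. }
  rewrite <- (RInt_Chasles (V := R_CompleteNormedModule) g 0 r b) by apply Hex.
  change (K < RInt g 0 r + RInt g r b).
  assert (H1 : 0 <= RInt g 0 r) by (apply RInt_ge_0; [lra|apply Hex|intros x _; left; apply Hg0]).
  assert (Hln : is_RInt (fun x => / k * / x) r b (/ k * ln b - / k * ln r)).
  { apply (is_RInt_derive (V := R_CompleteNormedModule) (fun x => / k * ln x)).
    - intros x Hx. rewrite Rmin_left in Hx by lra. auto_derive; [lra|field; lra].
    - intros x Hx. rewrite Rmin_left in Hx by lra. apply continuous_of_derive. auto_derive. lra. }
  assert (H2 : / k * ln b - / k * ln r <= RInt g r b).
  { rewrite <- (is_RInt_unique _ _ _ _ Hln).
    apply RInt_le; [lra|now exists (/ k * ln b - / k * ln r)|apply Hex|].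
    intros x Hx. unfold g. rewrite <- Rinv_mult. apply Rinv_le_contravar.
    - specialize (Hpos x). apply sqrt_lt_R0. lra.
    - replace (k * x) with (sqrt (2 * (C + 1) * x ^ 2)).
      + apply sqrt_le_1_alt. specialize (Hq x ltac:(lra)).
        assert (r ^ 2 <= x ^ 2) by (apply pow_incr; lra). nra.
      + unfold k. rewrite sqrt_mult by nra. now rewrite sqrt_pow2 by lra. }
  assert (H3 : ln r <= ln b - k * (Rabs K + 1)).
  { replace (ln b - k * (Rabs K + 1)) with (ln (b * exp (- (k * (Rabs K + 1))))).
    - apply Rcomplements.ln_le; [exact Hr|exact Hr1].
    - rewrite ln_mult by (try apply exp_pos; lra). rewrite ln_exp. ring. }
  assert (H4 : Rabs K + 1 <= / k * ln b - / k * ln r).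
  { rewrite <- Rmult_minus_distr_l. apply Rmult_le_reg_l with k; [exact Hk|].
    rewrite <- Rmult_assoc, Rinv_r by lra. lra. }
  assert (H5 := Rle_abs K). lra.
Qed.

(** The number [n] of turns is fixed first, at [e = ea], and is so large that the motion in [y] is
    the slower one there. As [e] decreases with [n] fixed, the time in [y] stays bounded by [Bd]
    while the time in [x] diverges, so the order of the two times is reversed at some [eb]. *)
Lemma time_matching (w v : R -> R) (C V0 V1 a b p q : R) :
  (forall x, continuous w x) -> (forall x, continuous v x) ->
  (forall x, 0 <= w x) -> 0 < V0 -> (forall y, V0 <= v y <= V1) ->
  a < 0 -> 0 < b -> 0 <= C -> (forall x, 0 <= x <= b -> w x <= C * x ^ 2) ->
  forall e1, 0 < e1 -> exists (n : nat) (e : R), 0 < e < e1 /\ e < V0 /\ p < q + 2 * INR n * PI /\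
    RInt (fun x => / sqrt (2 * (w x + e))) a b =
    RInt (fun y => / sqrt (2 * (v y - e))) p (q + 2 * INR n * PI).
Proof.
  intros Hw Hv Hwp HV0 HV Ha Hb HC Hq e1 He1.
  (* Half of the minimum, so that [v - e] is bounded away from 0 for all [e <= ea]. *)
  set (ea := Rmin e1 V0 / 2).
  assert (Hea : 0 < ea /\ ea < e1 /\ ea < V0).
  { assert (0 < Rmin e1 V0) by now apply Rmin_pos. unfold ea. repeat split; Rmin_lra. }
  set (T := fun e => RInt (fun x => / sqrt (2 * (w x + 1 * e))) a b).
  set (S := fun n e => RInt (fun y => / sqrt (2 * (v y + -1 * e))) p (q + 2 * INR n * PI)).
  assert (HVV : V0 <= V1) by (specialize (HV 0); lra).
  assert (HTex : forall e u u', 0 < e -> ex_RInt (fun x => / sqrt (2 * (w x + 1 * e))) u u').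
  { intros e u u' He. apply ex_RInt_of_continuous. intros x.
    apply inv_sqrt_continuous; [apply Hw|]. specialize (Hwp x). lra. }
  assert (HSex : forall e u u', e < V0 -> ex_RInt (fun y => / sqrt (2 * (v y + -1 * e))) u u').
  { intros e u u' He. apply ex_RInt_of_continuous. intros x.
    apply inv_sqrt_continuous; [apply Hv|]. specialize (HV x). lra. }
  assert (HPI := PI_RGT_0).
  set (kk := sqrt (2 * V1)). assert (Hkk : 0 < kk) by (apply sqrt_lt_R0; lra).
  assert (Hn : exists n : nat, p < q + 2 * INR n * PI /\ T ea < S n ea).
  { destruct (INR_unbounded (Rabs (p - q) + kk * (Rabs (T ea) + 1))) as [n Hn].
    exists n. assert (H1 := Rle_abs (p - q)). assert (H2 := Rabs_pos (T ea)).
    assert (H3 : INR n <= 2 * INR n * PI).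
    { assert (HPI2 := PI2_1). assert (0 <= INR n) by apply pos_INR. nra. }
    assert (H4 : kk * (Rabs (T ea) + 1) < q + 2 * INR n * PI - p) by lra.
    assert (H5 : 0 <= kk * (Rabs (T ea) + 1)) by (apply Rmult_le_pos; lra).
    split; [lra|].
    assert (H6 : RInt (fun _ => / kk) p (q + 2 * INR n * PI) <= S n ea).
    { apply RInt_le; [lra|apply (ex_RInt_const (V := R_NormedModule))|now apply HSex|].
      intros y _. specialize (HV y). apply Rinv_le_contravar; [apply sqrt_lt_R0; lra|].
      apply sqrt_le_1_alt. lra. }
    rewrite RInt_const in H6. unfold scal in H6; simpl in H6; unfold mult in H6; simpl in H6.
    assert (H7 : Rabs (T ea) + 1 < (q + 2 * INR n * PI - p) * / kk).
    { apply Rlt_div_r; lra. }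
    assert (H8 := Rle_abs (T ea)). lra. }
  destruct Hn as [n [Hpn HTS]]. exists n.
  set (k0 := sqrt (2 * (V0 - ea))). assert (Hk0 : 0 < k0) by (apply sqrt_lt_R0; lra).
  set (Bd := (q + 2 * INR n * PI - p) * / k0).
  assert (HSB : forall e, e <= ea -> S n e <= Bd).
  { intros e He. assert (H6 : S n e <= RInt (fun _ => / k0) p (q + 2 * INR n * PI)).
    { apply RInt_le; [lra|apply HSex; lra|apply (ex_RInt_const (V := R_NormedModule))|].
      intros y _. specialize (HV y). apply Rinv_le_contravar; [exact Hk0|].
      apply sqrt_le_1_alt. lra. }
    rewrite RInt_const in H6. exact H6. }
  destruct (travel_time_unbounded w C b Hw Hwp Hb HC Hq Bd ea) as [eb [Heb HTb]]; [lra|].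
  assert (HTb' : Bd < T eb).
  { unfold T. rewrite <- (RInt_Chasles (V := R_CompleteNormedModule) _ a 0 b) by (apply HTex; lra).
    change (Bd < RInt (fun x => / sqrt (2 * (w x + 1 * eb))) a 0 + RInt (fun x => / sqrt (2 * (w x + 1 * eb))) 0 b).
    assert (0 <= RInt (fun x => / sqrt (2 * (w x + 1 * eb))) a 0).
    { apply RInt_ge_0; [lra|apply HTex; lra|]. intros x _. specialize (Hwp x).
      left. apply Rinv_0_lt_compat, sqrt_lt_R0. lra. }
    rewrite (RInt_ext (fun x => / sqrt (2 * (w x + 1 * eb))) (fun x => / sqrt (2 * (w x + eb))) 0 b).
    - lra.
    - intros x _. now rewrite Rmult_1_l. }
  destruct (Ranalysis5.IVT_interv (fun e => S n e - T e) eb ea) as [e [He HeST]].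
  - intros e He. apply continuity_pt_filterlim.
    apply (continuous_minus (V := R_NormedModule) (S n) T).
    + apply (travel_time_continuous v (-1) p (q + 2 * INR n * PI)); [exact Hv|lra|].
      exists ((V0 - ea) / 2). split; [lra|]. intros e' y He'. apply Rabs_def2 in He'.
      specialize (HV y). lra.
    + apply (travel_time_continuous w 1 a b); [exact Hw|lra|].
      exists (eb / 2). split; [lra|]. intros e' y He'. apply Rabs_def2 in He'.
      specialize (Hwp y). lra.
  - lra.
  - specialize (HSB eb ltac:(lra)). lra.
  - lra.
  - exists e. split; [lra|]. split; [lra|]. split; [exact Hpn|].
    transitivity (T e).
    + apply RInt_ext. intros x _. now rewrite Rmult_1_l.
    + transitivity (S n e); [lra|]. apply RInt_ext. intros y _. do 3 f_equal. ring.
Qed.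

(** * The boundary curve *)

Section Billiard.

Variable gamma : R -> plane.
Hypothesis Hgamma : analytic_simple_closed_curve gamma.

Definition gx (s : R) := fst (gamma s).
Definition gy (s : R) := snd (gamma s).
Definition dx (s : R) := Derive gx s.
Definition dy (s : R) := Derive gy s.

Lemma curve_C1 (s : R) :
  is_derive gx s (dx s) /\ is_derive gy s (dy s) /\ continuous dx s /\ continuous dy s.
Proof.
  destruct Hgamma as [_ [Han _]]. destruct (Han s) as [H1 H2].
  apply analytic_at_C1 in H1, H2. destruct H1, H2.
  repeat split; auto; now apply Derive_correct.
Qed.

Lemma curve_continuous (s : R) : continuous gx s /\ continuous gy s.
Proof.
  destruct (curve_C1 s) as [H1 [H2 _]].
  split; apply continuous_of_derive; eexists; eassumption.
Qed.

Lemma speed_sqr_pos (s : R) : 0 < dx s ^ 2 + dy s ^ 2.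
Proof.
  destruct Hgamma as [_ [_ [Hv _]]]. apply sqr_sum_pos. intros [E1 E2]. apply (Hv s).
  unfold velocity. now fold gx gy; fold (dx s) (dy s); rewrite E1, E2.
Qed.

Lemma gamma_period (s : R) (k : Z) : gamma (s + 2 * IZR k * PI) = gamma s.
Proof.
  destruct Hgamma as [Hper _].
  assert (Hn : forall (n : nat) s, gamma (s + 2 * INR n * PI) = gamma s).
  { induction n as [|n IH]; intros s'.
    - simpl. f_equal; ring.
    - rewrite S_INR. replace (s' + 2 * (INR n + 1) * PI) with (s' + 2 * INR n * PI + 2 * PI) by ring.
      now rewrite Hper. }
  destruct (Z_le_gt_dec 0 k) as [Hk|Hk].
  - rewrite <- (Z2Nat.id k Hk), <- INR_IZR_INZ. apply Hn.
  - rewrite <- (Hn (Z.to_nat (- k)) (s + 2 * IZR k * PI)). f_equal.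
    rewrite INR_IZR_INZ, Z2Nat.id, opp_IZR by lia. ring.
Qed.

Lemma gamma_representative (lo s : R) :
  exists s', lo <= s' < lo + 2 * PI /\ gamma s' = gamma s.
Proof.
  assert (HPI := PI_RGT_0).
  set (k := up ((lo - s) / (2 * PI))).
  destruct (archimed ((lo - s) / (2 * PI))) as [H1 H2]. fold k in H1, H2.
  assert (E : lo - s = (lo - s) / (2 * PI) * (2 * PI)) by (field; lra).
  destruct (Req_dec (IZR k - (lo - s) / (2 * PI)) 1) as [E1|E1].
  - exists (s + 2 * IZR (k - 1) * PI). split; [|apply gamma_period].
    rewrite minus_IZR. nra.
  - exists (s + 2 * IZR k * PI). split; [|apply gamma_period]. nra.
Qed.

Lemma gamma_injective (s t : R) : gamma s = gamma t -> Rabs (s - t) < 2 * PI -> s = t.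
Proof.
  intros E H. destruct Hgamma as [_ [_ [_ Hinj]]]. destruct (Hinj s t E) as [k ->].
  apply Rabs_def2 in H. assert (HPI := PI_RGT_0).
  assert (-1 < IZR k < 1) by (split; nra).
  replace k with 0%Z by (assert (-1 < k < 1)%Z by (split; apply lt_IZR; lra); lia). ring.
Qed.

Lemma sqr_dist_continuous (p q s : R) : continuity_pt (fun s => (gx s - p) ^ 2 + (gy s - q) ^ 2) s.
Proof.
  destruct (curve_C1 s) as [Hx [Hy _]]. apply continuity_pt_filterlim.
  apply (continuous_of_derive (fun s => (gx s - p) ^ 2 + (gy s - q) ^ 2)).
  auto_derive. repeat split; eexists; eassumption.
Qed.

(** On the rest of one period, a compact interval, the distance to [gamma s0] has a positive minimum
    by injectivity. *)
Lemma local_parameter (s0 d : R) :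
  0 < d -> exists rho, 0 < rho /\
    forall s, Rabs (gx s - gx s0) < rho -> Rabs (gy s - gy s0) < rho ->
    exists s', Rabs (s' - s0) < d /\ gamma s' = gamma s.
Proof.
  intros Hd. assert (HPI := PI_RGT_0).
  set (d' := Rmin (d / 2) (PI / 2)).
  assert (Hd' : 0 < d' < PI /\ d' < d).
  { unfold d', Rmin. destruct (Rle_dec (d/2) (PI/2)); lra. }
  set (D := fun s => (gx s - gx s0) ^ 2 + (gy s - gy s0) ^ 2).
  destruct (continuity_ab_min D (s0 + d') (s0 + 2 * PI - d')) as [m [Hmin Hm]]; [lra|intros; apply sqr_dist_continuous|].
  assert (HDm : 0 < D m).
  { apply sqr_sum_pos. intros [E1 E2]. assert (m = s0); [|lra].
    apply gamma_injective; [|apply Rabs_def1; lra].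
    apply injective_projections; [unfold gx in E1|unfold gy in E2]; lra. }
  exists (Rmin 1 (D m / 2)). split; [apply Rmin_pos; lra|].
  intros s Hx Hy.
  destruct (gamma_representative (s0 - d') s) as [s' [Hs' Hg]].
  exists s'. split; [|exact Hg].
  destruct (Rlt_le_dec s' (s0 + d')) as [Hlt|Hge]; [apply Rabs_def1; lra|exfalso].
  assert (HD : D m <= D s') by (apply Hmin; lra).
  assert (Hsmall : forall z, Rabs z < Rmin 1 (D m / 2) -> z ^ 2 < D m / 2).
  { intros z Hz. rewrite <- pow2_abs. assert (H0 := Rabs_pos z).
    assert (Rabs z < 1 /\ Rabs z < D m / 2) by (split; Rmin_lra). nra. }
  apply Hsmall in Hx. apply Hsmall in Hy.
  unfold D in HD at 2. unfold gx in *; unfold gy in *. rewrite Hg in HD. lra.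
Qed.

(* [along] and [across] are the coordinates, scaled by the speed at [s0], of
   [gamma s - gamma s0] in the frame of the tangent at [s0]. *)
Definition along (s0 s : R) : R := (gx s - gx s0) * dx s0 + (gy s - gy s0) * dy s0.
Definition across (s0 s : R) : R := (gy s - gy s0) * dx s0 - (gx s - gx s0) * dy s0.

Lemma along_derive (s0 c : R) : is_derive (along s0) c (dx c * dx s0 + dy c * dy s0).
Proof.
  destruct (curve_C1 c) as [Hx [Hy _]]. unfold along. auto_derive; [repeat split; eexists; eassumption|].
  rewrite (is_derive_unique (fun s : R => gx s) c _ Hx), (is_derive_unique (fun s : R => gy s) c _ Hy). ring.
Qed.

Lemma across_derive (s0 c : R) : is_derive (across s0) c (dy c * dx s0 - dx c * dy s0).
Proof.
  destruct (curve_C1 c) as [Hx [Hy _]]. unfold across. auto_derive; [repeat split; eexists; eassumption|].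
  rewrite (is_derive_unique (fun s : R => gx s) c _ Hx), (is_derive_unique (fun s : R => gy s) c _ Hy). ring.
Qed.

Lemma velocity_combination_continuous (p q s : R) : continuous (fun s => dx s * p + dy s * q) s.
Proof.
  destruct (curve_C1 s) as [_ [_ [Hx Hy]]].
  apply (continuous_plus (V := R_NormedModule) (fun s => dx s * p) (fun s => dy s * q));
    apply (continuous_scal_l (V := R_NormedModule)); assumption.
Qed.

(** At [s0] the derivative of [along] is the squared speed and that of [across] is 0. By continuity
    of the velocity, near [s0] the curve is a graph over its tangent with Lipschitz constant
    [kappa]. *)
Lemma along_across (s0 kappa : R) :
  0 < kappa -> exists d, 0 < d /\ forall s s', Rabs (s - s0) < d -> Rabs (s' - s0) < d ->
    (exists a, (dx s0 ^ 2 + dy s0 ^ 2) / 2 <= a /\ along s0 s - along s0 s' = a * (s - s')) /\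
    Rabs (across s0 s - across s0 s') <= kappa * Rabs (along s0 s - along s0 s').
Proof.
  intros Hk. set (L := dx s0 ^ 2 + dy s0 ^ 2).
  assert (HL : 0 < L) by apply speed_sqr_pos.
  assert (He : 0 < Rmin (L / 2) (kappa * (L / 2))) by (apply Rmin_pos; nra).
  destruct (continuous_eps _ _ _ (velocity_combination_continuous (dx s0) (dy s0) s0) He) as [d1 [Hd1 H1]].
  destruct (continuous_eps _ _ _ (velocity_combination_continuous (- dy s0) (dx s0) s0) He) as [d2 [Hd2 H2]].
  exists (Rmin d1 d2). split; [now apply Rmin_pos|]. intros s s' Hs Hs'.
  destruct (mean_value (along s0) _ s0 (Rmin d1 d2) s s' (fun c _ => along_derive s0 c) Hs Hs') as [c [Hc Ec]].
  destruct (mean_value (across s0) _ s0 (Rmin d1 d2) s s' (fun c _ => across_derive s0 c) Hs Hs') as [c' [Hc' Ec']].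
  specialize (H1 c ltac:(Rmin_lra)). specialize (H2 c' ltac:(Rmin_lra)).
  assert (Ha : L / 2 <= dx c * dx s0 + dy c * dy s0).
  { apply Rabs_def2 in H1. unfold L in *. Rmin_lra. }
  split; [exists (dx c * dx s0 + dy c * dy s0); now split|].
  rewrite Ec, Ec', !Rabs_mult, <- Rmult_assoc. apply Rmult_le_compat_r; [apply Rabs_pos|].
  rewrite (Rabs_pos_eq (dx c * _ + _)) by lra. apply Rle_trans with (kappa * (L / 2)); [|nra].
  replace (dy c' * dx s0 - dx c' * dy s0) with (dx c' * - dy s0 + dy c' * dx s0 - (dx s0 * - dy s0 + dy s0 * dx s0)) by ring.
  Rmin_lra.
Qed.

(** Collar chart. The displacement is along the fixed normal direction at [s0], not at [s], so that
    the [along] coordinate does not depend on [t]. *)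
Definition shift (s0 s t : R) : plane := (gx s - t * dy s0, gy s + t * dx s0).

(** In the chart [along] depends on [s] alone and is increasing in it. Hence a chart point on the
    curve has [t = 0]; and a point near [gamma s0] is reached by solving for [s] with the
    intermediate value theorem and reading [t] off the normal component. *)
Lemma collar (s0 kappa : R) :
  0 < kappa -> exists d, 0 < d /\
    (forall s s', Rabs (s - s0) < d -> Rabs (s' - s0) < d ->
       Rabs (across s0 s - across s0 s') <= kappa * Rabs (along s0 s - along s0 s')) /\
    (forall s t s', Rabs (s - s0) < d -> Rabs t < d -> gamma s' = shift s0 s t -> t = 0) /\
    locally (gamma s0) (fun q => exists s t, Rabs (s - s0) < d /\ Rabs t < d /\ q = shift s0 s t).
Proof.
  intros Hk. set (L := dx s0 ^ 2 + dy s0 ^ 2).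
  assert (HL : 0 < L) by apply speed_sqr_pos.
  destruct (along_across s0 kappa Hk) as [d1 [Hd1 H1]]. fold L in H1.
  destruct (local_parameter s0 d1 Hd1) as [rho [Hrho Hloc]].
  destruct (curve_continuous s0) as [Hcx Hcy].
  destruct (continuous_eps _ _ (rho / 2) Hcx ltac:(lra)) as [d2 [Hd2 H2]].
  destruct (continuous_eps _ _ (rho / 2) Hcy ltac:(lra)) as [d3 [Hd3 H3]].
  set (S := Rabs (dx s0) + Rabs (dy s0) + 1).
  assert (HS : Rabs (dx s0) < S /\ Rabs (dy s0) < S /\ 1 <= S).
  { assert (Hx := Rabs_pos (dx s0)). assert (Hy := Rabs_pos (dy s0)). unfold S. lra. }
  assert (Hd : exists d, 0 < d /\ d <= d1 /\ d <= rho / 2 / S /\ d <= d2 /\ d <= d3).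
  { exists (Rmin (Rmin d1 (rho / 2 / S)) (Rmin d2 d3)). split; [|repeat split; Rmin_lra].
    repeat apply Rmin_pos; try lra. apply Rdiv_lt_0_compat; lra. }
  destruct Hd as [d [Hd [Hl1 [Hl2 [Hl3 Hl4]]]]].
  assert (Hlip : forall s s', Rabs (s - s0) < d -> Rabs (s' - s0) < d ->
    Rabs (across s0 s - across s0 s') <= kappa * Rabs (along s0 s - along s0 s'))
    by (intros s s' Hs Hs'; apply H1; lra).
  exists d. split; [exact Hd|]. split; [exact Hlip|split].
  - intros s t s' Hs Ht Heq.
    assert (Ex : fst (gamma s') = gx s - t * dy s0) by now rewrite Heq.
    assert (Ey : snd (gamma s') = gy s + t * dx s0) by now rewrite Heq.
    destruct (Hloc s') as [s'' [Hs'' Hg]].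
    + unfold gx at 1; rewrite Ex.
      replace (gx s - t * dy s0 - gx s0) with ((gx s - gx s0) + - (t * dy s0)) by ring.
      eapply Rle_lt_trans; [apply Rabs_triang|]. rewrite Rabs_Ropp.
      assert (Hts := mult_small t (dy s0) S (rho / 2) ltac:(lra) ltac:(lra)).
      specialize (H2 s ltac:(lra)). lra.
    + unfold gy at 1; rewrite Ey.
      replace (gy s + t * dx s0 - gy s0) with ((gy s - gy s0) + t * dx s0) by ring.
      eapply Rle_lt_trans; [apply Rabs_triang|].
      assert (Hts := mult_small t (dx s0) S (rho / 2) ltac:(lra) ltac:(lra)).
      specialize (H3 s ltac:(lra)). lra.
    + rewrite <- Hg in Ex, Ey. change (gx s'' = gx s - t * dy s0) in Ex.
      change (gy s'' = gy s + t * dx s0) in Ey.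
      assert (Ea : along s0 s'' = along s0 s) by (unfold along; rewrite Ex, Ey; ring).
      assert (Es : s'' = s).
      { destruct (H1 s'' s) as [[a [Ha E]] _]; [lra..|]. nra. }
      rewrite Es in Ex, Ey. apply Rmult_eq_reg_r with L; [|lra].
      replace (t * L) with ((t * dx s0) * dx s0 + (t * dy s0) * dy s0) by (unfold L; ring).
      replace (t * dx s0) with 0 by lra. replace (t * dy s0) with 0 by lra. ring.
  - set (A := L / 2 * (d / 2)). assert (HA : 0 < A) by (unfold A; nra).
    assert (E1 : along s0 s0 = 0) by (unfold along; ring).
    assert (E0 : across s0 s0 = 0) by (unfold across; ring).
    assert (Hs0 := Rabs_self_lt s0 d Hd).
    assert (Hdl : along s0 (s0 - d / 2) <= - A).
    { destruct (H1 s0 (s0 - d / 2)) as [[a [Ha E]] _]; try (apply Rabs_def1; lra). unfold A. nra. }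
    assert (Hdh : A <= along s0 (s0 + d / 2)).
    { destruct (H1 (s0 + d / 2) s0) as [[a [Ha E]] _]; try (apply Rabs_def1; lra). unfold A. nra. }
    (* The first condition puts the tangential component of [q] in the range of [along] on
       [[s0 - d / 2, s0 + d / 2]]; the second makes the resulting [t] smaller than [d]. *)
    assert (He : exists e, 0 < e /\ e * (4 * S) <= A /\ e * (8 * (kappa + 1) * S) <= L * d).
    { exists (Rmin (A / (4 * S)) (L * d / (8 * (kappa + 1) * S))).
      split; [apply Rmin_pos; apply Rdiv_lt_0_compat; nra|].
      split; apply Rle_div_r; try Rmin_lra; nra. }
    destruct He as [e [He [He1 He2]]].
    apply locally_plane. exists e. split; [exact He|].
    intros [qx qy] Hqx Hqy; simpl in Hqx, Hqy.
    change (Rabs (qx - gx s0) < e) in Hqx. change (Rabs (qy - gy s0) < e) in Hqy.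
    set (aq := (qx - gx s0) * dx s0 + (qy - gy s0) * dy s0).
    set (bq := (qy - gy s0) * dx s0 - (qx - gx s0) * dy s0).
    assert (Hprod : forall u v, Rabs u < e -> Rabs v < S -> Rabs (u * v) <= e * S).
    { intros u v Hu Hv. rewrite Rabs_mult. apply Rmult_le_compat; try apply Rabs_pos; lra. }
    assert (Haq : Rabs aq <= 2 * (e * S)).
    { unfold aq. eapply Rle_trans; [apply Rabs_triang|].
      assert (Ha1 := Hprod _ (dx s0) Hqx ltac:(lra)). assert (Ha2 := Hprod _ (dy s0) Hqy ltac:(lra)). lra. }
    assert (Hbq : Rabs bq <= 2 * (e * S)).
    { unfold bq, Rminus at 1. eapply Rle_trans; [apply Rabs_triang|]. rewrite Rabs_Ropp.
      assert (Ha1 := Hprod _ (dy s0) Hqx ltac:(lra)). assert (Ha2 := Hprod _ (dx s0) Hqy ltac:(lra)). lra. }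
    assert (Haq' := Haq). apply Rabs_le_between in Haq'.
    destruct (IVT (fun s => along s0 s - aq) (s0 - d / 2) (s0 + d / 2)) as [s [Hs Has]]; try lra.
    { intros s. apply continuity_pt_filterlim.
      apply (continuous_minus (V := R_NormedModule) (along s0) (fun _ => aq)); [|apply continuous_const].
      apply continuous_of_derive. eexists; apply along_derive. }
    assert (Hsd : Rabs (s - s0) < d) by (apply Rabs_def1; lra).
    assert (Hbs := Hlip s s0 Hsd Hs0). rewrite E0, E1, !Rminus_0_r in Hbs.
    replace (along s0 s) with aq in Hbs by lra.
    exists s, ((bq - across s0 s) / L). split; [exact Hsd|]. split.
    + unfold Rdiv. rewrite Rabs_mult, Rabs_inv, (Rabs_pos_eq L) by lra.
      apply Rlt_div_l; [exact HL|].
      eapply Rle_lt_trans; [apply Rabs_triang|]. rewrite Rabs_Ropp.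
      assert (HeS : 0 < e * S) by nra.
      assert (kappa * Rabs aq <= kappa * (2 * (e * S))) by (apply Rmult_le_compat_l; lra).
      nra.
    + replace (bq - across s0 s) with ((qy - gy s) * dx s0 - (qx - gx s) * dy s0) by (unfold bq, across; ring).
      destruct (orthogonal_multiple (qx - gx s) (qy - gy s) (dx s0) (dy s0) HL) as [Ex Ey];
        [unfold aq, along in Has; lra|]. fold L in Ex, Ey.
      apply injective_projections; simpl; lra.
Qed.

(** * The two sides of the boundary curve *)

Variable Omega : plane -> Prop.
Hypothesis Hopen : open Omega.
Hypothesis Hbounded : bounded_set Omega.
Hypothesis Hboundary : forall x, boundary Omega x <-> exists theta, x = gamma theta.

Lemma boundary_gamma (s : R) : boundary Omega (gamma s).
Proof. apply Hboundary. now exists s. Qed.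

Lemma not_Omega_gamma (s : R) : ~ Omega (gamma s).
Proof. intros H. apply (proj1 (boundary_gamma s)). now apply Hopen. Qed.

Lemma shift_0 (s0 s : R) : shift s0 s 0 = gamma s.
Proof. apply injective_projections; unfold shift, gx, gy; simpl; ring. Qed.

(** The segment joining the two parameter pairs keeps [t] away from 0, so its image avoids the
    boundary. *)
Lemma side_connected (s0 d : R) :
  (forall s t s', Rabs (s - s0) < d -> Rabs t < d -> gamma s' = shift s0 s t -> t = 0) ->
  forall s s' t t', Rabs (s - s0) < d -> Rabs (s' - s0) < d -> Rabs t < d -> Rabs t' < d ->
    0 < t * t' -> Omega (shift s0 s t) -> Omega (shift s0 s' t').
Proof.
  intros Hav s s' t t' Hs Hs' Ht Ht' Htt HO.
  set (sr := fun r => s + r * (s' - s)). set (tr := fun r => t + r * (t' - t)).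
  assert (Hlin : forall a b r, continuous (fun r => a + r * (b - a)) r).
  { intros a b r. apply continuous_of_derive.
    auto_derive. exact I. }
  assert (Hsc : forall c r, continuous (fun r => tr r * c) r).
  { intros c r. apply (continuous_scal_l (V := R_NormedModule) tr c). apply Hlin. }
  apply Rabs_def2 in Hs, Hs', Ht, Ht'.
  assert (H : Omega (shift s0 (sr 1) (tr 1))).
  { apply (path_stays Omega (fun r => gx (sr r) - tr r * dy s0) (fun r => gy (sr r) + tr r * dx s0)).
    - intros r _. destruct (curve_continuous (sr r)) as [Hx Hy]. split.
      + apply (continuous_minus (V := R_NormedModule) (fun r => gx (sr r))); [|apply Hsc].
        apply (continuous_comp sr gx); [apply Hlin|exact Hx].
      + apply (continuous_plus (V := R_NormedModule) (fun r => gy (sr r))); [|apply Hsc].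
        apply (continuous_comp sr gy); [apply Hlin|exact Hy].
    - intros r Hr Hb. apply Hboundary in Hb. destruct Hb as [s'' Hb].
      assert (H0 : tr r = 0).
      { apply (Hav (sr r) (tr r) s''); [| |now rewrite <- Hb];
          [assert (Hc := convex_bounds (s0 - d) (s0 + d) s s' r ltac:(lra) ltac:(lra) Hr); unfold sr
          |assert (Hc := convex_bounds (- d) d t t' r ltac:(lra) ltac:(lra) Hr); unfold tr]; apply Rabs_def1; lra. }
      destruct (Rlt_le_dec 0 t) as [Htp|Htn].
      + assert (0 < t') by nra.
        assert (Hc := convex_bounds 0 d t t' r ltac:(lra) ltac:(lra) Hr). unfold tr in H0. lra.
      + assert (t < 0 /\ t' < 0) by (split; nra).
        assert (Hc := convex_bounds (- d) 0 t t' r ltac:(lra) ltac:(lra) Hr). unfold tr in H0. lra.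
    - replace (gx (sr 0) - tr 0 * dy s0, gy (sr 0) + tr 0 * dx s0) with (shift s0 s t); [exact HO|].
      unfold shift, sr, tr. now rewrite !Rmult_0_l, !Rplus_0_r. }
  revert H. unfold sr, tr. replace (s + 1 * (s' - s)) with s' by ring.
  now replace (t + 1 * (t' - t)) with t' by ring.
Qed.

(** The alternative to be excluded: [Omega] on both sides of the curve, as around a slit. *)
Definition two_sided (s : R) := locally (gamma s) (fun q => Omega q \/ boundary Omega q).

Lemma shift_near (s0 s : R) (P : plane -> Prop) :
  locally (gamma s) P -> exists e, 0 < e /\ forall t, Rabs t < e -> P (shift s0 s t).
Proof.
  intros HP. apply locally_plane in HP. destruct HP as [e [He HP]].
  set (S := Rabs (dx s0) + Rabs (dy s0) + 1).
  assert (Hx := Rabs_pos (dx s0)). assert (Hy := Rabs_pos (dy s0)).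
  exists (e / S). split; [apply Rdiv_lt_0_compat; unfold S; lra|].
  intros t Ht. apply HP; unfold shift; simpl.
  - unfold gx. replace (_ - _ - _) with (- (t * dy s0)) by ring.
    rewrite Rabs_Ropp. apply (mult_small _ _ S); [exact Ht|unfold S; lra].
  - unfold gy. replace (_ + _ - _) with (t * dx s0) by ring.
    apply (mult_small _ _ S); [exact Ht|unfold S; lra].
Qed.

Lemma gamma_near (s : R) (P : plane -> Prop) :
  locally (gamma s) P -> locally s (fun s' => P (gamma s')).
Proof.
  intros HP. apply locally_plane in HP. destruct HP as [e [He HP]].
  destruct (curve_continuous s) as [Hx Hy].
  destruct (continuous_eps _ _ _ Hx He) as [d1 [Hd1 H1]].
  destruct (continuous_eps _ _ _ Hy He) as [d2 [Hd2 H2]].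
  apply locally_R. exists (Rmin d1 d2). split; [now apply Rmin_pos|].
  intros s' Hs'. apply HP; [apply H1|apply H2]; Rmin_lra.
Qed.

(** Some chart point with [t0 <> 0] lies outside [Omega]. The whole side of the collar containing it
    is then outside, and this side touches all neighbouring curve points. *)
Lemma not_two_sided_open (s0 : R) :
  ~ two_sided s0 -> locally s0 (fun s => ~ two_sided s).
Proof.
  intros Hn. destruct (collar s0 1 Rlt_0_1) as [d [Hd [_ [Hav Hcov]]]].
  assert (Hside := side_connected s0 d Hav).
  assert (Habs := Rabs_self_lt s0 d Hd).
  assert (H : exists t0, Rabs t0 < d /\ t0 <> 0 /\ ~ Omega (shift s0 s0 t0)).
  { apply NNPP. intros H. apply Hn. unfold two_sided. refine (filter_imp _ _ _ Hcov).
    intros q [s [t [Hs [Ht ->]]]].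
    destruct (Req_dec t 0) as [->|Ht0].
    - right. rewrite shift_0. apply boundary_gamma.
    - left. apply (Hside s0 s t t); auto; [nra|].
      apply NNPP. intros HO. apply H. now exists t. }
  destruct H as [t0 [Ht0 [Hne HO]]].
  apply locally_R. exists d. split; [exact Hd|]. intros s Hs Hts.
  destruct (shift_near s0 s _ Hts) as [e [He Hsh]].
  (* A small displacement on the same side as [t0]. *)
  set (t := t0 * Rmin 1 (e / 2 / Rabs t0)).
  assert (Ht0p : 0 < Rabs t0) by now apply Rabs_pos_lt.
  assert (Hm : 0 < Rmin 1 (e / 2 / Rabs t0)) by (apply Rmin_pos; [lra|apply Rdiv_lt_0_compat; lra]).
  assert (Htd : Rabs t < d /\ Rabs t < e).
  { unfold t. rewrite Rabs_mult, (Rabs_pos_eq (Rmin _ _)) by lra.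
    assert (Rmin 1 (e / 2 / Rabs t0) <= 1 /\ Rmin 1 (e / 2 / Rabs t0) <= e / 2 / Rabs t0) by (split; Rmin_lra).
    split; [nra|]. apply Rle_lt_trans with (Rabs t0 * (e / 2 / Rabs t0)); [nra|].
    replace (Rabs t0 * (e / 2 / Rabs t0)) with (e / 2) by (field; lra). lra. }
  assert (Hpos : 0 < t * t0) by (unfold t; assert (0 < t0 * t0) by nra; nra).
  destruct (Hsh t) as [Hq|Hq]; [apply Htd| |].
  - apply HO. apply (Hside s s0 t t0); tauto.
  - apply Hboundary in Hq. destruct Hq as [s' Hq].
    assert (t = 0) by (apply (Hav s t s'); [exact Hs|tauto|now symmetry]). nra.
Qed.

(** At a curve point farthest from [gamma 0], the ray pointing away from [gamma 0] never meets the
    curve again. With [Omega] on both sides it would start in [Omega] and, [Omega] being bounded,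
    have to leave it through the boundary. *)
Lemma exists_not_two_sided : exists s, ~ two_sided s.
Proof.
  set (D := fun s => (gx s - gx 0) ^ 2 + (gy s - gy 0) ^ 2).
  assert (HPI := PI2_1).
  destruct (continuity_ab_maj D 0 (2 * PI)) as [m [Hmax Hm]]; [lra|intros; apply sqr_dist_continuous|].
  assert (HD : forall s, D s <= D m).
  { intros s. destruct (gamma_representative 0 s) as [s' [Hs' Hg]].
    replace (D s) with (D s') by (unfold D, gx, gy; now rewrite Hg). apply Hmax; lra. }
  assert (HDm : 0 < D m).
  { apply Rlt_le_trans with (D 1); [|apply HD]. apply sqr_sum_pos. intros [E1 E2].
    assert (1 = 0); [|lra]. apply gamma_injective; [|apply Rabs_def1; lra].
    apply injective_projections; [unfold gx in E1|unfold gy in E2]; lra. }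
  exists m. intros Hts. apply locally_plane in Hts. destruct Hts as [e [He Hts]].
  set (wx := gx m - gx 0). set (wy := gy m - gy 0). set (S := Rabs wx + Rabs wy + 1).
  assert (Hax := Rabs_pos wx). assert (Hay := Rabs_pos wy).
  assert (HS : 0 < e / S) by (apply Rdiv_lt_0_compat; unfold S; lra).
  set (t := e / S / 2). assert (HtS : Rabs t < e / S) by (rewrite Rabs_pos_eq; unfold t; lra).
  assert (Hout : forall r, 0 < r -> ~ boundary Omega (gx m + r * wx, gy m + r * wy)).
  { intros r Hr Hb. apply Hboundary in Hb. destruct Hb as [s Hs]. specialize (HD s).
    assert (E : D s = (1 + r) ^ 2 * D m).
    { unfold D; unfold gx at 1; unfold gy at 1. rewrite <- Hs. unfold wx, wy; simpl. ring. }
    assert (0 < r * D m) by now apply Rmult_lt_0_compat. nra. }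
  assert (Hq : Omega (gx m + t * wx, gy m + t * wy)).
  { destruct (Hts (gx m + t * wx, gy m + t * wy)) as [H|H]; [| |exact H|exfalso]; simpl; fold (gx m) (gy m).
    - replace (_ + _ - _) with (t * wx) by ring. apply (mult_small _ _ S); [exact HtS|unfold S; lra].
    - replace (_ + _ - _) with (t * wy) by ring. apply (mult_small _ _ S); [exact HtS|unfold S; lra].
    - apply (Hout t); [unfold t; lra|exact H]. }
  destruct (ray_meets_boundary Omega _ _ wx wy Hbounded Hq (Rabs_sum_pos _ _ HDm)) as [r [Hr Hb]].
  apply (Hout (t + r)); [unfold t; lra|].
  now replace ((gx m + (t + r) * wx, gy m + (t + r) * wy) : plane) with
    ((gx m + t * wx + r * wx, gy m + t * wy + r * wy) : plane) by (f_equal; ring).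
Qed.

(** Both [two_sided] and its negation are open in the parameter, so connectedness of the line
    spreads the one good point to all. This is the part of the Jordan curve theorem that is used. *)
Lemma not_two_sided (s : R) : ~ two_sided s.
Proof.
  destruct exists_not_two_sided as [s1 Hs1].
  apply (interval_clopen (fun r => ~ two_sided r) s1 s); [| |exact Hs1].
  - intros r _. apply not_two_sided_open.
  - intros r _ H. apply NNPP in H. apply locally_locally in H. apply gamma_near in H.
    refine (filter_imp _ _ _ H). intros r' Hr' Hn. now apply Hn.
Qed.

(** One side of the collar lies in [Omega] and the other outside: both inside is excluded by
    [not_two_sided], both outside because [gamma s0] is a boundary point. [sg] names the inner side,
    and a vector steeper than the Lipschitz constant [kappa] enters at once the side to which it
    points. *)
Lemma transversal_sides (s0 kappa : R) :
  0 < kappa -> exists sg d, 0 < d /\ is_sign sg /\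
    forall s wx wy, Rabs (s - s0) < d ->
      (kappa * Rabs (wx * dx s0 + wy * dy s0) < sg * (wy * dx s0 - wx * dy s0) ->
        exists e, 0 < e /\ forall t, 0 < t < e -> Omega (gx s + t * wx, gy s + t * wy)) /\
      (kappa * Rabs (wx * dx s0 + wy * dy s0) < - sg * (wy * dx s0 - wx * dy s0) ->
        exists e, 0 < e /\ forall t, 0 < t < e -> ~ Omega (gx s + t * wx, gy s + t * wy)).
Proof.
  intros Hk. destruct (collar s0 kappa Hk) as [d [Hd [Hlip [Hav Hcov]]]].
  assert (Hside := side_connected s0 d Hav).
  assert (Habs := Rabs_self_lt s0 d Hd).
  assert (Hd2 : forall sg, is_sign sg -> Rabs (sg * (d / 2)) < d /\ Rabs (- sg * (d / 2)) < d).
  { intros sg [-> | ->]; split; apply Rabs_def1; lra. }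
  assert (H1d := is_sign_1). assert (H2d := is_sign_m1).
  assert (Hsg : exists sg, is_sign sg /\ forall s t, Rabs (s - s0) < d -> Rabs t < d ->
    (0 < sg * t -> Omega (shift s0 s t)) /\ (0 < - sg * t -> ~ Omega (shift s0 s t))).
  { assert (Hgen : forall sg, is_sign sg -> Omega (shift s0 s0 (sg * (d / 2))) ->
      ~ Omega (shift s0 s0 (- sg * (d / 2))) -> forall s t, Rabs (s - s0) < d -> Rabs t < d ->
      (0 < sg * t -> Omega (shift s0 s t)) /\ (0 < - sg * t -> ~ Omega (shift s0 s t))).
    { intros sg Hsg H1 H2 s t Hs Ht. destruct (Hd2 sg Hsg). split; intros Hp.
      - apply (Hside s0 s (sg * (d / 2)) t); auto. nra.
      - intros HO. apply H2. apply (Hside s s0 t (- sg * (d / 2))); auto. nra. }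
    destruct (classic (Omega (shift s0 s0 (1 * (d / 2))))) as [H1|H1];
      destruct (classic (Omega (shift s0 s0 (-1 * (d / 2))))) as [H2|H2].
    - exfalso. apply (not_two_sided s0). refine (filter_imp _ _ _ Hcov).
      intros q [s [t [Hs [Ht ->]]]]. destruct (Rtotal_order t 0) as [H|[->|H]].
      + left. apply (Hside s0 s (-1 * (d / 2)) t); auto; [now apply Hd2|nra].
      + right. rewrite shift_0. apply boundary_gamma.
      + left. apply (Hside s0 s (1 * (d / 2)) t); auto; [now apply Hd2|nra].
    - exists 1. split; [now left|]. apply Hgen; auto.
    - exists (-1). split; [now right|]. apply Hgen; auto.
      now replace (- -1 * (d / 2)) with (1 * (d / 2)) by ring.
    - exfalso. apply (proj2 (boundary_gamma s0)). refine (filter_imp _ _ _ Hcov).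
      intros q [s [t [Hs [Ht ->]]]] HO. destruct (Rtotal_order t 0) as [H|[->|H]].
      + apply H2. apply (Hside s s0 t (-1 * (d / 2))); auto; [now apply Hd2|nra].
      + revert HO. rewrite shift_0. apply not_Omega_gamma.
      + apply H1. apply (Hside s s0 t (1 * (d / 2))); auto; [now apply Hd2|nra]. }
  destruct Hsg as [sg [Hsg Hcol]].
  apply locally_locally in Hcov. apply gamma_near, locally_R in Hcov.
  destruct Hcov as [d1 [Hd1 Hcov]].
  exists sg, (Rmin d d1). split; [now apply Rmin_pos|]. split; [exact Hsg|].
  intros s wx wy Hs.
  assert (Hsd : Rabs (s - s0) < d) by Rmin_lra. specialize (Hcov s ltac:(Rmin_lra)).
  apply locally_plane in Hcov. destruct Hcov as [e0 [He0 Hcov]].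
  set (S := Rabs wx + Rabs wy + 1).
  assert (Hax := Rabs_pos wx). assert (Hay := Rabs_pos wy).
  assert (HS : 0 < e0 / S) by (apply Rdiv_lt_0_compat; unfold S; lra).
  assert (HL := speed_sqr_pos s0).
  (* In the chart, [t'] times the squared speed is [t] times the normal component of [w], up to the
     variation of [across], which [kappa] controls. *)
  assert (Hpt : forall t, 0 < t < e0 / S -> exists s' t', Rabs (s' - s0) < d /\ Rabs t' < d /\
    (gx s + t * wx, gy s + t * wy) = shift s0 s' t' /\
    Rabs (t' * (dx s0 ^ 2 + dy s0 ^ 2) - t * (wy * dx s0 - wx * dy s0)) <= t * (kappa * Rabs (wx * dx s0 + wy * dy s0))).
  { intros t Ht. assert (Hta : Rabs t < e0 / S) by (rewrite Rabs_pos_eq; lra).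
    destruct (Hcov (gx s + t * wx, gy s + t * wy)) as [s' [t' [Hs' [Ht' Heq]]]].
    - simpl. unfold gx. replace (_ + _ - _) with (t * wx) by ring. apply (mult_small _ _ S); [exact Hta|unfold S; lra].
    - simpl. unfold gy. replace (_ + _ - _) with (t * wy) by ring. apply (mult_small _ _ S); [exact Hta|unfold S; lra].
    - exists s', t'. repeat split; auto.
      unfold shift in Heq. injection Heq as Hx Hy.
      assert (Ha : along s0 s' - along s0 s = t * (wx * dx s0 + wy * dy s0)).
      { unfold along. transitivity ((gx s' - t' * dy s0 - gx s) * dx s0 + (gy s' + t' * dx s0 - gy s) * dy s0); [ring|].
        rewrite <- Hx, <- Hy. ring. }
      assert (Hb : t' * (dx s0 ^ 2 + dy s0 ^ 2) - t * (wy * dx s0 - wx * dy s0) = - (across s0 s' - across s0 s)).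
      { unfold across. transitivity (t' * (dx s0 ^ 2 + dy s0 ^ 2) - ((gy s + t * wy - gy s) * dx s0 - (gx s + t * wx - gx s) * dy s0)); [ring|].
        rewrite Hx, Hy. ring. }
      rewrite Hb, Rabs_Ropp.
      specialize (Hlip s' s Hs' Hsd). rewrite Ha, Rabs_mult, (Rabs_pos_eq t) in Hlip by lra. lra. }
  split; intros Hw; exists (e0 / S); (split; [exact HS|]); intros t Ht;
    destruct (Hpt t Ht) as [s' [t' [Hs' [Ht' [-> Hb]]]]]; apply (Hcol s' t' Hs' Ht');
    apply Rabs_le_between in Hb; destruct Hsg as [-> | ->]; nra.
Qed.

(** * The inward normal *)

Definition speed (s : R) : R := sqrt (dx s ^ 2 + dy s ^ 2).

Lemma speed_pos (s : R) : 0 < speed s.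
Proof. apply sqrt_lt_R0, speed_sqr_pos. Qed.

Lemma speed_sqr (s : R) : speed s * speed s = dx s ^ 2 + dy s ^ 2.
Proof. apply sqrt_sqrt. left. apply speed_sqr_pos. Qed.

Definition normal (c s : R) : plane := (- c * dy s / speed s, c * dx s / speed s).

Lemma normal_components (c s : R) :
  fst (normal c s) * dx s + snd (normal c s) * dy s = 0 /\
  snd (normal c s) * dx s - fst (normal c s) * dy s = c * speed s.
Proof.
  assert (Hsp := speed_pos s). unfold normal; simpl. split; [field; lra|].
  apply Rmult_eq_reg_r with (speed s); [|lra]. rewrite Rmult_assoc, speed_sqr. field. lra.
Qed.

(** The normal is defined by choice, so a vector with the required properties has to be exhibited;
    [transversal_sides] tells which of the two unit normals enters [Omega]. *)
Lemma inward_normal_spec (s : R) :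
  is_inward_normal Omega gamma s (inward_normal Omega gamma s).
Proof.
  unfold inward_normal. apply epsilon_spec.
  destruct (transversal_sides s 1 Rlt_0_1) as [sg [d [Hd [Hsg H]]]].
  assert (Hsp := speed_pos s). destruct (normal_components sg s) as [HT HN].
  exists (normal sg s). repeat split.
  - rewrite norm_plane. unfold normal; simpl fst; simpl snd.
    transitivity (sqrt (sg * sg * (dx s ^ 2 + dy s ^ 2) / (speed s * speed s))); [f_equal; field; lra|].
    rewrite speed_sqr. replace (_ / _) with 1; [apply sqrt_1|].
    assert (HL := speed_sqr_pos s). destruct Hsg as [-> | ->]; field; lra.
  - exact HT.
  - destruct (H s (fst (normal sg s)) (snd (normal sg s))) as [Hin _].
    + now apply Rabs_self_lt.
    + apply Hin. rewrite HT, HN, Rabs_R0. destruct Hsg as [-> | ->]; lra.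
Qed.

Lemma inward_normal_cases (s : R) :
  exists c, is_sign c /\ inward_normal Omega gamma s = normal c s.
Proof.
  destruct (inward_normal_spec s) as [Hn [Hd _]].
  destruct (inward_normal Omega gamma s) as [n1 n2]; simpl in *.
  rewrite norm_plane in Hn; simpl fst in Hn; simpl snd in Hn.
  change (n1 * dx s + n2 * dy s = 0) in Hd.
  assert (Hn2 : n1 ^ 2 + n2 ^ 2 = 1).
  { rewrite <- (sqrt_sqrt (n1 ^ 2 + n2 ^ 2)); [rewrite Hn; ring|].
    apply sqr_sum_nonneg. }
  assert (Hsp := speed_pos s).
  destruct (orthogonal_multiple n1 n2 (dx s) (dy s) (speed_sqr_pos s) Hd) as [E1 E2].
  rewrite <- speed_sqr in E1, E2.
  exists ((n2 * dx s - n1 * dy s) / speed s). set (c := (n2 * dx s - n1 * dy s) / speed s).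
  assert (En : (n1, n2) = normal c s).
  { unfold normal. f_equal; [rewrite E1 at 1|rewrite E2 at 1]; unfold c; field; lra. }
  split; [|exact En]. unfold normal in En. injection En as En1 En2.
  assert (Hcc : c * c = 1).
  { rewrite <- Hn2, En1, En2.
    transitivity (c * c * ((dx s ^ 2 + dy s ^ 2) / (speed s * speed s))); [|field; lra].
    rewrite speed_sqr. field. apply Rgt_not_eq, speed_sqr_pos. }
  assert (H : (c - 1) * (c + 1) = 0) by lra.
  apply Rmult_integral in H. destruct H; [left|right]; lra.
Qed.

(** The normal is chosen point by point, so the constancy of its sign near [s0] needs proof: the
    opposite unit normal at a nearby point is still steep in the frame at [s0], hence its ray leaves
    [Omega]. *)
Lemma inward_normal_transversal (s0 kappa : R) :
  0 < kappa -> exists sg d, 0 < d /\ is_sign sg /\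
    (forall s, Rabs (s - s0) < d -> inward_normal Omega gamma s = normal sg s) /\
    (forall wx wy, kappa * Rabs (wx * dx s0 + wy * dy s0) < - sg * (wy * dx s0 - wx * dy s0) ->
      exists e, 0 < e /\ forall t, 0 < t < e -> ~ Omega (gx s0 + t * wx, gy s0 + t * wy)).
Proof.
  (* The aperture 1/4 serves the normals at nearby points, whose tangential part in the frame at
     [s0] is small; [kappa] serves the last conclusion. *)
  intros Hk. destruct (transversal_sides s0 (Rmin (1 / 4) kappa)) as [sg [d [Hd [Hsg H]]]].
  { apply Rmin_pos; lra. }
  assert (HL := speed_sqr_pos s0). set (L := dx s0 ^ 2 + dy s0 ^ 2) in *.
  assert (HL4 : 0 < L / 4) by lra.
  destruct (continuous_eps _ _ _ (velocity_combination_continuous (dx s0) (dy s0) s0) HL4) as [d1 [Hd1 H1]].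
  destruct (continuous_eps _ _ _ (velocity_combination_continuous (- dy s0) (dx s0) s0) HL4) as [d2 [Hd2 H2]].
  exists sg, (Rmin d (Rmin d1 d2)). split; [now repeat apply Rmin_pos|]. split; [exact Hsg|]. split.
  - intros s Hs. specialize (H1 s ltac:(Rmin_lra)). specialize (H2 s ltac:(Rmin_lra)).
    assert (Hsp := speed_pos s).
    destruct (inward_normal_cases s) as [c [Hc Hn]].
    destruct (inward_normal_spec s) as [_ [_ [e' [He' Hin]]]].
    destruct (Req_dec c sg) as [Hcs|Hcs]; [now rewrite Hn, Hcs|exfalso].
    assert (Ec : c = - sg) by (destruct Hc as [-> | ->], Hsg as [-> | ->]; lra).
    rewrite Hn in Hin.
    destruct (proj2 (H s (fst (normal c s)) (snd (normal c s)) ltac:(Rmin_lra))) as [e2 [He2 Hout]].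
    + unfold normal; simpl fst; simpl snd.
      replace (- c * dy s / speed s * dx s0 + c * dx s / speed s * dy s0)
        with (sg * (dx s * - dy s0 + dy s * dx s0 - (dx s0 * - dy s0 + dy s0 * dx s0)) * / speed s)
        by (rewrite Ec; field; lra).
      replace (- sg * (c * dx s / speed s * dx s0 - - c * dy s / speed s * dy s0))
        with (sg * sg * (dx s * dx s0 + dy s * dy s0) * / speed s) by (rewrite Ec; field; lra).
      rewrite !Rabs_mult, (Rabs_pos_eq (/ speed s)) by (left; now apply Rinv_0_lt_compat).
      rewrite <- Rmult_assoc. apply Rmult_lt_compat_r; [now apply Rinv_0_lt_compat|].
      assert (Es : Rabs sg = 1 /\ sg * sg = 1).
      { destruct Hsg as [-> | ->]; split; try ring; [apply Rabs_R1|rewrite Rabs_left; lra]. }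
      destruct Es as [-> ->]. apply Rabs_def2 in H1. unfold L in *.
      assert (Hr := Rmin_l (1 / 4) kappa). assert (Hr0 := Rmin_pos (1 / 4) kappa ltac:(lra) Hk).
      generalize dependent (Rmin (1 / 4) kappa). intros k' _ Hr Hr0.
      assert (H0 := Rabs_pos (dx s * - dy s0 + dy s * dx s0 - (dx s0 * - dy s0 + dy s0 * dx s0))). nra.
    + assert (Hp := Rmin_pos e' e2 He' He2).
      apply (Hout (Rmin e' e2 / 2)); [Rmin_lra|]. apply Hin. Rmin_lra.
  - intros wx wy Hw. apply (H s0 wx wy); [now apply Rabs_self_lt|].
    eapply Rle_lt_trans; [|exact Hw]. apply Rmult_le_compat_r; [apply Rabs_pos|apply Rmin_r].
Qed.

Lemma inward_normal_sees (s wx wy : R) :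
  (exists e, 0 < e /\ forall t, 0 < t < e -> Omega (gx s + t * wx, gy s + t * wy)) ->
  wy * dx s - wx * dy s <> 0 ->
  0 < dot (inward_normal Omega gamma s) (wx, wy).
Proof.
  intros [e [He Hw]] Hne.
  assert (Hsp := speed_pos s).
  set (wN := wy * dx s - wx * dy s) in *. set (wT := wx * dx s + wy * dy s).
  assert (HwN : 0 < Rabs wN) by now apply Rabs_pos_lt.
  (* Small enough for [(wx, wy)] to count as steep; if it pointed outwards, its ray would then start
     outside [Omega]. *)
  set (kappa := Rabs wN / 2 / (Rabs wT + 1)).
  assert (HT := Rabs_pos wT).
  assert (Hk : 0 < kappa) by (apply Rdiv_lt_0_compat; lra).
  assert (HkT : kappa * Rabs wT < Rabs wN).
  { assert (kappa * (Rabs wT + 1) = Rabs wN / 2) by (unfold kappa; field; lra). lra. }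
  destruct (inward_normal_transversal s kappa Hk) as [sg [d [Hd [Hsg [Hn H]]]]].
  assert (Hw' : 0 < sg * wN).
  { apply Rnot_le_lt. intros Hle. destruct (H wx wy) as [e' [He' Hout]].
    - fold wT wN. eapply Rlt_le_trans; [exact HkT|].
      unfold Rabs; destruct (Rcase_abs wN); destruct Hsg as [-> | ->]; lra.
    - assert (Hp := Rmin_pos e e' He He').
      apply (Hout (Rmin e e' / 2)); [Rmin_lra|]. apply Hw. Rmin_lra. }
  rewrite Hn by now apply Rabs_self_lt. unfold dot, normal; simpl.
  replace (_ + _) with (sg * wN / speed s) by (unfold wN; field; lra).
  now apply Rdiv_lt_0_compat.
Qed.

(** * The two-centre problem *)

Variables c1 c2 : plane.
Hypothesis Hc : c1 <> c2.

(** [foc] is the half focal distance [d], [(ax, ay)] the unit vector [e] and [(mx, my)] the midpoint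
    of the centres. *)
Definition foc : R := distance c1 c2 / 2.
Definition ax : R := / (2 * foc) * (fst c2 - fst c1).
Definition ay : R := / (2 * foc) * (snd c2 - snd c1).
Definition mx : R := / 2 * (fst c1 + fst c2).
Definition my : R := / 2 * (snd c1 + snd c2).

Lemma distance_plane (x y : plane) :
  distance x y = sqrt ((fst x - fst y) ^ 2 + (snd x - snd y) ^ 2).
Proof. unfold distance. rewrite norm_plane. reflexivity. Qed.

Lemma foc_pos : 0 < foc.
Proof.
  unfold foc. rewrite distance_plane.
  assert (0 < sqrt ((fst c1 - fst c2) ^ 2 + (snd c1 - snd c2) ^ 2)); [|lra].
  apply sqrt_lt_R0, sqr_sum_pos. intros [E1 E2]. apply Hc. apply injective_projections; lra.
Qed.

Lemma axis_unit : ax ^ 2 + ay ^ 2 = 1.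
Proof.
  assert (Hf := foc_pos). unfold ax, ay.
  assert (E : (2 * foc) ^ 2 = (fst c1 - fst c2) ^ 2 + (snd c1 - snd c2) ^ 2).
  { unfold foc. replace (2 * (distance c1 c2 / 2)) with (distance c1 c2) by field.
    rewrite distance_plane. apply pow2_sqrt.
    apply sqr_sum_nonneg. }
  apply Rmult_eq_reg_r with ((2 * foc) ^ 2); [|nra].
  replace (_ * _) with ((fst c2 - fst c1) ^ 2 + (snd c2 - snd c1) ^ 2) by (field; lra). lra.
Qed.

Lemma centre1 : fst c1 = mx - foc * ax /\ snd c1 = my - foc * ay.
Proof. assert (Hf := foc_pos). unfold mx, my, ax, ay. split; field; lra. Qed.

Lemma centre2 : fst c2 = mx + foc * ax /\ snd c2 = my + foc * ay.
Proof. assert (Hf := foc_pos). unfold mx, my, ax, ay. split; field; lra. Qed.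

Definition to_plane (u w : R) : plane :=
  (mx + foc * (u * ax - w * ay), my + foc * (u * ay + w * ax)).

Lemma Phi_to_plane (x y : R) : Phi c1 c2 x y = to_plane (cosh x * cos y) (sinh x * sin y).
Proof.
  unfold Phi, to_plane, rot90. fold foc.
  apply injective_projections; simpl; unfold plus, scal, minus, plus, opp, mult; simpl;
    unfold mult, minus, plus, opp; simpl.
  - fold mx. unfold Rminus in *. fold (Rminus (fst c2) (fst c1)) (Rminus (snd c2) (snd c1)).
    fold ax ay. ring.
  - fold my. fold (Rminus (fst c2) (fst c1)) (Rminus (snd c2) (snd c1)). fold ax ay. ring.
Qed.

Definition ucoord (p : plane) : R := ((fst p - mx) * ax + (snd p - my) * ay) / foc.
Definition wcoord (p : plane) : R := ((fst p - mx) * - ay + (snd p - my) * ax) / foc.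

Lemma to_plane_coords (p : plane) : p = to_plane (ucoord p) (wcoord p).
Proof.
  assert (Hf := foc_pos). assert (Hu := axis_unit).
  unfold to_plane, ucoord, wcoord. apply injective_projections; simpl.
  - transitivity (mx + (fst p - mx) * (ax ^ 2 + ay ^ 2)); [rewrite Hu; ring|field; lra].
  - transitivity (my + (snd p - my) * (ax ^ 2 + ay ^ 2)); [rewrite Hu; ring|field; lra].
Qed.

Lemma coords_to_plane (u w : R) : ucoord (to_plane u w) = u /\ wcoord (to_plane u w) = w.
Proof.
  assert (Hf := foc_pos). assert (Hu := axis_unit).
  unfold to_plane, ucoord, wcoord; simpl fst; simpl snd. split.
  - transitivity (u * (ax ^ 2 + ay ^ 2)); [field; lra|rewrite Hu; ring].
  - transitivity (w * (ax ^ 2 + ay ^ 2)); [field; lra|rewrite Hu; ring].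
Qed.

Lemma Phi_surjective (p : plane) : exists x y, 0 <= x /\ p = Phi c1 c2 x y.
Proof.
  destruct (elliptic_surjective (ucoord p) (wcoord p)) as [x [y [Hx [Hu Hw]]]].
  exists x, y. split; [exact Hx|]. rewrite Phi_to_plane, <- Hu, <- Hw. apply to_plane_coords.
Qed.

Lemma Phi_coords (x y x' y' : R) : Phi c1 c2 x y = Phi c1 c2 x' y' ->
  cosh x * cos y = cosh x' * cos y' /\ sinh x * sin y = sinh x' * sin y'.
Proof.
  rewrite !Phi_to_plane. intros E. split.
  - rewrite <- (proj1 (coords_to_plane (cosh x * cos y) (sinh x * sin y))), E. apply coords_to_plane.
  - rewrite <- (proj2 (coords_to_plane (cosh x * cos y) (sinh x * sin y))), E. apply coords_to_plane.
Qed.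

Lemma Phi_deck (x y : R) : Phi c1 c2 (- x) (- y) = Phi c1 c2 x y.
Proof. rewrite !Phi_to_plane, cosh_even, sinh_odd, cos_neg, sin_neg. f_equal; ring. Qed.

Lemma distance_to_plane (u w u' w' : R) :
  distance (to_plane u w) (to_plane u' w') = foc * sqrt ((u - u') ^ 2 + (w - w') ^ 2).
Proof.
  assert (Hf := foc_pos). assert (Hu := axis_unit).
  rewrite distance_plane. unfold to_plane; simpl fst; simpl snd.
  replace (_ + _) with (foc ^ 2 * (((u - u') ^ 2 + (w - w') ^ 2) * (ax ^ 2 + ay ^ 2))) by ring.
  rewrite Hu, Rmult_1_r, sqrt_mult; [now rewrite sqrt_pow2 by lra|apply pow2_ge_0|].
  apply sqr_sum_nonneg.
Qed.

Lemma centres_to_plane : c1 = to_plane (-1) 0 /\ c2 = to_plane 1 0.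
Proof.
  destruct centre1 as [E1 E2]. destruct centre2 as [E3 E4].
  split; apply injective_projections; unfold to_plane; simpl; [rewrite E1|rewrite E2|rewrite E3|rewrite E4]; ring.
Qed.

Lemma distance_Phi (x y : R) :
  distance (Phi c1 c2 x y) c1 = foc * (cosh x + cos y) /\
  distance (Phi c1 c2 x y) c2 = foc * (cosh x - cos y).
Proof.
  destruct centres_to_plane as [E1 E2]. rewrite Phi_to_plane.
  rewrite E1, E2, !distance_to_plane.
  assert (Hch := cosh_ge_1 x). assert (Hcos := COS_bound y).
  assert (Hd : forall u, is_sign u -> sqrt ((cosh x * cos y - u) ^ 2 + (sinh x * sin y - 0) ^ 2) = cosh x - u * cos y).
  { intros u Hu. assert (Hu2 := sign_sqr u Hu).
    rewrite <- (sqrt_pow2 (cosh x - u * cos y)) by (destruct Hu as [-> | ->]; lra). f_equal.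
    transitivity (cosh x ^ 2 * cos y ^ 2 - 2 * cosh x * cos y * u + u * u + sinh x ^ 2 * sin y ^ 2); [ring|].
    transitivity (cosh x ^ 2 - 2 * cosh x * cos y * u + u * u * cos y ^ 2); [|ring].
    rewrite Hu2, cosh2_sinh2, cos2_sin2. ring. }
  rewrite (Hd _ is_sign_1), (Hd _ is_sign_m1). split; ring.
Qed.

Definition focal_sum (p : plane) : R := distance p c1 + distance p c2.

Lemma focal_sum_Phi (x y : R) : focal_sum (Phi c1 c2 x y) = 2 * foc * cosh x.
Proof. unfold focal_sum. destruct (distance_Phi x y) as [-> ->]. ring. Qed.

Lemma distance_convex (c p q : plane) (r : R) : 0 <= r <= 1 ->
  distance ((1 - r) * fst p + r * fst q, (1 - r) * snd p + r * snd q) c <=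
  (1 - r) * distance p c + r * distance q c.
Proof.
  intros Hr. unfold distance.
  replace (minus (((1 - r) * fst p + r * fst q, (1 - r) * snd p + r * snd q) : plane) c)
    with (plus (scal (1 - r) (minus p c)) (scal r (minus q c))).
  - eapply Rle_trans; [apply (norm_triangle (K := R_AbsRing) (V := prod_NormedModule R_AbsRing R_NormedModule R_NormedModule))|].
    apply Rplus_le_compat; (eapply Rle_trans; [apply (norm_scal (K := R_AbsRing) (V := prod_NormedModule R_AbsRing R_NormedModule R_NormedModule))|]); right; f_equal;
      unfold abs; simpl; apply Rabs_pos_eq; lra.
  - apply injective_projections; simpl; unfold plus, scal, minus, plus, opp, mult; simpl;
      unfold mult, opp, plus; simpl; ring.
Qed.

Definition ray (p : plane) (r : R) : plane := ((1 - r) * mx + r * fst p, (1 - r) * my + r * snd p).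

Lemma ray_0 (p : plane) : ray p 0 = to_plane 0 0.
Proof. unfold ray, to_plane. f_equal; ring. Qed.

Lemma ray_1 (p : plane) : ray p 1 = p.
Proof. apply injective_projections; simpl; ring. Qed.

Lemma ray_ray (p : plane) (r r' : R) : ray (ray p r) r' = ray p (r' * r).
Proof. unfold ray; simpl. f_equal; ring. Qed.

(** Convexity of the distance, with the value [2 * foc] at the midpoint. It makes the confocal
    ellipses star-shaped about the midpoint. *)
Lemma focal_sum_ray (p : plane) (r : R) : 0 <= r <= 1 ->
  focal_sum (ray p r) <= (1 - r) * (2 * foc) + r * focal_sum p.
Proof.
  intros Hr. assert (H1 := distance_convex c1 (mx, my) p r Hr). assert (H2 := distance_convex c2 (mx, my) p r Hr).
  assert (E : focal_sum (mx, my) = 2 * foc).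
  { replace ((mx, my) : plane) with (Phi c1 c2 0 (PI / 2)).
    - rewrite focal_sum_Phi, cosh_0. ring.
    - rewrite Phi_to_plane, cos_PI2, sinh_0. unfold to_plane. f_equal; ring. }
  unfold focal_sum in *. unfold ray. simpl fst in *. simpl snd in *.
  replace (2 * foc) with (distance (mx, my) c1 + distance (mx, my) c2) by exact E. lra.
Qed.

(* The pushforward by [Phi] of the vector [(p, q)] at [(x, y)]. *)
Definition push (x y p q : R) : plane :=
  (foc * ((sinh x * cos y * ax - cosh x * sin y * ay) * p + (- cosh x * sin y * ax - sinh x * cos y * ay) * q),
   foc * ((sinh x * cos y * ay + cosh x * sin y * ax) * p + (- cosh x * sin y * ay + sinh x * cos y * ax) * q)).

Lemma is_derive_Phi (xi eta : R -> R) (t p q : R) :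
  is_derive xi t p -> is_derive eta t q ->
  is_derive (fun s => fst (Phi c1 c2 (xi s) (eta s))) t (fst (push (xi t) (eta t) p q)) /\
  is_derive (fun s => snd (Phi c1 c2 (xi s) (eta s))) t (snd (push (xi t) (eta t) p q)).
Proof.
  intros Hx He.
  assert (E1 := is_derive_unique (fun s : R => xi s) t p Hx). assert (E2 := is_derive_unique (fun s : R => eta s) t q He).
  split; [apply is_derive_ext with (fun s => fst (to_plane (cosh (xi s) * cos (eta s)) (sinh (xi s) * sin (eta s))))
         |apply is_derive_ext with (fun s => snd (to_plane (cosh (xi s) * cos (eta s)) (sinh (xi s) * sin (eta s))))];
    try (intros s; now rewrite Phi_to_plane); unfold to_plane, push; simpl;
    (auto_derive; [repeat split; auto; eexists; eassumption|rewrite E1, E2; ring]).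
Qed.

(** [foc ^ 2 * jac] is at once the squared conformal factor of [Phi] and the product of the
    distances to the centres, that is, the time change. *)
Definition jac (x y : R) : R := cosh x ^ 2 - cos y ^ 2.

Lemma jac_sum (x y : R) : jac x y = (sinh x * cos y) ^ 2 + (cosh x * sin y) ^ 2.
Proof.
  unfold jac. rewrite !Rpow_mult_distr, cosh2_sinh2, cos2_sin2. ring.
Qed.

Lemma jac_pos (x y : R) : 0 < x -> 0 < jac x y.
Proof.
  intros Hx. assert (H := sinh_pos x Hx). unfold jac. rewrite cosh2_sinh2, cos2_sin2.
  assert (H1 := pow2_ge_0 (sin y)). assert (0 < sinh x ^ 2) by now apply pow_lt. lra.
Qed.

Lemma physical_velocity_Phi (xi eta : R -> R) (t p q : R) :
  is_derive xi t p -> is_derive eta t q ->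
  physical_velocity c1 c2 (fun s => Phi c1 c2 (xi s) (eta s)) t =
  scal (/ (foc ^ 2 * jac (xi t) (eta t))) (push (xi t) (eta t) p q).
Proof.
  intros Hx He. unfold physical_velocity, velocity.
  destruct (is_derive_Phi xi eta t p q Hx He) as [H1 H2].
  apply is_derive_unique in H1, H2.
  transitivity (scal (/ (distance (Phi c1 c2 (xi t) (eta t)) c1 * distance (Phi c1 c2 (xi t) (eta t)) c2))
    (push (xi t) (eta t) p q)).
  { f_equal. apply injective_projections; assumption. }
  destruct (distance_Phi (xi t) (eta t)) as [-> ->]. do 2 f_equal. unfold jac. ring.
Qed.

Lemma push_deck (x y p q : R) : push (- x) (- y) p q = push x y (- p) (- q).
Proof.
  unfold push. rewrite cosh_even, sinh_odd, cos_neg, sin_neg. apply injective_projections; simpl; ring.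
Qed.

Lemma sin_cos_periodZ (y : R) (k : Z) :
  sin (y + 2 * IZR k * PI) = sin y /\ cos (y + 2 * IZR k * PI) = cos y.
Proof.
  assert (Hn : forall (n : nat) z, sin (z + 2 * INR n * PI) = sin z /\ cos (z + 2 * INR n * PI) = cos z)
    by (intros; split; [apply sin_period|apply cos_period]).
  destruct (Z_le_gt_dec 0 k) as [Hk|Hk].
  - rewrite <- (Z2Nat.id k Hk), <- INR_IZR_INZ. apply Hn.
  - destruct (Hn (Z.to_nat (- k)) (y + 2 * IZR k * PI)) as [<- <-].
    rewrite INR_IZR_INZ, Z2Nat.id, opp_IZR by lia.
    now replace (y + 2 * IZR k * PI + 2 * - IZR k * PI) with y by ring.
Qed.

Lemma shifted_deck (x y sg : R) (n : nat) : is_sign sg ->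
  cos (- y + sg * (2 * INR n * PI)) = cos y /\
  Phi c1 c2 (- x) (- y + sg * (2 * INR n * PI)) = Phi c1 c2 x y /\
  forall p q, push (- x) (- y + sg * (2 * INR n * PI)) p q = push x y (- p) (- q).
Proof.
  intros Hsg.
  assert (E : exists k, sg * (2 * INR n * PI) = 2 * IZR k * PI).
  { destruct Hsg as [-> | ->].
    - exists (Z.of_nat n). rewrite <- INR_IZR_INZ. ring.
    - exists (- Z.of_nat n)%Z. rewrite opp_IZR, <- INR_IZR_INZ. ring. }
  destruct E as [k ->]. destruct (sin_cos_periodZ (- y) k) as [Es Ec].
  split; [now rewrite Ec, cos_neg|split].
  - rewrite <- (Phi_deck x y), !Phi_to_plane. now rewrite Es, Ec.
  - intros p q. rewrite <- push_deck. unfold push. now rewrite Es, Ec.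
Qed.

(** * The separated Hamiltonian flow *)

Variables m1 m2 h : R.
Hypothesis Hm : m1 >= m2.
Hypothesis Hm2 : m2 > 0.
Hypothesis Hh : h >= 0.

(* On [K = 0] the energies separate as [p_xi ^ 2 / 2 = wpot xi + eps] and
   [p_eta ^ 2 / 2 = vpot eta - eps]. *)
Definition wpot (x : R) : R := foc * (m1 + m2) * (cosh x - 1) + h * foc ^ 2 * (cosh x ^ 2 - 1).
Definition vpot (y : R) : R :=
  foc * (m1 + m2) + h * foc ^ 2 - foc * (m1 - m2) * cos y - h * foc ^ 2 * cos y ^ 2.

Lemma wpot_continuous (x : R) : continuous wpot x.
Proof. apply continuous_of_derive. unfold wpot. auto_derive. exact I. Qed.

Lemma vpot_continuous (y : R) : continuous vpot y.
Proof. apply continuous_of_derive. unfold vpot. auto_derive. exact I. Qed.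

Lemma wpot_nonneg (x : R) : 0 <= wpot x.
Proof.
  unfold wpot. assert (Hf := foc_pos). assert (Hch := cosh_ge_1 x).
  assert (0 <= foc * (m1 + m2)) by nra. assert (0 <= h * foc ^ 2) by nra.
  assert (0 <= cosh x ^ 2 - 1) by nra. nra.
Qed.

Lemma wpot_even (x : R) : wpot (- x) = wpot x.
Proof. unfold wpot. now rewrite cosh_even. Qed.

Lemma vpot_even (y : R) : vpot (- y) = vpot y.
Proof. unfold vpot. now rewrite cos_neg. Qed.

Lemma wpot_increasing (x y : R) : 0 <= x < y -> wpot x < wpot y.
Proof.
  intros Hxy. assert (H := cosh_increasing x y Hxy). assert (Hx := cosh_ge_1 x).
  unfold wpot. assert (Hf := foc_pos).
  assert (0 < foc * (m1 + m2)) by nra. assert (0 <= h * foc ^ 2) by nra.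
  assert (cosh x ^ 2 <= cosh y ^ 2) by nra. nra.
Qed.

Lemma wpot_pos (x : R) : 0 < x -> 0 < wpot x.
Proof.
  intros Hx. assert (H := wpot_increasing 0 x ltac:(lra)). assert (H0 := wpot_nonneg 0). lra.
Qed.

(** Both [cosh x - 1] and [cosh x ^ 2 - 1] are at most [sinh x ^ 2], and [sinh x <= cosh b * x] on
    [[0, b]]. This quadratic contact at 0 is the reason why the travel time diverges. *)
Lemma wpot_quadratic (b : R) : 0 < b ->
  exists C, 0 <= C /\ forall x, 0 <= x <= b -> wpot x <= C * x ^ 2.
Proof.
  intros Hb. assert (Hf := foc_pos).
  assert (Hp1 : 0 <= foc * (m1 + m2)) by nra. assert (Hp2 : 0 <= h * foc ^ 2) by nra.
  exists ((foc * (m1 + m2) + h * foc ^ 2) * cosh b ^ 2).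
  split; [apply Rmult_le_pos; [lra|apply pow2_ge_0]|]. intros x Hx.
  assert (Hs : 0 <= sinh x <= cosh b * x).
  { destruct (Req_dec x 0) as [->|Hx0]; [rewrite sinh_0; lra|].
    destruct (MVT_cor2 sinh cosh 0 x) as [c [Hc1 Hc2]]; [lra|intros; apply derivable_pt_lim_sinh|].
    rewrite sinh_0, !Rminus_0_r in Hc1.
    assert (cosh c < cosh b) by (apply cosh_increasing; lra). assert (H0 := cosh_pos c). nra. }
  assert (Hs2 : sinh x ^ 2 <= cosh b ^ 2 * x ^ 2).
  { rewrite <- Rpow_mult_distr. apply pow_incr. lra. }
  assert (Hch := cosh_ge_1 x). assert (H2 := cosh2_sinh2 x).
  unfold wpot. assert (cosh x - 1 <= sinh x ^ 2) by nra. nra.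
Qed.

(** The value of [vpot] at 0, its minimum because [h >= 0] and [m1 >= m2]. By contrast [vmax] is
    just a convenient upper bound. *)
Definition vmin : R := 2 * foc * m2.
Definition vmax : R := 2 * foc * (m1 + m2) + h * foc ^ 2.

Lemma vmin_pos : 0 < vmin.
Proof. unfold vmin. assert (Hf := foc_pos). nra. Qed.

Lemma vpot_bounds (y : R) : vmin <= vpot y <= vmax.
Proof.
  unfold vmin, vmax, vpot. assert (Hf := foc_pos). assert (Hcos := COS_bound y).
  assert (H0 := pow2_ge_0 (cos y)). assert (H1 : cos y ^ 2 <= 1) by nra.
  assert (Hp2 : 0 <= h * foc ^ 2) by nra. assert (0 <= foc * (m1 - m2)) by nra.
  assert (0 <= foc * m2) by nra. assert (0 <= foc * m1) by nra. split; nra.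
Qed.

Definition pxi (eps x : R) : R := sqrt (2 * (wpot x + eps)).
Definition peta (eps y : R) : R := sqrt (2 * (vpot y - eps)).

Lemma pxi_sqr (eps x : R) : 0 <= eps -> pxi eps x ^ 2 = 2 * (wpot x + eps).
Proof. intros He. apply pow2_sqrt. assert (H := wpot_nonneg x). lra. Qed.

Lemma peta_sqr (eps y : R) : eps <= vmin -> peta eps y ^ 2 = 2 * (vpot y - eps).
Proof. intros He. apply pow2_sqrt. assert (H := vpot_bounds y). lra. Qed.

Lemma pxi_pos (eps x : R) : 0 < eps -> 0 < pxi eps x.
Proof. intros He. apply sqrt_lt_R0. assert (H := wpot_nonneg x). lra. Qed.

Lemma peta_pos (eps y : R) : eps < vmin -> 0 < peta eps y.
Proof. intros He. apply sqrt_lt_R0. assert (H := vpot_bounds y). lra. Qed.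

Lemma pxi_derive (eps x : R) : 0 < eps ->
  is_derive (pxi eps) x ((foc * (m1 + m2) * sinh x + h * foc ^ 2 * (2 * cosh x * sinh x)) / pxi eps x).
Proof.
  intros He. assert (Hp := pxi_pos eps x He). assert (Hw := wpot_nonneg x).
  unfold pxi, wpot in *. auto_derive; [simpl in Hw; lra|]. unfold Rminus in *; simpl in *. field. lra.
Qed.

Lemma peta_derive (eps y : R) : eps < vmin ->
  is_derive (peta eps) y ((foc * (m1 - m2) * sin y + h * foc ^ 2 * (2 * cos y * sin y)) / peta eps y).
Proof.
  intros He. assert (Hp := peta_pos eps y He). assert (Hw := vpot_bounds y).
  unfold peta, vpot in *. auto_derive; [simpl in Hw; lra|]. unfold Rminus in *; simpl in *. field. lra.
Qed.

Lemma pxi_even (eps x : R) : pxi eps (- x) = pxi eps x.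
Proof. unfold pxi. now rewrite wpot_even. Qed.

Lemma peta_even (eps y : R) : peta eps (- y) = peta eps y.
Proof. unfold peta. now rewrite vpot_even. Qed.

(** The branch of the flow on which [xi] decreases and [eta] moves in the direction [sg]. For
    [0 < eps < vmin] neither speed vanishes, so this branch is never left. *)
Definition separated (eps sg a b : R) (xi eta : R -> R) : Prop :=
  forall t, a < t < b -> is_derive xi t (- pxi eps (xi t)) /\ is_derive eta t (sg * peta eps (eta t)).

(** The momenta are functions of the positions, so the chain rule turns the two first-order
    equations into Hamilton's equations for the momenta; the speeds cancel because [pxi] and [peta]
    are square roots of the separated energies. *)
Lemma separated_orbit (eps a b sg : R) (xi eta : R -> R) :
  0 < eps -> eps < vmin -> is_sign sg ->
  separated eps sg a b xi eta ->
  zero_level_orbit c1 c2 m1 m2 h a b xi eta (fun t => - pxi eps (xi t)) (fun t => sg * peta eps (eta t)).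
Proof.
  intros He Hev Hsg HD t Ht. destruct (HD t Ht) as [Hx Hy].
  assert (Hp := pxi_pos eps (xi t) He). assert (Hq := peta_pos eps (eta t) Hev).
  assert (Hp2 := pxi_sqr eps (xi t) ltac:(lra)). assert (Hq2 := peta_sqr eps (eta t) ltac:(lra)).
  assert (Hsg2 := sign_sqr _ Hsg).
  unfold Ham. fold foc.
  split; [|split; [|split; [|split]]].
  - replace ((- pxi eps (xi t)) ^ 2) with (pxi eps (xi t) ^ 2) by ring.
    replace ((sg * peta eps (eta t)) ^ 2) with (sg * sg * peta eps (eta t) ^ 2) by ring.
    rewrite Hsg2, Hp2, Hq2. unfold wpot, vpot. field.
  - evar_last; [exact Hx|]. symmetry. apply is_derive_unique. auto_derive; [exact I|field].
  - evar_last; [exact Hy|]. symmetry. apply is_derive_unique. auto_derive; [exact I|field].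
  - evar_last.
    + apply (is_derive_comp (fun z => - pxi eps z) xi); [|exact Hx].
      apply (is_derive_opp (K := R_AbsRing) (V := R_NormedModule)), pxi_derive, He.
    + transitivity (foc * (m1 + m2) * sinh (xi t) + h * foc ^ 2 * (2 * cosh (xi t) * sinh (xi t))).
      * unfold scal, opp; simpl; unfold mult; simpl. field. lra.
      * match goal with |- _ = - Derive ?f ?z =>
          replace (Derive f z) with (- (foc * (m1 + m2) * sinh z + h * foc ^ 2 * (2 * cosh z * sinh z))) end.
        { ring. }
        symmetry. apply is_derive_unique. auto_derive; [exact I|]. field.
  - evar_last.
    + apply (is_derive_comp (fun z => sg * peta eps z) eta); [|exact Hy].
      apply (is_derive_scal (peta eps) (eta t) sg), peta_derive, Hev.
    + transitivity (foc * (m1 - m2) * sin (eta t) + h * foc ^ 2 * (2 * cos (eta t) * sin (eta t))).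
      * unfold scal; simpl; unfold mult; simpl.
        transitivity (sg * sg * (foc * (m1 - m2) * sin (eta t) + h * foc ^ 2 * (2 * cos (eta t) * sin (eta t))));
          [simpl; field; lra|rewrite Hsg2; ring].
      * match goal with |- _ = - Derive ?f ?z =>
          replace (Derive f z) with (- (foc * (m1 - m2) * sin z + h * foc ^ 2 * (2 * cos z * sin z))) end.
        { ring. }
        symmetry. apply is_derive_unique. auto_derive; [exact I|]. field.
Qed.

(** The increasing quantities [- xi] and [sg * eta] solve autonomous equations, since [pxi] and
    [peta] are even. Equality of the two travel times makes them reach [x1] and [L] at the same
    instant [T]. *)
Lemma orbit_exists (sg eps x0 x1 y0 L : R) :
  is_sign sg -> 0 < eps -> eps < vmin -> 0 < x0 -> 0 < x1 -> sg * y0 < L ->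
  RInt (fun x => / pxi eps x) (- x0) x1 = RInt (fun y => / peta eps y) (sg * y0) L ->
  exists (T a b : R) (xi eta : R -> R), 0 < T /\ a < 0 /\ T < b /\
    separated eps sg a b xi eta /\
    xi 0 = x0 /\ xi T = - x1 /\ eta 0 = y0 /\ eta T = sg * L.
Proof.
  intros Hsg He Hev Hx0 Hx1 HL Htime.
  assert (Hsg2 := sign_sqr _ Hsg).
  destruct (autonomous_ode (pxi eps) (- x0)) as [g1 [T1 [HT1 [Hg1 [Hi1 Hd1]]]]].
  { intros x. apply continuous_of_derive. eexists. now apply pxi_derive. }
  { intros x. now apply pxi_pos. }
  destruct (autonomous_ode (peta eps) (sg * y0)) as [g2 [T2 [HT2 [Hg2 [Hi2 Hd2]]]]].
  { intros x. apply continuous_of_derive. eexists. now apply peta_derive. }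
  { intros x. now apply peta_pos. }
  assert (E1 : T1 (- x0) = 0) by (rewrite HT1; apply (RInt_point (V := R_CompleteNormedModule))).
  assert (E2 : T2 (sg * y0) = 0) by (rewrite HT2; apply (RInt_point (V := R_CompleteNormedModule))).
  assert (ET : T1 x1 = T2 L) by now rewrite HT1, HT2.
  assert (Ha1 := Hi1 (- x0 - 1) (- x0) ltac:(lra)). assert (Hb1 := Hi1 x1 (x1 + 1) ltac:(lra)).
  assert (Ha2 := Hi2 (sg * y0 - 1) (sg * y0) ltac:(lra)). assert (Hb2 := Hi2 L (L + 1) ltac:(lra)).
  assert (HT := Hi1 (- x0) x1 ltac:(lra)).
  exists (T1 x1), (Rmax (T1 (- x0 - 1)) (T2 (sg * y0 - 1))), (Rmin (T1 (x1 + 1)) (T2 (L + 1))),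
    (fun t => - g1 t), (fun t => sg * g2 t).
  split; [lra|]. split; [apply Rmax_lub_lt; lra|]. split; [apply Rmin_glb_lt; lra|].
  split; [|split; [|split; [|split]]].
  - intros t [Hta Htb].
    assert (Hta1 := Rmax_l (T1 (- x0 - 1)) (T2 (sg * y0 - 1))). assert (Hta2 := Rmax_r (T1 (- x0 - 1)) (T2 (sg * y0 - 1))).
    assert (Hder1 : is_derive g1 t (pxi eps (g1 t))) by (apply (Hd1 (- x0 - 1) (x1 + 1)); [lra|split; Rmin_lra]).
    assert (Hder2 : is_derive g2 t (peta eps (g2 t))) by (apply (Hd2 (sg * y0 - 1) (L + 1)); [lra|split; Rmin_lra]).
    split.
    + rewrite pxi_even. now apply (is_derive_opp (K := R_AbsRing) (V := R_NormedModule)).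
    + replace (peta eps (sg * g2 t)) with (peta eps (g2 t)).
      * now apply (is_derive_scal g2 t sg).
      * destruct Hsg as [-> | ->]; [now rewrite Rmult_1_l|].
        replace (-1 * g2 t) with (- g2 t) by ring. now rewrite peta_even.
  - rewrite <- E1, Hg1. ring.
  - now rewrite Hg1.
  - rewrite <- E2, Hg2, <- Rmult_assoc, Hsg2. ring.
  - now rewrite ET, Hg2.
Qed.

Lemma push_sqr (x y p q : R) :
  fst (push x y p q) ^ 2 + snd (push x y p q) ^ 2 = foc ^ 2 * jac x y * (p ^ 2 + q ^ 2).
Proof.
  rewrite jac_sum. unfold push; simpl fst; simpl snd.
  transitivity (foc ^ 2 * ((sinh x * cos y) ^ 2 + (cosh x * sin y) ^ 2) * (p ^ 2 + q ^ 2) * (ax ^ 2 + ay ^ 2));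
    [ring|rewrite axis_unit; ring].
Qed.

Lemma kinetic_Phi (x y : R) : 0 < x ->
  2 * (h + potential c1 c2 m1 m2 (Phi c1 c2 x y)) = 2 * (wpot x + vpot y) / (foc ^ 2 * jac x y).
Proof.
  intros Hx. assert (Hf := foc_pos). assert (Hj := jac_pos x y Hx).
  assert (H1 := cosh_increasing 0 x ltac:(lra)). rewrite cosh_0 in H1. assert (H2 := COS_bound y).
  unfold potential. destruct (distance_Phi x y) as [-> ->].
  replace (jac x y) with ((cosh x + cos y) * (cosh x - cos y)) by (unfold jac; ring).
  unfold wpot, vpot. field. lra.
Qed.

Local Notation nu := (inward_normal Omega gamma).
Local Notation kin s := (2 * (h + potential c1 c2 m1 m2 (gamma s))).
Local Notation phase_vel := (phase_velocity c1 c2 m1 m2 h Omega gamma).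

(** [Phi] is conformal, so the angle to the normal can be computed in the [(xi, eta)] plane. There
    [atan (peta / pxi)] is the inclination of the orbit to the [xi] direction and [atan (x' / y')]
    that of the boundary to the ellipse [xi = x]. *)
Lemma phase_velocity_push (s x y x' y' sg sigma eps : R) :
  gamma s = Phi c1 c2 x y -> 0 < x ->
  dx s = fst (push x y x' y') -> dy s = snd (push x y x' y') ->
  nu s = normal sg s ->
  is_sign sg -> is_sign sigma -> 0 < sg * y' -> 0 < eps -> eps < vmin ->
  phase_vel s
    (sg * (sigma * atan (peta eps y / pxi eps x) - atan (x' / y'))) =
  scal (/ (foc ^ 2 * jac x y)) (push x y (- pxi eps x) (sigma * peta eps y)).
Proof.
  intros Hg Hx Hdx Hdy Hn Hsg Hsi Hy' He Hev.
  assert (Hf := foc_pos). assert (Hj := jac_pos x y Hx).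
  assert (HP := pxi_pos eps x He). assert (HQ := peta_pos eps y Hev).
  assert (HP2 := pxi_sqr eps x ltac:(lra)). assert (HQ2 := peta_sqr eps y ltac:(lra)).
  set (P := pxi eps x) in *. set (Q := peta eps y) in *.
  assert (Hsg2 := sign_sqr _ Hsg).
  assert (Hsi2 := sign_sqr _ Hsi).
  set (Rn := sqrt (P ^ 2 + Q ^ 2)). set (r := sqrt (x' ^ 2 + y' ^ 2)).
  assert (HRn : 0 < Rn) by (apply sqrt_lt_R0; nra).
  assert (Hy'0 : y' <> 0) by (intros ->; lra).
  assert (Hr : 0 < r) by (apply sqrt_lt_R0; assert (0 < y' ^ 2) by (now apply pow2_gt_0); assert (H0 := pow2_ge_0 x'); lra).
  assert (Hr2 : r ^ 2 = x' ^ 2 + y' ^ 2).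
  { apply pow2_sqrt. apply sqr_sum_nonneg. }
  set (sj := sqrt (jac x y)). assert (Hsj : 0 < sj) by now apply sqrt_lt_R0.
  assert (Hsj2 : sj ^ 2 = jac x y) by (apply pow2_sqrt; lra).
  assert (Hspeed : speed s = foc * sj * r).
  { unfold speed. rewrite Hdx, Hdy, push_sqr, <- Hsj2, <- Hr2.
    replace (foc ^ 2 * sj ^ 2 * r ^ 2) with ((foc * sj * r) ^ 2) by ring.
    apply sqrt_pow2. apply Rmult_le_pos; [apply Rmult_le_pos|]; lra. }
  destruct (cos_sin_atan_div P Q HP) as [Hc1 Hs1]. fold Rn in Hc1, Hs1.
  destruct (cos_sin_atan_div (sg * y') (sg * x') Hy') as [Hc2 Hs2].
  replace (sg * x' / (sg * y')) with (x' / y') in Hc2, Hs2.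
  2:{ field. split; [exact Hy'0|]. intros ->. lra. }
  replace ((sg * y') ^ 2 + (sg * x') ^ 2) with (x' ^ 2 + y' ^ 2) in Hc2, Hs2.
  2:{ replace ((sg * y') ^ 2 + (sg * x') ^ 2) with (sg * sg * (x' ^ 2 + y' ^ 2)) by ring. rewrite Hsg2. ring. }
  fold r in Hc2, Hs2.
  set (phi := atan (Q / P)) in *. set (psi := atan (x' / y')) in *.
  destruct (cos_sin_sign sigma phi Hsi) as [Hcphi Hsphi].
  destruct (cos_sin_sign sg (sigma * phi - psi) Hsg) as [Hca Hsa].
  rewrite cos_minus, Hcphi, Hsphi, Hc1, Hs1, Hc2, Hs2 in Hca.
  rewrite sin_minus, Hcphi, Hsphi, Hc1, Hs1, Hc2, Hs2 in Hsa.
  replace (P / Rn * (sg * y' / r) + sigma * (Q / Rn) * (sg * x' / r))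
    with (sg * (P * y' + sigma * Q * x') / (Rn * r)) in Hca by (field; lra).
  replace (sg * (sigma * (Q / Rn) * (sg * y' / r) - P / Rn * (sg * x' / r)))
    with (sg * sg * (sigma * Q * y' - P * x') / (Rn * r)) in Hsa by (field; lra).
  rewrite Hsg2, Rmult_1_l in Hsa.
  assert (Hkin : sqrt (kin s) = Rn / (foc * sj)).
  { rewrite Hg, kinetic_Phi by exact Hx.
    replace (2 * (wpot x + vpot y)) with (P ^ 2 + Q ^ 2) by (rewrite HP2, HQ2; ring).
    rewrite <- Hsj2. replace (foc ^ 2 * sj ^ 2) with ((foc * sj) ^ 2) by ring.
    rewrite sqrt_div_alt by (apply pow_lt; now apply Rmult_lt_0_compat).
    rewrite sqrt_pow2; [reflexivity|]. apply Rmult_le_pos; lra. }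
  assert (Hvel : norm (velocity gamma s) = speed s) by (rewrite norm_plane; reflexivity).
  unfold phase_velocity, tangent. rewrite Hkin, Hca, Hsa, Hn, Hvel. unfold normal.
  change (velocity gamma s) with (dx s, dy s). rewrite Hspeed, Hdx, Hdy.
  (* One identity for both components: [(D, E)] is the tangent vector for the first, and that vector
     turned by a right angle for the second. *)
  assert (Hfin : forall D E Z,
    sg * sg * (- (P * y' + sigma * Q * x') * E + (sigma * Q * y' - P * x') * D) = r ^ 2 * Z ->
    Rn / (foc * sj) * (sg * (P * y' + sigma * Q * x') / (Rn * r) * (- sg * E / (foc * sj * r)) +
      (sigma * Q * y' - P * x') / (Rn * r) * (/ (foc * sj * r) * D)) =
    / (foc ^ 2 * jac x y) * Z).
  { intros D E Z HZ. rewrite <- Hsj2.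
    transitivity (/ (foc ^ 2 * sj ^ 2 * r ^ 2) * (- (sg * sg) * (P * y' + sigma * Q * x') * E + (sigma * Q * y' - P * x') * D)).
    - field. lra.
    - rewrite Hsg2 in *. replace (- (1) * (P * y' + sigma * Q * x') * E + (sigma * Q * y' - P * x') * D)
        with (r ^ 2 * Z) by (rewrite <- HZ; ring). field. lra. }
  apply injective_projections; simpl.
  - apply (Hfin (fst (push x y x' y')) (snd (push x y x' y'))). rewrite Hsg2, Hr2. unfold push; simpl fst; simpl snd. ring.
  - replace (snd (push x y x' y')) with (- - snd (push x y x' y')) at 1 by ring.
    transitivity (Rn / (foc * sj) * (sg * (P * y' + sigma * Q * x') / (Rn * r) * (- sg * (- fst (push x y x' y')) / (foc * sj * r)) +
      (sigma * Q * y' - P * x') / (Rn * r) * (/ (foc * sj * r) * snd (push x y x' y')))).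
    + unfold scal, plus, mult; simpl. unfold mult; simpl. unfold Rdiv. ring.
    + apply Hfin. rewrite Hsg2, Hr2. unfold push; simpl fst; simpl snd. ring.
Qed.

(** * Boundary points, the angle coordinate and reflection *)

Hypothesis Hseg : contains_segment Omega c1 c2.

Lemma segment_in_Omega (u : R) : -1 <= u <= 1 -> Omega (to_plane u 0).
Proof.
  intros Hu. assert (H := Hseg ((1 + u) / 2) ltac:(lra)).
  destruct centre1 as [E1 E2]. destruct centre2 as [E3 E4].
  replace (to_plane u 0) with (plus (scal (1 - (1 + u) / 2) c1) (scal ((1 + u) / 2) c2)); [exact H|].
  apply injective_projections; unfold to_plane; simpl; unfold plus, scal, mult; simpl; unfold mult; simpl;
    [rewrite E1, E3|rewrite E2, E4]; field.
Qed.

(** The locus [xi = 0] is the segment between the centres, which lies in the open set [Omega]. *)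
Lemma boundary_Phi_pos (s x y : R) : 0 <= x -> gamma s = Phi c1 c2 x y -> 0 < x.
Proof.
  intros Hx Hg. destruct Hx as [Hx|<-]; [exact Hx|exfalso].
  apply (not_Omega_gamma s). rewrite Hg, Phi_to_plane.
  rewrite cosh_0, sinh_0, Rmult_1_l, Rmult_0_l. apply segment_in_Omega, COS_bound.
Qed.

Lemma gamma_elliptic (s : R) : exists x y, 0 < x /\ gamma s = Phi c1 c2 x y.
Proof.
  destruct (Phi_surjective (gamma s)) as [x [y [Hx Hg]]].
  exists x, y. split; [now apply boundary_Phi_pos with s y|exact Hg].
Qed.

Lemma kinetic_pos (s : R) : 0 < kin s.
Proof.
  destruct (gamma_elliptic s) as [x [y [Hx ->]]]. rewrite kinetic_Phi by exact Hx.
  assert (H1 := wpot_pos x Hx). assert (H2 := vpot_bounds y). assert (H3 := vmin_pos).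
  apply Rdiv_lt_0_compat; [lra|]. apply Rmult_lt_0_compat; [apply pow_lt, foc_pos|now apply jac_pos].
Qed.

Lemma frame (s : R) :
  let n := nu s in
  let t := tangent gamma s in
  fst n ^ 2 + snd n ^ 2 = 1 /\ fst t ^ 2 + snd t ^ 2 = 1 /\ fst n * fst t + snd n * snd t = 0.
Proof.
  intros n t. destruct (inward_normal_cases s) as [c [Hcc Hn]].
  assert (Hsp := speed_pos s). assert (Hsq := speed_sqr s).
  assert (Ht : t = (/ speed s * dx s, / speed s * dy s)).
  { unfold t, tangent. rewrite norm_plane. reflexivity. }
  unfold n. rewrite Hn, Ht. unfold normal; simpl fst; simpl snd.
  assert (Hs2 : (dx s ^ 2 + dy s ^ 2) / (speed s * speed s) = 1).
  { rewrite Hsq. field. apply Rgt_not_eq, speed_sqr_pos. }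
  split; [|split].
  - transitivity (c * c * ((dx s ^ 2 + dy s ^ 2) / (speed s * speed s))); [field; lra|].
    rewrite Hs2. destruct Hcc as [-> | ->]; ring.
  - rewrite <- Hs2. field. lra.
  - field. lra.
Qed.

Lemma phase_velocity_coords (s alpha : R) :
  let k := sqrt (kin s) in
  let n := nu s in
  let t := tangent gamma s in
  phase_vel s alpha =
  (k * (cos alpha * fst n + sin alpha * fst t), k * (cos alpha * snd n + sin alpha * snd t)).
Proof. reflexivity. Qed.

Lemma dot_phase_velocity (s alpha : R) :
  dot (phase_vel s alpha) (nu s) =
  sqrt (kin s) * cos alpha.
Proof.
  destruct (frame s) as [Hn [Ht Hnt]]. rewrite phase_velocity_coords. cbv zeta.
  set (k := sqrt (2 * _)). clearbody k.
  set (n := nu s) in *. set (t := tangent gamma s) in *. clearbody n t.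
  unfold dot; simpl fst; simpl snd.
  transitivity (k * (cos alpha * (fst n ^ 2 + snd n ^ 2) + sin alpha * (fst n * fst t + snd n * snd t))); [ring|].
  rewrite Hn, Hnt. ring.
Qed.

Lemma phase_space_phase_velocity (s alpha : R) : - (PI / 2) < alpha < PI / 2 ->
  phase_space c1 c2 m1 m2 h Omega gamma (gamma s) (phase_vel s alpha).
Proof.
  intros Ha. assert (Hk := kinetic_pos s). exists s. split; [reflexivity|]. split.
  - destruct (frame s) as [Hn [Ht Hnt]]. rewrite norm_plane, phase_velocity_coords. cbv zeta.
    set (n := nu s) in *. set (t := tangent gamma s) in *. clearbody n t.
    set (U := potential c1 c2 m1 m2 (gamma s)) in *. set (k := sqrt (2 * (h + U))).
    simpl fst; simpl snd.
    replace (_ + _) with (k ^ 2 * (cos alpha ^ 2 * (fst n ^ 2 + snd n ^ 2) + sin alpha ^ 2 * (fst t ^ 2 + snd t ^ 2)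
      + 2 * cos alpha * sin alpha * (fst n * fst t + snd n * snd t))) by ring.
    rewrite Hn, Ht, Hnt, cos2_sin2.
    replace (k ^ 2 * _) with (k ^ 2) by ring.
    rewrite pow2_sqrt by apply pow2_ge_0. unfold k. rewrite pow2_sqrt by lra. field.
  - rewrite dot_phase_velocity. apply Rmult_lt_0_compat; [now apply sqrt_lt_R0|]. apply cos_gt_0; lra.
Qed.

Lemma phase_space_angle (x v : plane) : phase_space c1 c2 m1 m2 h Omega gamma x v ->
  exists s alpha, - (PI / 2) < alpha < PI / 2 /\ x = gamma s /\
    v = phase_vel s alpha.
Proof.
  intros [s [-> [Hen Hdot]]].
  destruct (frame s) as [Hn [Ht Hnt]]. assert (Hk := kinetic_pos s).
  set (n := nu s) in *. set (t := tangent gamma s) in *.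
  set (a := dot v n) in *. set (b := dot v t).
  assert (Hv1 : fst v = a * fst n + b * fst t) by now apply orthonormal_expansion.
  assert (Hv2 : snd v = a * snd n + b * snd t).
  { etransitivity; [apply (orthonormal_expansion (snd n) (fst n) (snd t) (fst t) (snd v) (fst v)); lra|].
    unfold a, b, dot. ring. }
  assert (Hab : a ^ 2 + b ^ 2 = kin s).
  { assert (Hnv : norm v ^ 2 = a ^ 2 + b ^ 2).
    { rewrite norm_plane, pow2_sqrt.
      - rewrite Hv1, Hv2. transitivity (a ^ 2 * (fst n ^ 2 + snd n ^ 2) + b ^ 2 * (fst t ^ 2 + snd t ^ 2)
          + 2 * a * b * (fst n * fst t + snd n * snd t)); [ring|rewrite Hn, Ht, Hnt; ring].
      - apply sqr_sum_nonneg. }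
    lra. }
  destruct (cos_sin_atan_div a b Hdot) as [Hcos Hsin].
  rewrite Hab in Hcos, Hsin.
  assert (Hk' : 0 < sqrt (kin s)) by now apply sqrt_lt_R0.
  exists s, (atan (b / a)). split; [|split; [reflexivity|]].
  - assert (H := atan_bound (b / a)). lra.
  - rewrite phase_velocity_coords. cbv zeta. fold n t. rewrite Hcos, Hsin.
    apply injective_projections; cbn [fst snd]; [rewrite Hv1|rewrite Hv2]; field; lra.
Qed.

(** Reversal changes the sign of both components and reflection restores the normal one. This gives
    the outgoing angle of a flight whose arrival velocity is opposite to a known departure
    velocity. *)
Lemma reflect_opposite (s alpha : R) :
  reflect (nu s) (opp (phase_vel s alpha)) =
  phase_vel s (- alpha).
Proof.
  assert (Hd := dot_phase_velocity s alpha). rewrite !phase_velocity_coords in *. cbv zeta in *.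
  set (k := sqrt (2 * _)) in *. clearbody k.
  set (n := nu s) in *. set (t := tangent gamma s) in *. clearbody n t.
  rewrite cos_neg, sin_neg.
  set (p := k * (cos alpha * fst n + sin alpha * fst t)) in *.
  set (q := k * (cos alpha * snd n + sin alpha * snd t)) in *.
  assert (E : dot (opp ((p, q) : plane)) n = - (k * cos alpha)).
  { rewrite <- Hd. unfold dot; simpl. unfold opp; simpl. ring. }
  unfold reflect. rewrite E. apply injective_projections; simpl; unfold minus, plus, opp, scal; simpl;
    unfold mult, opp; simpl; unfold p, q; ring.
Qed.

Lemma focal_sum_continuous (s : R) :
  continuous (fun s => focal_sum (gamma s)) s.
Proof.
  assert (Hd : forall c : plane, continuous (fun s => distance (gamma s) c) s).
  { intros c.
    apply (continuous_ext (fun s => sqrt ((gx s - fst c) ^ 2 + (gy s - snd c) ^ 2))).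
    { intros s'. symmetry. apply distance_plane. }
    apply (continuous_comp (fun s => (gx s - fst c) ^ 2 + (gy s - snd c) ^ 2) sqrt); [|apply continuous_sqrt].
    apply continuity_pt_filterlim, sqr_dist_continuous. }
  apply (continuous_plus (V := R_NormedModule)); apply Hd.
Qed.

Lemma focal_sum_min : exists s0, forall s,
  focal_sum (gamma s0) <= focal_sum (gamma s).
Proof.
  assert (HPI := PI_RGT_0).
  destruct (continuity_ab_min (fun s => focal_sum (gamma s)) 0 (2 * PI)) as [m [Hm' _]]; [lra| |].
  - intros s _. apply continuity_pt_filterlim, focal_sum_continuous.
  - exists m. intros s. destruct (gamma_representative 0 s) as [s' [Hs' <-]]. apply Hm'. lra.
Qed.

(** * Flights near the minimum of the focal sum *)

Section Minimum.

Variables (s0 x0 y0 : R).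
Hypothesis Hmin : forall s,
  focal_sum (gamma s0) <= focal_sum (gamma s).
Hypothesis Hx0 : 0 < x0.
Hypothesis Hg0 : gamma s0 = Phi c1 c2 x0 y0.

Lemma min_elliptic (s x y : R) : 0 <= x -> gamma s = Phi c1 c2 x y -> x0 <= x.
Proof.
  intros Hx Hg. assert (H := Hmin s). rewrite Hg0, Hg, !focal_sum_Phi in H.
  assert (Hf := foc_pos). apply Rnot_lt_le. intros Hlt.
  assert (H1 := cosh_increasing x x0 ltac:(lra)). nra.
Qed.

Lemma below_min_not_boundary (p : plane) :
  focal_sum p < 2 * foc * cosh x0 -> ~ boundary Omega p.
Proof.
  intros Hp Hb. apply Hboundary in Hb. destruct Hb as [s ->].
  assert (H := Hmin s). rewrite Hg0, focal_sum_Phi in H. lra.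
Qed.

(** The focal sum stays below its boundary minimum on the segment from the midpoint to [p]; this
    segment starts in [Omega] and so cannot leave it. *)
Lemma below_min_in_Omega (p : plane) :
  focal_sum p < 2 * foc * cosh x0 -> Omega p.
Proof.
  intros Hp. assert (Hf := foc_pos).
  assert (Hch := cosh_increasing 0 x0 ltac:(lra)). rewrite cosh_0 in Hch.
  rewrite <- (ray_1 p).
  apply (path_stays Omega (fun r => (1 - r) * mx + r * fst p) (fun r => (1 - r) * my + r * snd p)).
  - intros r _. split; apply continuous_of_derive; auto_derive; exact I.
  - intros r Hr. apply below_min_not_boundary. change (focal_sum (ray p r) < 2 * foc * cosh x0).
    assert (H := focal_sum_ray p r Hr).
    destruct (Req_dec r 1) as [->|Hr1]; [lra|].
    assert (0 < (1 - r) * (2 * foc * cosh x0 - 2 * foc)) by (apply Rmult_lt_0_compat; nra).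
    assert (0 <= r * (2 * foc * cosh x0 - focal_sum p)) by (apply Rmult_le_pos; lra). lra.
  - change (Omega (ray p 0)). rewrite ray_0. apply segment_in_Omega. lra.
Qed.

Lemma push_inverse (x y p q : R) : 0 < x ->
  let A := sinh x * cos y in let B := cosh x * sin y in let v := push x y p q in
  p = (fst v * (A * ax - B * ay) + snd v * (A * ay + B * ax)) / (foc * jac x y) /\
  q = (fst v * (- B * ax - A * ay) + snd v * (- B * ay + A * ax)) / (foc * jac x y).
Proof.
  intros Hx A B v. assert (Hf := foc_pos). assert (Hj := jac_pos x y Hx). assert (Hu := axis_unit).
  assert (Hs := jac_sum x y). fold A B in Hs.
  assert (E : fst v = foc * ((A * ax - B * ay) * p + (- B * ax - A * ay) * q) /\
    snd v = foc * ((A * ay + B * ax) * p + (- B * ay + A * ax) * q)).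
  { unfold v, push, A, B; simpl; split; ring. }
  destruct E as [-> ->]. split.
  - transitivity (p * (foc * jac x y) / (foc * jac x y)); [field; lra|]. f_equal. rewrite Hs.
    transitivity (p * (foc * (A ^ 2 + B ^ 2)) * (ax ^ 2 + ay ^ 2)); [rewrite Hu|]; ring.
  - transitivity (q * (foc * jac x y) / (foc * jac x y)); [field; lra|]. f_equal. rewrite Hs.
    transitivity (q * (foc * (A ^ 2 + B ^ 2)) * (ax ^ 2 + ay ^ 2)); [rewrite Hu|]; ring.
Qed.

Lemma lift_exists : exists (xb yb : R -> R) (d : R), 0 < d /\ xb s0 = x0 /\ yb s0 = y0 /\
  forall s, Rabs (s - s0) < d -> 0 < xb s /\ ex_derive xb s /\ ex_derive yb s /\
    gamma s = Phi c1 c2 (xb s) (yb s).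
Proof.
  assert (Hd : forall s, ex_derive (fun s => ucoord (gamma s)) s /\ ex_derive (fun s => wcoord (gamma s)) s).
  { intros s. destruct (curve_C1 s) as [Hx [Hy _]]. assert (Hf := foc_pos).
    split; [change (ex_derive (fun s => ((gx s - mx) * ax + (gy s - my) * ay) / foc) s)
           |change (ex_derive (fun s => ((gx s - mx) * - ay + (gy s - my) * ax) / foc) s)];
      auto_derive; repeat split; try (eexists; eassumption). }
  destruct (elliptic_lift (fun s => ucoord (gamma s)) (fun s => wcoord (gamma s)) s0 x0 y0) as [xb [yb [d [Hd0 [Hxb [Hyb H]]]]]].
  - intros s. apply Hd.
  - intros s. apply Hd.
  - exact Hx0.
  - rewrite Hg0, Phi_to_plane. apply coords_to_plane.
  - rewrite Hg0, Phi_to_plane. apply coords_to_plane.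
  - exists xb, yb, d. repeat (split; [assumption|]). intros s Hs.
    destruct (H s Hs) as [H1 [H2 [H3 [H4 H5]]]]. repeat (split; [assumption|]).
    rewrite Phi_to_plane, <- H4, <- H5. apply to_plane_coords.
Qed.

(** * The boundary near the minimum in elliptic coordinates *)

Section Lift.

Variables (xb yb : R -> R) (d : R).
Hypothesis Hd : 0 < d.
Hypothesis Hxb0 : xb s0 = x0.
Hypothesis Hyb0 : yb s0 = y0.
Hypothesis Hlift : forall s, Rabs (s - s0) < d -> 0 < xb s /\ ex_derive xb s /\ ex_derive yb s /\
  gamma s = Phi c1 c2 (xb s) (yb s).

Lemma lift_ge (s : R) : Rabs (s - s0) < d -> x0 <= xb s.
Proof.
  intros Hs. destruct (Hlift s Hs) as [H1 [_ [_ H2]]]. apply min_elliptic with s (yb s); [lra|exact H2].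
Qed.

Lemma lift_velocity (s : R) : Rabs (s - s0) < d ->
  dx s = fst (push (xb s) (yb s) (Derive xb s) (Derive yb s)) /\
  dy s = snd (push (xb s) (yb s) (Derive xb s) (Derive yb s)).
Proof.
  intros Hs. destruct (Hlift s Hs) as [_ [H1 [H2 _]]].
  destruct (is_derive_Phi xb yb s _ _ (Derive_correct _ _ H1) (Derive_correct _ _ H2)) as [E1 E2].
  assert (Hloc : locally s (fun s' => gamma s' = Phi c1 c2 (xb s') (yb s'))).
  { apply locally_R. exists (d - Rabs (s - s0)). split; [lra|]. intros s' Hs'. apply Hlift.
    replace (s' - s0) with ((s' - s) + (s - s0)) by ring. eapply Rle_lt_trans; [apply Rabs_triang|lra]. }
  split; apply is_derive_unique; unfold gx, gy.
  - refine (is_derive_ext_loc _ _ _ _ _ E1). refine (filter_imp _ _ _ Hloc). now intros s' ->.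
  - refine (is_derive_ext_loc _ _ _ _ _ E2). refine (filter_imp _ _ _ Hloc). now intros s' ->.
Qed.

(** The lift is only given as differentiable. Inverting [push] expresses its derivatives through the
    velocity of [gamma], which is continuous. *)
Lemma lift_C1 : continuous (Derive xb) s0 /\ continuous (Derive yb) s0.
Proof.
  destruct (Hlift s0 (Rabs_self_lt s0 d Hd)) as [Hx [Hdx [Hdy _]]].
  destruct (curve_C1 s0) as [_ [_ [Hcx Hcy]]].
  assert (Hf := foc_pos). assert (Hj := jac_pos (xb s0) (yb s0) Hx).
  set (a := fun s => sinh (xb s) * cos (yb s) / (foc * jac (xb s) (yb s))).
  set (b := fun s => cosh (xb s) * sin (yb s) / (foc * jac (xb s) (yb s))).
  assert (Hlin : forall p q, continuous (fun s => p * a s + q * b s) s0).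
  { intros p q. apply continuous_of_derive. unfold a, b, jac in *. auto_derive.
    repeat split; auto; simpl in Hj; apply Rgt_not_eq, Rmult_lt_0_compat; lra. }
  assert (Hcomb : forall p1 q1 p2 q2,
    continuous (fun s => dx s * (p1 * a s + q1 * b s) + dy s * (p2 * a s + q2 * b s)) s0).
  { intros p1 q1 p2 q2. apply (continuous_plus (V := R_NormedModule)).
    - apply (continuous_mult (K := R_AbsRing) (dx)); [exact Hcx|apply Hlin].
    - apply (continuous_mult (K := R_AbsRing) (dy)); [exact Hcy|apply Hlin]. }
  split; [apply (continuous_ext_loc _ (fun s => dx s * (ax * a s + - ay * b s) + dy s * (ay * a s + ax * b s)))
         |apply (continuous_ext_loc _ (fun s => dx s * (- ay * a s + - ax * b s) + dy s * (ax * a s + - ay * b s)))];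
    try apply Hcomb; apply locally_R; exists d; (split; [exact Hd|]); intros s Hs;
    destruct (Hlift s Hs) as [Hxs _]; destruct (lift_velocity s Hs) as [-> ->];
    assert (Hjs := jac_pos (xb s) (yb s) Hxs);
    assert (E := push_inverse (xb s) (yb s) (Derive xb s) (Derive yb s) Hxs); cbv zeta in E;
    destruct E as [E1 E2]; symmetry;
    [etransitivity; [exact E1|]|etransitivity; [exact E2|]];
    match goal with |- ?y = ?z => change (@eq R y z) end; unfold a, b; field; lra.
Qed.

(** [xb] attains its minimum at [s0], and the velocity of [gamma] does not vanish. *)
Lemma lift_critical : Derive xb s0 = 0 /\ Derive yb s0 <> 0.
Proof.
  assert (H0 := Rabs_self_lt s0 d Hd).
  assert (Hx : Derive xb s0 = 0).
  { destruct (Hlift s0 H0) as [_ [Hdx _]]. apply ex_derive_Reals_0 in Hdx.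
    rewrite <- (Derive_Reals xb s0 Hdx). apply (deriv_minimum xb (s0 - d) (s0 + d)); try lra.
    intros s H1 H2. rewrite Hxb0. apply lift_ge. apply Rabs_def1; lra. }
  split; [exact Hx|]. intros Hy.
  destruct (lift_velocity s0 H0) as [E1 E2]. rewrite Hx, Hy in E1, E2.
  assert (H := speed_sqr_pos s0). rewrite E1, E2 in H. unfold push in H; simpl in H.
  rewrite !Rmult_0_r, !Rplus_0_r, !Rmult_0_r, Rmult_0_l, Rplus_0_r in H. lra.
Qed.

(** At [s0] the vector [(wx, wy)] to the midpoint enters [Omega], since the focal sum decreases
    along it. Its normal component is a positive multiple of [Derive yb s0], so the sign that
    selects the inward normal is also the sign of this derivative. *)
Lemma lift_orientation : exists sg d', 0 < d' <= d /\ is_sign sg /\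
  forall s, Rabs (s - s0) < d' ->
    nu s = normal sg s /\
    0 < sg * Derive yb s.
Proof.
  assert (H0 := Rabs_self_lt s0 d Hd). assert (Hf := foc_pos). assert (Hu := axis_unit).
  destruct (inward_normal_transversal s0 1 Rlt_0_1) as [sg [d1 [Hd1 [Hsg [Hn _]]]]].
  destruct lift_C1 as [_ Hcy]. destruct lift_critical as [Hx Hy].
  assert (Hchx := cosh_increasing 0 x0 ltac:(lra)). rewrite cosh_0 in Hchx.
  assert (Hshx := sinh_pos x0 Hx0).
  set (wx := mx - gx s0). set (wy := my - gy s0).
  assert (Egx : gx s0 = fst (Phi c1 c2 x0 y0)) by (unfold gx; now rewrite Hg0).
  assert (Egy : gy s0 = snd (Phi c1 c2 x0 y0)) by (unfold gy; now rewrite Hg0).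
  rewrite Phi_to_plane in Egx, Egy. unfold to_plane in Egx, Egy; simpl in Egx, Egy.
  assert (HwN : wy * dx s0 - wx * dy s0 = foc ^ 2 * (cosh x0 * sinh x0) * Derive yb s0).
  { destruct (lift_velocity s0 H0) as [-> ->]. rewrite Hx, Hxb0, Hyb0. unfold wx, wy. rewrite Egx, Egy.
    unfold push; simpl.
    transitivity (foc ^ 2 * (cosh x0 * sinh x0) * Derive yb s0 * ((cos y0 ^ 2 + sin y0 ^ 2) * (ax ^ 2 + ay ^ 2))); [ring|].
    rewrite Hu, cos2_sin2. ring. }
  assert (Hsee : 0 < dot (nu s0) (wx, wy)).
  { apply (inward_normal_sees).
    - exists 1. split; [lra|]. intros t Ht. apply below_min_in_Omega.
      assert (H := focal_sum_ray (gamma s0) (1 - t) ltac:(lra)). rewrite Hg0, focal_sum_Phi, <- Hg0 in H.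
      replace (gx s0 + t * wx, gy s0 + t * wy) with (ray (gamma s0) (1 - t))
        by (unfold wx, wy, ray, gx, gy; f_equal; ring).
      assert (0 < t * (2 * foc * cosh x0 - 2 * foc)) by (apply Rmult_lt_0_compat; nra). lra.
    - rewrite HwN. apply Rmult_integral_contrapositive_currified; [|exact Hy]. apply Rgt_not_eq.
      apply Rmult_lt_0_compat; [now apply pow_lt|nra]. }
  rewrite (Hn s0 (Rabs_self_lt s0 d1 Hd1)) in Hsee. unfold dot, normal in Hsee; simpl in Hsee.
  assert (Hsp := speed_pos s0).
  replace (- sg * dy s0 / speed s0 * wx + sg * dx s0 / speed s0 * wy)
    with (sg * (wy * dx s0 - wx * dy s0) / speed s0) in Hsee by (field; lra).
  rewrite HwN in Hsee.
  assert (Hpos : 0 < sg * Derive yb s0).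
  { apply Rmult_lt_reg_r with (foc ^ 2 * (cosh x0 * sinh x0) / speed s0).
    - apply Rdiv_lt_0_compat; [|lra]. apply Rmult_lt_0_compat; [now apply pow_lt|nra].
    - rewrite Rmult_0_l. eapply Rlt_le_trans; [exact Hsee|]. right. field. lra. }
  destruct (continuous_eps _ _ _ Hcy Hpos) as [d2 [Hd2 H2]].
  exists sg, (Rmin d (Rmin d1 d2)). split; [split; [now repeat apply Rmin_pos|apply Rmin_l]|].
  split; [exact Hsg|]. intros s Hs.
  split; [apply Hn; Rmin_lra|]. specialize (H2 s ltac:(Rmin_lra)). apply Rabs_def2 in H2.
  destruct Hsg as [-> | ->]; lra.
Qed.

Lemma lift_lipschitz (kappa : R) : 0 < kappa -> exists d', 0 < d' <= d /\
  forall s s', Rabs (s - s0) < d' -> Rabs (s' - s0) < d' ->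
    Rabs (xb s - xb s') <= kappa * Rabs (yb s - yb s').
Proof.
  intros Hk. destruct lift_C1 as [Hcx Hcy]. destruct lift_critical as [Hx Hy].
  set (m := Rabs (Derive yb s0) / 2).
  assert (Hm' : 0 < m) by (apply Rabs_pos_lt in Hy; unfold m; lra).
  destruct (continuous_eps _ _ (kappa * m) Hcx) as [d1 [Hd1 H1]]; [nra|].
  destruct (continuous_eps _ _ m Hcy Hm') as [d2 [Hd2 H2]].
  exists (Rmin d (Rmin d1 d2)). split; [split; [now repeat apply Rmin_pos|apply Rmin_l]|].
  intros s s' Hs Hs'.
  destruct (mean_value xb (Derive xb) s0 (Rmin d (Rmin d1 d2)) s s') as [c [Hcc Ec]]; [|exact Hs|exact Hs'|].
  { intros c Hcc. apply Derive_correct, Hlift. Rmin_lra. }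
  destruct (mean_value yb (Derive yb) s0 (Rmin d (Rmin d1 d2)) s s') as [c' [Hcc' Ec']]; [|exact Hs|exact Hs'|].
  { intros c' Hcc'. apply Derive_correct, Hlift. Rmin_lra. }
  rewrite Ec, Ec', !Rabs_mult, <- Rmult_assoc. apply Rmult_le_compat_r; [apply Rabs_pos|].
  specialize (H1 c ltac:(Rmin_lra)). rewrite Hx, Rminus_0_r in H1. specialize (H2 c' ltac:(Rmin_lra)).
  assert (Ht := Rabs_triang_inv (Derive yb s0) (Derive yb s0 - Derive yb c')).
  replace (Derive yb s0 - (Derive yb s0 - Derive yb c')) with (Derive yb c') in Ht by ring.
  rewrite (Rabs_minus_sym (Derive yb s0)) in Ht.
  assert (m <= Rabs (Derive yb c')) by (unfold m in *; lra). nra.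
Qed.

Lemma Phi_locally_injective (x y x' y' : R) : 0 < x -> 0 < x' -> Rabs (y - y') < 1 ->
  Phi c1 c2 x y = Phi c1 c2 x' y' -> x = x' /\ y = y'.
Proof.
  intros Hx Hx' Hy E. assert (Hf := foc_pos).
  assert (Ech : cosh x = cosh x').
  { assert (H := focal_sum_Phi x y). rewrite E, focal_sum_Phi in H. nra. }
  assert (Ex : x = x').
  { destruct (Rtotal_order x x') as [H|[H|H]]; [|exact H|].
    - assert (Hi := cosh_increasing x x' ltac:(lra)). lra.
    - assert (Hi := cosh_increasing x' x ltac:(lra)). lra. }
  split; [exact Ex|]. subst x'. apply Phi_coords in E. destruct E as [E1 E2].
  assert (Hcx := cosh_pos x). assert (Hsx := sinh_pos x Hx).
  assert (E3 : cos y = cos y') by (apply Rmult_eq_reg_l with (cosh x); lra).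
  assert (E4 : sin y = sin y') by (apply Rmult_eq_reg_l with (sinh x); lra).
  assert (Hs : sin (y - y') = 0) by (rewrite sin_minus, E3, E4; ring).
  assert (HPI := PI2_1). apply Rabs_def2 in Hy.
  destruct (Rtotal_order y y') as [H|[H|H]]; [|exact H|].
  - assert (Hp : 0 < sin (- (y - y'))) by (apply sin_gt_0; lra). rewrite sin_neg in Hp. lra.
  - assert (Hp : 0 < sin (y - y')) by (apply sin_gt_0; lra). lra.
Qed.

Lemma lift_continuous (e : R) : 0 < e -> exists d', 0 < d' <= d /\
  forall s, Rabs (s - s0) < d' -> Rabs (xb s - x0) < e /\ Rabs (yb s - y0) < e.
Proof.
  intros He. destruct (Hlift s0 (Rabs_self_lt s0 d Hd)) as [_ [Hdx [Hdy _]]].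
  apply continuous_of_derive in Hdx, Hdy.
  destruct (continuous_eps _ _ _ Hdx He) as [d1 [Hd1 H1]].
  destruct (continuous_eps _ _ _ Hdy He) as [d2 [Hd2 H2]].
  exists (Rmin d (Rmin d1 d2)). split; [split; [now repeat apply Rmin_pos|apply Rmin_l]|].
  intros s Hs. rewrite <- Hxb0, <- Hyb0.
  split; [apply H1|apply H2]; Rmin_lra.
Qed.

Lemma Phi_continuity (x y : R) :
  continuity_2d_pt (fun x y => fst (Phi c1 c2 x y)) x y /\ continuity_2d_pt (fun x y => snd (Phi c1 c2 x y)) x y.
Proof.
  assert (Hm' : forall f g : R -> R, ex_derive f x -> ex_derive g y -> continuity_2d_pt (fun x y => f x * g y) x y).
  { intros f g Hf Hg. apply continuous_of_derive in Hf, Hg. apply continuity_pt_filterlim in Hf, Hg.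
    apply continuity_2d_pt_mult.
    - apply (continuity_1d_2d_pt_comp f (fun x _ => x)); [exact Hf|apply continuity_2d_pt_id1].
    - apply (continuity_1d_2d_pt_comp g (fun _ y => y)); [exact Hg|apply continuity_2d_pt_id2]. }
  assert (Hlin : forall a b c, continuity_2d_pt (fun x y => c + (a * (cosh x * cos y) + b * (sinh x * sin y))) x y).
  { intros a b c. repeat apply continuity_2d_pt_plus; try apply continuity_2d_pt_mult; try apply continuity_2d_pt_const;
      apply Hm'; auto_derive; exact I. }
  split; [refine (continuity_2d_pt_ext _ _ _ _ _ (Hlin (foc * ax) (- foc * ay) mx))
         |refine (continuity_2d_pt_ext _ _ _ _ _ (Hlin (foc * ay) (foc * ax) my))];
    intros x' y'; rewrite Phi_to_plane; unfold to_plane; simpl; ring.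
Qed.

Lemma lift_covers (d' : R) : 0 < d' -> d' <= d ->
  exists rho, 0 < rho /\ forall x y, 0 < x -> Rabs (x - x0) < rho -> Rabs (y - y0) < rho ->
    boundary Omega (Phi c1 c2 x y) -> exists s, Rabs (s - s0) < d' /\ xb s = x /\ yb s = y.
Proof.
  (* Two deviations from [y0] below 1/2 keep the angles within the distance 1 that
     [Phi_locally_injective] requires. *)
  intros Hd' Hdd. destruct (lift_continuous (1 / 2) ltac:(lra)) as [d1 [Hd1 H1]].
  destruct (local_parameter s0 (Rmin d' d1) ltac:(apply Rmin_pos; lra)) as [rho1 [Hrho1 Hloc]].
  destruct (Phi_continuity x0 y0) as [Hcx Hcy].
  destruct (Hcx (mkposreal _ Hrho1)) as [[r1 Hr1] Hx1]. destruct (Hcy (mkposreal _ Hrho1)) as [[r2 Hr2] Hx2].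
  simpl in Hx1, Hx2.
  exists (Rmin (1 / 2) (Rmin r1 r2)). split; [repeat apply Rmin_pos; lra|].
  intros x y Hx Hxx Hyy Hb. apply Hboundary in Hb. destruct Hb as [s Hs].
  destruct (Hloc s) as [s' [Hs' Hgs]].
  - unfold gx. rewrite <- Hs, Hg0. apply (Hx1 x y); Rmin_lra.
  - unfold gy. rewrite <- Hs, Hg0. apply (Hx2 x y); Rmin_lra.
  - exists s'. split; [Rmin_lra|]. destruct (H1 s' ltac:(Rmin_lra)) as [_ Hy1].
    destruct (Hlift s' ltac:(Rmin_lra)) as [Hxs [_ [_ Hgs']]].
    apply Phi_locally_injective; [exact Hxs|exact Hx| |congruence].
    replace (yb s' - y) with ((yb s' - y0) - (y - y0)) by ring.
    unfold Rminus at 1. eapply Rle_lt_trans; [apply Rabs_triang|]. rewrite Rabs_Ropp. Rmin_lra.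
Qed.

(** * Flights between boundary points near the minimum *)

(** The least [|p_xi|] on [|xi| >= x0] over a bound for [|p_eta|], both uniform in [eps > 0]. *)
Definition slope : R := sqrt (2 * wpot x0) / sqrt (2 * vmax).

Lemma slope_pos : 0 < slope.
Proof.
  assert (H1 := wpot_pos x0 Hx0). assert (H2 := vpot_bounds 0). assert (H3 := vmin_pos).
  apply Rdiv_lt_0_compat; apply sqrt_lt_R0; lra.
Qed.

(* The boundary near [gamma s0] is almost a curve [xi = x0], while near the
   separatrices an orbit crosses such curves with slope at least [slope]. *)
Lemma steep_avoids_boundary : exists d', 0 < d' <= d /\
  forall s x y, Rabs (s - s0) < d' -> x0 <= x < xb s -> slope * Rabs (y - yb s) <= xb s - x ->
    ~ boundary Omega (Phi c1 c2 x y).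
Proof.
  assert (Hsl := slope_pos).
  (* Half the slope of the orbit: a boundary point on the steep side would satisfy
     [xb s - x <= (xb s - x) / 2] with [x < xb s]. *)
  destruct (lift_lipschitz (slope / 2) ltac:(lra)) as [d1 [Hd1 H1]].
  destruct (lift_covers d1 ltac:(lra) ltac:(lra)) as [rho [Hrho H2]].
  set (e := Rmin (rho / 2) (slope * (rho / 2))).
  assert (He : 0 < e) by (apply Rmin_pos; nra).
  assert (He1 : e <= rho / 2 /\ e <= slope * (rho / 2)) by (unfold e; split; Rmin_lra).
  destruct (lift_continuous e He) as [d2 [Hd2 H3]].
  exists (Rmin d1 d2). split; [split; [apply Rmin_pos; lra|Rmin_lra]|].
  intros s x y Hs Hx Hy Hb.
  destruct (H3 s ltac:(Rmin_lra)) as [Hxs Hys]. apply Rabs_def2 in Hxs.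
  assert (Hyd : Rabs (y - yb s) < rho / 2).
  { apply Rmult_lt_reg_l with slope; [exact Hsl|]. lra. }
  destruct (H2 x y) as [s' [Hs' [Ex Ey]]]; [lra| | |exact Hb|].
  - apply Rabs_def1; lra.
  - replace (y - y0) with ((y - yb s) + (yb s - y0)) by ring. eapply Rle_lt_trans; [apply Rabs_triang|]. lra.
  - specialize (H1 s s' ltac:(Rmin_lra) Hs'). rewrite Ex, Ey, (Rabs_minus_sym (yb s)), Rabs_pos_eq in H1 by lra. lra.
Qed.

Lemma orbit_slope (eps a b sg t1 t2 : R) (xi eta : R -> R) :
  0 < eps -> eps < vmin -> is_sign sg -> a < t1 < b -> a < t2 < b -> t1 < t2 ->
  separated eps sg a b xi eta ->
  xi t2 < xi t1 /\
  ((forall t, t1 <= t <= t2 -> x0 <= Rabs (xi t)) -> slope * Rabs (eta t2 - eta t1) <= xi t1 - xi t2).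
Proof.
  intros He Hev Hsg Ht1 Ht2 Ht HD.
  destruct (MVT_cor2 xi (fun t => - pxi eps (xi t)) t1 t2 Ht) as [c [Ec Hcc]].
  { intros c Hcc. apply is_derive_Reals, HD. lra. }
  destruct (MVT_cor2 eta (fun t => sg * peta eps (eta t)) t1 t2 Ht) as [c' [Ec' Hcc']].
  { intros c' Hcc'. apply is_derive_Reals, HD. lra. }
  assert (Hp := pxi_pos eps (xi c) He). assert (Hq := peta_pos eps (eta c') Hev).
  split; [nra|]. intros Habs.
  assert (Hwx : wpot x0 <= wpot (xi c)).
  { assert (Hge := Habs c ltac:(lra)). destruct (Req_dec (Rabs (xi c)) x0) as [E|E].
    - right. rewrite <- E. apply even_Rabs, wpot_even.
    - left. rewrite <- (even_Rabs wpot (xi c) wpot_even). apply wpot_increasing. lra. }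
  assert (Hpl : sqrt (2 * wpot x0) <= pxi eps (xi c)) by (apply sqrt_le_1_alt; lra).
  assert (Hql : peta eps (eta c') <= sqrt (2 * vmax)).
  { apply sqrt_le_1_alt. assert (H := vpot_bounds (eta c')). lra. }
  assert (Hv : 0 < sqrt (2 * vmax)) by lra.
  assert (Hsl : slope * sqrt (2 * vmax) = sqrt (2 * wpot x0)) by (unfold slope; field; lra).
  assert (Hslp := slope_pos).
  rewrite Ec', Rabs_mult, (Rabs_pos_eq (t2 - t1)), Rabs_mult, (Rabs_pos_eq (peta _ _)) by lra.
  replace (Rabs sg) with 1 by (destruct Hsg as [-> | ->]; [now rewrite Rabs_R1|rewrite Rabs_left; lra]).
  replace (xi t1 - xi t2) with (pxi eps (xi c) * (t2 - t1)) by lra.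
  rewrite <- Rmult_assoc. apply Rmult_le_compat_r; [lra|]. rewrite Rmult_1_l.
  eapply Rle_trans; [|exact Hpl]. rewrite <- Hsl. apply Rmult_le_compat_l; lra.
Qed.

(** At [eps = 0] this is the limit angle [tau (+-phi(s) - psi(s))] of the overview, with [sg] for
    [tau] and [sigma] for the sign of [phi], the direction in which [eta] moves. *)
Definition start_angle (sg sigma s eps : R) : R :=
  sg * (sigma * atan (peta eps (yb s) / pxi eps (xb s)) - atan (Derive xb s / Derive yb s)).

(* Every orbit with [eps > 0] passes between the centres and emerges on the
   sheet [xi < 0]; the deck transformation brings it back to [xi > 0] with both
   momenta reversed, so that the arrival velocity at [gamma s1] is opposite to
   the departure velocity there. *)
Lemma flight : exists sg d', 0 < d' <= d /\ is_sign sg /\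
  (forall s, Rabs (s - s0) < d' -> 0 < sg * Derive yb s) /\
  forall sigma s s1, is_sign sigma -> Rabs (s - s0) < d' -> Rabs (s1 - s0) < d' ->
  forall e1, 0 < e1 -> exists eps, 0 < eps < e1 /\
    (- (PI / 2) < start_angle sg sigma s eps < PI / 2 -> - (PI / 2) < start_angle sg sigma s1 eps < PI / 2 ->
     billiard_map c1 c2 m1 m2 h Omega gamma
      (gamma s) (phase_vel s (start_angle sg sigma s eps))
      (gamma s1) (phase_vel s1 (- start_angle sg sigma s1 eps))).
Proof.
  destruct lift_orientation as [sg [d1 [Hd1 [Hsg Hor]]]].
  destruct steep_avoids_boundary as [d2 [Hd2 Hav]].
  exists sg, (Rmin d1 d2).
  split; [split; [apply Rmin_pos; lra|Rmin_lra]|]. split; [exact Hsg|].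
  split; [intros s Hs; apply Hor; Rmin_lra|].
  intros sigma s s1 Hsi Hs Hs1 e1 He1.
  assert (Hsab : Rabs (s - s0) < d1 /\ Rabs (s - s0) < d2) by (split; Rmin_lra). destruct Hsab as [Hsa Hsb].
  assert (Hs1ab : Rabs (s1 - s0) < d1 /\ Rabs (s1 - s0) < d2) by (split; Rmin_lra). destruct Hs1ab as [Hs1a Hs1b].
  destruct (Hlift s ltac:(lra)) as [Hxs [_ [_ Hgs]]]. destruct (Hlift s1 ltac:(lra)) as [Hxs1 [_ [_ Hgs1]]].
  destruct (Hor s Hsa) as [Hns Hys]. destruct (Hor s1 Hs1a) as [Hns1 Hys1].
  assert (Hsi2 := sign_sqr _ Hsi).
  destruct (wpot_quadratic (xb s1) Hxs1) as [C [HC HCq]].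
  (* The times are measured in the increasing quantities [- xi] and [sigma * eta]. The target is the
     deck image [(- xb s1, - yb s1)] up to full turns, hence the end points [xb s1] and
     [- sigma * yb s1]. *)
  destruct (time_matching wpot vpot C vmin vmax (- xb s) (xb s1) (sigma * yb s) (- sigma * yb s1))
    with (e1 := e1) as [n [eps [He [Hev [Hpq Htime]]]]]; auto using wpot_continuous, vpot_continuous, wpot_nonneg, vmin_pos, vpot_bounds.
  { lra. }
  exists eps. split; [exact He|]. intros Ha Ha1.
  set (L := - sigma * yb s1 + 2 * INR n * PI) in *.
  destruct (orbit_exists sigma eps (xb s) (xb s1) (yb s) L Hsi) as
    [T [a [b [xi [eta [HT [Ha0 [HTb [HD [Exi0 [ExiT [Eeta0 EetaT]]]]]]]]]]]]; try tauto.
  set (X := fun t => Phi c1 c2 (xi t) (eta t)).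
  assert (EL : sigma * L = - yb s1 + sigma * (2 * INR n * PI)).
  { unfold L. transitivity (- (sigma * sigma) * yb s1 + sigma * (2 * INR n * PI)); [ring|rewrite Hsi2; ring]. }
  rewrite EL in EetaT.
  assert (Epv : forall r, Rabs (r - s0) < d1 -> phase_vel r (start_angle sg sigma r eps) =
    scal (/ (foc ^ 2 * jac (xb r) (yb r))) (push (xb r) (yb r) (- pxi eps (xb r)) (sigma * peta eps (yb r)))).
  { intros r Hr. destruct (Hor r Hr) as [Hnr Hyr]. destruct (lift_velocity r ltac:(lra)) as [Hvx Hvy].
    destruct (Hlift r ltac:(lra)) as [Hxr [_ [_ Hgr]]]. apply phase_velocity_push; tauto. }
  destruct (shifted_deck (xb s1) (yb s1) sigma n Hsi) as [Ecos [EPhi Epush]].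
  assert (Epeta1 : peta eps (eta T) = peta eps (yb s1)) by (unfold peta, vpot; now rewrite EetaT, Ecos).
  assert (Epv1' : physical_velocity c1 c2 X T = opp (phase_vel s1 (start_angle sg sigma s1 eps))).
  { unfold X. destruct (HD T ltac:(lra)) as [Hdx Hdy].
    rewrite (physical_velocity_Phi xi eta T _ _ Hdx Hdy), (Epv s1 Hs1a), Epeta1, ExiT, EetaT, pxi_even, Epush.
    unfold jac. rewrite cosh_even, Ecos.
    apply injective_projections; simpl; unfold opp, scal; simpl; unfold mult; simpl; ring. }
  assert (EXT : X T = gamma s1) by (unfold X; now rewrite ExiT, EetaT, Hgs1).
  split; [now apply phase_space_phase_velocity|].
  exists T, X, s1. split; [|split; [|split; [|split; [|split; [|split]]]]].
  - exists a, b, xi, eta, (fun t => - pxi eps (xi t)), (fun t => sigma * peta eps (eta t)).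
    split; [exact Ha0|]. split; [exact HTb|]. split; [|reflexivity].
    apply separated_orbit; tauto.
  - unfold X. now rewrite Exi0, Eeta0, Hgs.
  - unfold X. destruct (HD 0 ltac:(lra)) as [Hdx Hdy].
    rewrite (physical_velocity_Phi xi eta 0 _ _ Hdx Hdy), Exi0, Eeta0. symmetry. now apply Epv.
  - split; [exact HT|]. split; [rewrite EXT; apply Hboundary; now exists s1|].
    intros t Ht.
    assert (Hdec : forall t1 t2, a < t1 < b -> a < t2 < b -> t1 < t2 -> xi t2 < xi t1).
    { intros t1 t2 H1 H2 H3. apply (orbit_slope eps a b sigma t1 t2 xi eta); tauto. }
    assert (Hmono : forall t1 t2, a < t1 < b -> a < t2 < b -> t1 <= t2 -> xi t2 <= xi t1).
    { intros t1 t2 H1 H2 [H3|<-]; [left; now apply Hdec|lra]. }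
    (* Three stages: the layer near the start, where the orbit is too steep to meet the boundary;
       the layer near the end, the same situation around [s1] after the deck transformation; and
       between them the interior of the ellipse [xi = x0]. *)
    destruct (Rle_lt_dec x0 (xi t)) as [Hpos|Hpos]; [|destruct (Rle_lt_dec (xi t) (- x0)) as [Hneg|Hneg]].
    + unfold X. apply (Hav s (xi t) (eta t) Hsb).
      * split; [exact Hpos|]. rewrite <- Exi0. apply Hdec; lra.
      * rewrite <- Exi0, <- Eeta0.
        apply (orbit_slope eps a b sigma 0 t xi eta); try tauto; try lra.
        intros t' Ht'. assert (H := Hmono t' t ltac:(lra) ltac:(lra) ltac:(lra)).
        rewrite Rabs_pos_eq; lra.
    + unfold X. rewrite <- (proj1 (proj2 (shifted_deck (xi t) (eta t) sigma n Hsi))).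
      apply (Hav s1 (- xi t) (- eta t + sigma * (2 * INR n * PI)) Hs1b).
      * split; [lra|]. assert (H := Hdec t T ltac:(lra) ltac:(lra) ltac:(lra)). lra.
      * replace (- eta t + sigma * (2 * INR n * PI) - yb s1) with (eta T - eta t) by (rewrite EetaT; ring).
        replace (xb s1 - - xi t) with (xi t - xi T) by (rewrite ExiT; ring).
        apply (orbit_slope eps a b sigma t T xi eta); try tauto; try lra.
        intros t' Ht'. assert (H := Hmono t t' ltac:(lra) ltac:(lra) ltac:(lra)).
        rewrite Rabs_left; lra.
    + apply below_min_not_boundary. unfold X. rewrite focal_sum_Phi.
      assert (Hf := foc_pos). apply Rmult_lt_compat_l; [lra|].
      rewrite <- (even_Rabs cosh (xi t) cosh_even).
      apply cosh_increasing. split; [apply Rabs_pos|]. apply Rabs_def1; lra.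
  - exact EXT.
  - reflexivity.
  - cbv zeta. rewrite Epv1'. split; [|symmetry; apply reflect_opposite].
    assert (Hd1' := dot_phase_velocity s1 (start_angle sg sigma s1 eps)).
    assert (Hcos : 0 < cos (start_angle sg sigma s1 eps)) by (apply cos_gt_0; lra).
    assert (Hk := sqrt_lt_R0 _ (kinetic_pos s1)).
    set (w := phase_vel s1 (start_angle sg sigma s1 eps)) in *.
    assert (E : dot (opp w) (nu s1) = - dot w (nu s1)).
    { unfold dot, opp; simpl; unfold opp; simpl. ring. }
    rewrite E, Hd1'. assert (Hkc := Rmult_lt_0_compat _ _ Hk Hcos). lra.
Qed.

(* If [xb] were constant near [s0], the polynomial equation of the ellipse
   [xi = x0] would hold on the whole curve by analytic continuation. *)
Lemma lift_not_constant : ~ is_ellipse_with_foci c1 c2 (boundary Omega) ->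
  forall e, 0 < e -> exists s, Rabs (s - s0) < e /\ Rabs (s - s0) < d /\ Derive xb s <> 0.
Proof.
  intros Hnot e He. apply NNPP. intros Hno. apply Hnot.
  assert (Hf := foc_pos). assert (HC := cosh_pos x0). assert (HS := sinh_pos x0 Hx0).
  assert (HC1 := cosh_increasing 0 x0 ltac:(lra)). rewrite cosh_0 in HC1.
  set (e' := Rmin e d). assert (He' : 0 < e') by now apply Rmin_pos.
  assert (He1 : e' <= e /\ e' <= d) by (unfold e'; split; Rmin_lra).
  assert (Hz : forall s, Rabs (s - s0) < e' -> Derive xb s = 0).
  { intros s Hs. apply NNPP. intros Hne. apply Hno. exists s. split; [lra|]. split; [lra|exact Hne]. }
  assert (Hcst : forall s, Rabs (s - s0) < e' -> xb s = x0).
  { intros s Hs. destruct (mean_value xb (Derive xb) s0 e' s s0) as [c [Hcc Ec]]; [|exact Hs|now apply Rabs_self_lt|].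
    - intros c Hcc. apply Derive_correct, Hlift. lra.
    - rewrite Hz in Ec by exact Hcc. lra. }
  (* The ellipse equation cleared of denominators. It is polynomial in [gamma s], hence analytic
     along the whole curve, whereas [xb] exists only near [s0]. *)
  set (q := fun s => ucoord (gamma s) * ucoord (gamma s) * sinh x0 ^ 2 +
                     wcoord (gamma s) * wcoord (gamma s) * cosh x0 ^ 2).
  assert (Hq : forall s x y, gamma s = Phi c1 c2 x y ->
    q s = cosh x ^ 2 * (1 - sin y ^ 2) * sinh x0 ^ 2 + sinh x ^ 2 * sin y ^ 2 * cosh x0 ^ 2).
  { intros s x y E. unfold q. rewrite E, Phi_to_plane.
    destruct (coords_to_plane (cosh x * cos y) (sinh x * sin y)) as [-> ->]. rewrite <- cos2_sin2. ring. }
  assert (Hqan : forall s, analytic_at q s).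
  { intros s. destruct Hgamma as [_ [Han _]]. destruct (Han s) as [Hx Hy].
    assert (Hlin : forall p q a b, analytic_at (fun s => ((fst (gamma s) + p) * a + (snd (gamma s) + q) * b) * / foc) s)
      by (intros; repeat first [assumption|apply analytic_at_const|apply analytic_at_plus|apply analytic_at_mult]).
    assert (Hu : analytic_at (fun s => ucoord (gamma s)) s) by exact (Hlin (- mx) (- my) ax ay).
    assert (Hw : analytic_at (fun s => wcoord (gamma s)) s) by exact (Hlin (- mx) (- my) (- ay) ax).
    apply analytic_at_plus; apply analytic_at_mult; try apply analytic_at_const; now apply analytic_at_mult. }
  assert (Hqloc : locally s0 (fun s => q s = cosh x0 ^ 2 * sinh x0 ^ 2)).
  { apply locally_R. exists e'. split; [exact He'|]. intros s Hs.
    destruct (Hlift s ltac:(lra)) as [_ [_ [_ Hgs]]]. rewrite (Hq s _ _ Hgs), (Hcst s Hs). ring. }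
  assert (Hall : forall s, focal_sum (gamma s) = 2 * foc * cosh x0).
  { intros s. destruct (gamma_elliptic s) as [x [y [Hx Hg]]].
    assert (Hqs : q s = cosh x0 ^ 2 * sinh x0 ^ 2).
    { apply (analytic_identity q (Rmin s s0 - 1) (Rmax s s0 + 1) s0); auto;
        assert (H3 := Rmax_l s s0); assert (H4 := Rmax_r s s0); Rmin_lra. }
    rewrite (Hq s x y Hg) in Hqs. rewrite Hg, focal_sum_Phi. f_equal.
    destruct (Req_dec x x0) as [->|Hne]; [reflexivity|exfalso].
    assert (Hge := min_elliptic s x y ltac:(lra) Hg).
    assert (Hch := cosh_increasing x0 x ltac:(lra)).
    assert (Ha : 0 < cosh x ^ 2 - cosh x0 ^ 2) by nra.
    assert (Hb : 0 < sinh x ^ 2 - sinh x0 ^ 2) by (assert (H1 := cosh2_sinh2 x); assert (H2 := cosh2_sinh2 x0); lra).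
    assert (HA : 0 < (cosh x ^ 2 - cosh x0 ^ 2) * sinh x0 ^ 2) by (apply Rmult_lt_0_compat; [lra|now apply pow_lt]).
    assert (HB : 0 < (sinh x ^ 2 - sinh x0 ^ 2) * cosh x0 ^ 2) by (apply Rmult_lt_0_compat; [lra|now apply pow_lt]).
    assert (H3 := cos2_sin2 y). assert (H4 := pow2_ge_0 (sin y)). assert (H5 := pow2_ge_0 (cos y)).
    assert (E : (cosh x ^ 2 - cosh x0 ^ 2) * sinh x0 ^ 2 * (1 - sin y ^ 2) +
      (sinh x ^ 2 - sinh x0 ^ 2) * cosh x0 ^ 2 * sin y ^ 2 = 0) by lra.
    destruct (Rle_lt_dec (sin y ^ 2) (1 / 2)); nra. }
  exists (foc * cosh x0). split; [unfold foc at 1; unfold foc in Hf; nra|].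
  intros p. split.
  - intros Hb. apply Hboundary in Hb. destruct Hb as [s ->].
    change (focal_sum (gamma s) = 2 * (foc * cosh x0)). rewrite Hall. ring.
  (* It remains to see that the ellipse has no point outside the curve. The ray from the midpoint is
     in [Omega] up to [p]; if [p] were interior to [Omega], the prolonged ray would leave through a
     boundary point of strictly larger focal sum. *)
  - intros Hp. change (focal_sum p = 2 * (foc * cosh x0)) in Hp. rewrite <- Rmult_assoc in Hp.
    assert (Hlow : forall r, 0 <= r < 1 -> Omega (ray p r)).
    { intros r Hr. apply below_min_in_Omega. assert (H := focal_sum_ray p r ltac:(lra)). rewrite Hp in H.
      assert (0 < (1 - r) * (2 * foc * cosh x0 - 2 * foc)) by (apply Rmult_lt_0_compat; nra). lra. }
    assert (Hhigh : forall r, 1 < r -> 2 * foc * cosh x0 < focal_sum (ray p r)).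
    { intros r Hr. assert (Hir : 0 < / r < 1).
      { split; [apply Rinv_0_lt_compat; lra|]. rewrite <- Rinv_1. apply Rinv_lt_contravar; lra. }
      assert (H := focal_sum_ray (ray p r) (/ r) ltac:(lra)).
      rewrite ray_ray, Rinv_l, ray_1, Hp in H by lra.
      assert (H4 : 0 < (1 - / r) * (2 * foc * cosh x0 - 2 * foc)) by (apply Rmult_lt_0_compat; nra).
      apply Rmult_lt_reg_l with (/ r); lra. }
    split.
    + intros Hl. apply locally_singleton in Hl.
      destruct (ray_meets_boundary Omega (fst p) (snd p) (fst p - mx) (snd p - my) Hbounded) as [r [Hr Hb]].
      { now rewrite <- surjective_pairing. }
      { apply Rabs_sum_pos, sqr_sum_pos. intros [E1 E2]. assert (H := focal_sum_ray p 0 ltac:(lra)).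
        replace (ray p 0) with p in H by (apply injective_projections; simpl; lra). rewrite Hp in H. nra. }
      replace ((fst p + r * (fst p - mx), snd p + r * (snd p - my)) : plane) with (ray p (1 + r)) in Hb
        by (unfold ray; f_equal; ring).
      destruct (Req_dec r 0) as [->|Hr0].
      * rewrite Rplus_0_r, ray_1 in Hb. apply (proj1 Hb). now apply Hopen.
      * apply Hboundary in Hb. destruct Hb as [s Hs]. assert (H1 := Hall s). rewrite <- Hs in H1.
        specialize (Hhigh (1 + r) ltac:(lra)). lra.
    + intros Hl. apply locally_plane in Hl. destruct Hl as [r0 [Hr0 Hl]].
      set (B := Rabs (fst p - mx) + Rabs (snd p - my) + 1).
      assert (Hb1 := Rabs_pos (fst p - mx)). assert (Hb2 := Rabs_pos (snd p - my)).
      assert (HB : 0 < r0 / B) by (apply Rdiv_lt_0_compat; unfold B; lra).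
      assert (Hm' := Rmin_pos 1 (r0 / B) ltac:(lra) HB). set (t := Rmin 1 (r0 / B) / 2).
      assert (Ht : 0 < t < 1) by (unfold t; split; Rmin_lra).
      assert (HtB : Rabs (- t) < r0 / B) by (rewrite Rabs_Ropp, Rabs_pos_eq; unfold t; Rmin_lra).
      apply (Hl (ray p (1 - t))); [| |apply Hlow; lra]; unfold ray; cbn [fst snd].
      * replace (_ + _ - _) with (- t * (fst p - mx)) by ring. apply (mult_small _ _ B); [exact HtB|unfold B; lra].
      * replace (_ + _ - _) with (- t * (snd p - my)) by ring. apply (mult_small _ _ B); [exact HtB|unfold B; lra].
Qed.

(** Raising [eps] lowers [peta] and raises [pxi], so the first arctangent strictly decreases, while
    the second does not involve [eps]. The nonzero speed is what lets orders be transferred between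
    slices. *)
Lemma start_angle_derive (sg sigma s : R) :
  is_sign sg -> is_sign sigma -> Rabs (s - s0) < d ->
  exists l, l <> 0 /\ is_derive (start_angle sg sigma s) 0 l.
Proof.
  intros Hsg Hsi Hs. destruct (Hlift s Hs) as [Hx _].
  assert (HW := wpot_pos (xb s) Hx). assert (HV := vpot_bounds (yb s)). assert (Hv0 := vmin_pos).
  set (W := wpot (xb s)) in *. set (V := vpot (yb s)) in *.
  set (P := sqrt (2 * (W + 0))). set (Q := sqrt (2 * (V - 0))).
  assert (HP : 0 < P) by (apply sqrt_lt_R0; lra). assert (HQ : 0 < Q) by (apply sqrt_lt_R0; lra).
  set (l := sg * (sigma * ((- / Q * / P - Q * / P * / P * / P) * / (1 + (Q / P) ^ 2)))).
  exists l. split.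
  - assert (Hiq : 0 < / Q) by now apply Rinv_0_lt_compat. assert (Hip : 0 < / P) by now apply Rinv_0_lt_compat.
    assert (Hneg : - / Q * / P - Q * / P * / P * / P < 0).
    { assert (0 < / Q * / P) by now apply Rmult_lt_0_compat.
      assert (0 < Q * / P * / P * / P) by (repeat apply Rmult_lt_0_compat; assumption). lra. }
    assert (Hden : 0 < / (1 + (Q / P) ^ 2)).
    { apply Rinv_0_lt_compat. assert (H := pow2_ge_0 (Q / P)). lra. }
    unfold l. destruct Hsg as [-> | ->], Hsi as [-> | ->]; nra.
  - unfold start_angle, peta, pxi. fold W V. auto_derive.
    + split; [lra|]. split; [lra|]. split; [|exact I].
      replace (W + 0) with (W + 0) by ring. apply Rgt_not_eq. exact HP.
    + replace (V + - 0) with (V - 0) by ring. fold P Q. unfold l. simpl. field.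
      assert (0 < P ^ 2 + Q ^ 2) by nra. lra.
Qed.

Lemma start_angle_continuous (sg sigma : R) :
  is_sign sg -> continuous (fun s => start_angle sg sigma s 0) s0.
Proof.
  intros Hsg. destruct (Hlift s0 (Rabs_self_lt s0 d Hd)) as [Hx [Hdx [Hdy _]]].
  destruct lift_C1 as [Hcx Hcy]. destruct lift_critical as [Hx' Hy'].
  assert (HW := wpot_pos (xb s0) Hx). assert (HV := vpot_bounds (yb s0)). assert (Hv0 := vmin_pos).
  assert (Hphi : continuous (fun s => atan (peta 0 (yb s) / pxi 0 (xb s))) s0).
  { set (w := fun s => wpot (xb s)). set (v := fun s => vpot (yb s)).
    assert (Hw : ex_derive w s0) by (unfold w, wpot; auto_derive; repeat split; auto).
    assert (Hv : ex_derive v s0) by (unfold v, vpot; auto_derive; repeat split; auto).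
    assert (Hw0 : 0 < w s0) by exact HW. assert (Hv1 : 0 < v s0) by (unfold v; lra).
    assert (HP : 0 < sqrt (2 * (w s0 + 0))) by (apply sqrt_lt_R0; lra).
    apply continuous_of_derive.
    change (ex_derive (fun s => atan (sqrt (2 * (v s - 0)) / sqrt (2 * (w s + 0)))) s0).
    clearbody w v. auto_derive. repeat split; auto; lra. }
  assert (Hpsi : continuous (fun s => atan (Derive xb s / Derive yb s)) s0).
  { apply (continuous_comp (fun s => Derive xb s / Derive yb s) atan).
    - apply (continuous_mult (K := R_AbsRing) (Derive xb) (fun s => / Derive yb s)); [exact Hcx|].
      apply (continuous_comp (Derive yb) Rinv); [exact Hcy|].
      apply continuous_of_derive. auto_derive. exact Hy'.
    - apply continuous_of_derive. auto_derive. exact I. }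
  unfold start_angle. apply (continuous_scal_r (V := R_NormedModule) sg).
  apply (continuous_minus (V := R_NormedModule)); [|exact Hpsi].
  now apply (continuous_scal_r (V := R_NormedModule) sigma (fun s => atan (peta 0 (yb s) / pxi 0 (xb s)))).
Qed.

Lemma start_angle_s0 (sg sigma : R) :
  is_sign sg -> is_sign sigma ->
  - (PI / 2) < start_angle sg sigma s0 0 < PI / 2 /\
  - start_angle sg sigma s0 0 = start_angle sg (- sigma) s0 0.
Proof.
  intros Hsg Hsi. destruct lift_critical as [Hx' _]. unfold start_angle. rewrite Hx'.
  replace (0 / Derive yb s0) with 0 by (unfold Rdiv; ring). rewrite atan_0. split; [|ring].
  assert (H := atan_bound (peta 0 (yb s0) / pxi 0 (xb s0))).
  destruct Hsg as [-> | ->], Hsi as [-> | ->]; lra.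
Qed.

(** * The first integral near the minimum *)

Variable F : plane -> plane -> R.
Hypothesis HF : analytic_first_integral c1 c2 m1 m2 h Omega gamma F.

Definition on_section (s alpha : R) : R := F (gamma s) (phase_vel s alpha).

Lemma on_section_analytic (s alpha : R) : - (PI / 2) < alpha < PI / 2 ->
  analytic2_at on_section s alpha.
Proof. apply (proj1 HF). Qed.

Lemma constant_near_minimum : ~ is_ellipse_with_foci c1 c2 (boundary Omega) ->
  exists e c, 0 < e /\ forall s alpha, Rabs (s - s0) < e -> - (PI / 2) < alpha < PI / 2 ->
    on_section s alpha = c.
Proof.
  intros Hnot.
  destruct flight as [sg [d1 [Hd1 [Hsg [Hor Hfl]]]]].
  set (st := start_angle sg).
  assert (H1 := is_sign_1). assert (Hm1 := is_sign_m1).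
  assert (Hang : exists d2, 0 < d2 <= d1 /\ forall s sigma, is_sign sigma -> Rabs (s - s0) < d2 ->
    - (PI / 2) < st sigma s 0 < PI / 2).
  { destruct (continuous_between _ _ _ _ (start_angle_continuous sg 1 Hsg) (proj1 (start_angle_s0 sg 1 Hsg H1)))
      as [a [Ha Ha']].
    destruct (continuous_between _ _ _ _ (start_angle_continuous sg (-1) Hsg) (proj1 (start_angle_s0 sg (-1) Hsg Hm1)))
      as [b [Hb Hb']].
    exists (Rmin d1 (Rmin a b)). split; [split; [repeat apply Rmin_pos; lra|apply Rmin_l]|].
    intros s sigma [-> | ->] Hs; [apply Ha'|apply Hb']; Rmin_lra. }
  destruct Hang as [d2 [Hd2 Hang]].
  assert (Hder : forall s sigma, is_sign sigma -> Rabs (s - s0) < d2 ->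
    exists l, l <> 0 /\ is_derive (st sigma s) 0 l).
  { intros s sigma Hsi Hs. apply start_angle_derive; auto; lra. }
  assert (Hcont : forall s sigma, is_sign sigma -> Rabs (s - s0) < d2 -> continuous (st sigma s) 0).
  { intros s sigma Hsi Hs. destruct (Hder s sigma Hsi Hs) as [l [_ Hl]]. apply continuous_of_derive. now exists l. }
  assert (Hmeet : forall s s1 sigma, is_sign sigma -> Rabs (s - s0) < d2 -> Rabs (s1 - s0) < d2 ->
    meet (on_section s) (on_section s1) (st sigma s) (fun e => - st sigma s1 e)).
  { intros s s1 sigma Hsi Hs Hs1 e1 He1.
    assert (Hsmall : forall s, Rabs (s - s0) < d2 -> exists e0, 0 < e0 /\ forall e, 0 < e < e0 ->
      - (PI / 2) < st sigma s e < PI / 2).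
    { intros s' Hs'. destruct (continuous_between _ _ _ _ (Hcont s' sigma Hsi Hs') (Hang s' sigma Hsi Hs')) as [e0 [He0 H0]].
      exists e0. split; [exact He0|]. intros e He. apply H0. rewrite Rminus_0_r, Rabs_pos_eq; lra. }
    destruct (Hsmall s Hs) as [ea [Hea Ha]]. destruct (Hsmall s1 Hs1) as [eb [Heb Hb]].
    destruct (Hfl sigma s s1 Hsi ltac:(lra) ltac:(lra) (Rmin e1 (Rmin ea eb))) as [e [He Hb']].
    { now repeat apply Rmin_pos. }
    exists e. split; [Rmin_lra|]. symmetry. apply (proj2 HF). apply Hb'; [apply Ha|apply Hb]; Rmin_lra. }
  assert (Hslice : forall s alpha, - (PI / 2) < alpha < PI / 2 -> analytic_at (on_section s) alpha).
  { intros s alpha Ha. now apply analytic2_at_snd, on_section_analytic. }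
  assert (Hdneg : forall s sigma l, is_derive (st sigma s) 0 l -> is_derive (fun e => - st sigma s e) 0 (- l)).
  { intros s sigma l Hl. now apply (is_derive_opp (K := R_AbsRing) (V := R_NormedModule)). }
  assert (Hval : forall s s1 sigma, is_sign sigma -> Rabs (s - s0) < d2 -> Rabs (s1 - s0) < d2 ->
    on_section s (st sigma s 0) = on_section s1 (- st sigma s1 0)).
  { intros s s1 sigma Hsi Hs Hs1. assert (Ha := Hang s sigma Hsi Hs). assert (Ha1 := Hang s1 sigma Hsi Hs1).
    apply (meet_value (on_section s) (on_section s1) (st sigma s) (fun e => - st sigma s1 e)).
    - now apply analytic_at_continuous, Hslice.
    - apply analytic_at_continuous, Hslice. lra.
    - now apply Hcont.
    - apply (continuous_opp (V := R_NormedModule) (st sigma s1)). now apply Hcont.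
    - now apply Hmeet. }
  assert (Hs0 := Rabs_self_lt s0 d2 ltac:(lra)).
  (* Since [psi] vanishes at [s0], the limit angle after arrival at [s0] with [sigma = 1] is also
     the limit departure angle there with [sigma = -1]. This coincidence links the two families of
     flights. *)
  set (be := - st 1 s0 0).
  assert (Hbe : be = st (-1) s0 0).
  { unfold be, st. rewrite (proj2 (start_angle_s0 sg 1 Hsg H1)). f_equal. }
  assert (Hbeb : - (PI / 2) < be < PI / 2) by (unfold be; assert (H := Hang s0 1 H1 Hs0); lra).
  exists d2, (on_section s0 be). split; [lra|].
  destruct (Hder s0 1 H1 Hs0) as [l0 [Hl0 Hd0]].
  destruct (analytic_dichotomy _ _ (Hslice s0 be Hbeb)) as [Hloc|[k Hk]].
  (* Flights with [sigma = 1] carry local constancy from the slice at [s0] to the slice at [s],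
     which is then constant by the identity principle. *)
  - intros s alpha Hs Ha. destruct (Hder s 1 H1 Hs) as [l [Hl Hdl]].
    assert (Hst := Hang s 1 H1 Hs).
    apply (analytic_identity (on_section s) (- (PI / 2)) (PI / 2) (st 1 s 0)); auto.
    assert (Hv := Hval s s0 1 H1 Hs Hs0). fold be in Hv. rewrite <- Hv.
    apply (meet_constant (on_section s) (on_section s0) (st 1 s) (fun e => - st 1 s0 e) l (- l0)); auto.
  - exfalso.
    (* The comparison along flights is symmetric, so it yields both inequalities between the orders
       at [be] and at [st 1 s 0]. *)
    assert (Hord : forall s, Rabs (s - s0) < d2 -> has_order (on_section s) (st 1 s 0) k).
    { intros s Hs. destruct (Hder s 1 H1 Hs) as [l [Hl Hdl]].
      assert (Hst := Hang s 1 H1 Hs). assert (Hv := Hval s s0 1 H1 Hs Hs0).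
      assert (Hl0' : - l0 <> 0) by lra.
      destruct (analytic_dichotomy _ _ (Hslice s _ Hst)) as [Hc'|[k' Hk']].
      - exfalso. assert (Hcb : locally be (fun y => on_section s0 y = on_section s0 be)).
        { apply (meet_constant (on_section s0) (on_section s) (fun e => - st 1 s0 e) (st 1 s) (- l0) l); auto.
          apply meet_sym. now apply Hmeet. }
        destruct Hk as [_ [[m [M [r [Hm' [Hr Hb]]]]] _]]. apply locally_R in Hcb. destruct Hcb as [r' [Hr' Hcb]].
        set (y := be + Rmin r r' / 2). assert (Hmin' := Rmin_pos r r' Hr Hr').
        assert (Ey : Rabs (y - be) = Rmin r r' / 2) by (unfold y; rewrite Rabs_pos_eq; lra).
        destruct (Hb y) as [Hlow _]; [Rmin_lra|]. rewrite Hcb, Rminus_diag, Rabs_R0 in Hlow by Rmin_lra.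
        rewrite Ey in Hlow. assert (0 < m * (Rmin r r' / 2) ^ k) by (apply Rmult_lt_0_compat; [exact Hm'|apply pow_lt; lra]). lra.
      - replace k with k'; [exact Hk'|]. apply Nat.le_antisymm.
        + apply (meet_order_le (on_section s0) (on_section s) (fun e => - st 1 s0 e) (st 1 s) (- l0) l); auto.
          apply meet_sym. now apply Hmeet.
        + apply (meet_order_le (on_section s) (on_section s0) (st 1 s) (fun e => - st 1 s0 e) l (- l0)); auto. }
    destruct (Hord s0 Hs0) as [Hk1 [_ [_ HDk]]].
    assert (Hst0 := Hang s0 1 H1 Hs0).
    destruct (no_confluence on_section s0 (st 1 s0 0) k (on_section_analytic _ _ Hst0) Hk1 HDk) as [eta [Heta Hconf]].
    assert (Enm : st (-1) s0 0 = - st 1 s0 0) by (rewrite <- Hbe; reflexivity).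
    destruct (continuous_eps _ _ _ (start_angle_continuous sg 1 Hsg) Heta) as [da [Hda Ha]].
    destruct (continuous_eps _ _ _ (start_angle_continuous sg (-1) Hsg) Heta) as [db [Hdb Hb]].
    fold st in Ha, Hb.
    destruct (lift_not_constant Hnot (Rmin (Rmin eta d2) (Rmin da db))) as [s [Hs [Hsd Hne]]].
    { repeat apply Rmin_pos; lra. }
    assert (Hl : (Rabs (s - s0) < eta /\ Rabs (s - s0) < d2) /\ Rabs (s - s0) < da /\ Rabs (s - s0) < db)
      by (repeat split; Rmin_lra).
    (* The two angles are [sg * (phi - psi)] and [sg * (phi + psi)]: distinct as soon as
       [Derive xb s <> 0], and merging as [s] tends to [s0]. *)
    apply (Hconf s (st 1 s 0) (- st (-1) s 0)); [lra|apply Ha; lra| | | |].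
    + replace (- st (-1) s 0 - st 1 s0 0) with (- (st (-1) s 0 - st (-1) s0 0)) by (rewrite Enm; ring).
      rewrite Rabs_Ropp. apply Hb. lra.
    + assert (Hyp := Hor s ltac:(lra)). unfold st, start_angle. intros E.
      assert (Hpsi : atan (Derive xb s / Derive yb s) = 0) by (destruct Hsg as [-> | ->]; lra).
      assert (Hz : Derive xb s / Derive yb s = 0) by (rewrite <- (tan_atan (Derive xb s / Derive yb s)), Hpsi; apply tan_0).
      apply Hne. replace (Derive xb s) with (Derive xb s / Derive yb s * Derive yb s); [rewrite Hz; ring|].
      field. intros E0. rewrite E0 in Hyp. lra.
    (* Both values equal that at [be] on the slice of [s0]: one by flights from [s] to [s0] with
       [sigma = 1], the other by flights from [s0] to [s] with [sigma = -1]. *)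
    + rewrite (Hval s s0 1 H1 ltac:(lra) Hs0). fold be. rewrite Hbe. symmetry.
      rewrite (Hval s0 s (-1) Hm1 Hs0 ltac:(lra)). reflexivity.
    + apply (Hord s). lra.
Qed.

End Lift.

End Minimum.

(** * Continuation from the minimum to the whole phase space *)

(** Near [s0] the constant is the same for all angles, so for each fixed angle the identity
    principle extends it along the whole parameter line. *)
Lemma first_integral_constant (F : plane -> plane -> R) :
  analytic_first_integral c1 c2 m1 m2 h Omega gamma F ->
  ~ is_ellipse_with_foci c1 c2 (boundary Omega) ->
  exists c, forall x v, phase_space c1 c2 m1 m2 h Omega gamma x v -> F x v = c.
Proof.
  intros HF Hnot. destruct focal_sum_min as [s0 Hmin].
  destruct (gamma_elliptic s0) as [x0 [y0 [Hx0 Hg0]]].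
  destruct (lift_exists s0 x0 y0 Hx0 Hg0) as [xb [yb [d [Hd [Hxb [Hyb Hlift]]]]]].
  destruct (constant_near_minimum s0 x0 y0 Hmin Hx0 Hg0 xb yb d Hd Hxb Hyb Hlift F HF Hnot) as [e [c [He Hconst]]].
  exists c. intros x v Hxv. destruct (phase_space_angle x v Hxv) as [s [alpha [Ha [-> ->]]]].
  assert (H1 := Rmax_l s s0). assert (H2 := Rmax_r s s0).
  apply (analytic_identity (fun s => on_section F s alpha) (Rmin s s0 - 1) (Rmax s s0 + 1) s0 c).
  - intros s' _. apply analytic2_at_fst. now apply (proj1 HF).
  - split; Rmin_lra.
  - apply locally_R. exists e. split; [exact He|]. intros s' Hs'. now apply Hconst.
  - split; Rmin_lra.
Qed.

End Billiard.

Theorem theorem2 :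
  forall (c1 c2 : plane) (m1 m2 : R) (Omega : plane -> Prop)
    (gamma : R -> plane),
    c1 <> c2 ->
    m1 >= m2 -> m2 > 0 ->
    open Omega -> connected Omega -> bounded_set Omega ->
    contains_segment Omega c1 c2 ->
    parametrises_boundary gamma Omega ->
    ~ is_ellipse_with_foci c1 c2 (boundary Omega) ->
    forall h : R, h >= 0 ->
    forall F : plane -> plane -> R,
      analytic_first_integral c1 c2 m1 m2 h Omega gamma F ->
      exists c : R, forall x v : plane,
        phase_space c1 c2 m1 m2 h Omega gamma x v -> F x v = c.
Proof.
  intros c1 c2 m1 m2 Omega gamma Hc Hm Hm2 Hopen _ Hbounded Hseg [Hgamma Hboundary] Hnot h Hh F HF.
  eapply first_integral_constant; eassumption.
Qed.
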